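(* Let $k\neq0,-1$ be a complex number. The currents $S^1(z),S^2(z)$ defined in the context satisfy, for $i,j\in\{1,2\}$, the following commutation relations with the bosonized generators of $U_q[\widehat{sl(2|1)}]$ at level $k$: $$[h^i_n,S^j(w)]=0\quad(n\in\mathbb{Z}),\qquad [X^{+,i}(z),S^j(w)]=0,$$ $$[X^{-,i}(z),S^j(w)]=\delta_{ij}\;{}_{k+1}\partial_w\Big(-z^{-1}\,\delta\big(\tfrac wz\big):e^{-a^{*,i}(w;-\frac{k+1}2)}:\Big).$$ That is, the currents $S^i(z)$ (the $q$-screen currents) (anti-)commute with the action of $U_q[\widehat{sl(2|1)}]$ up to total differences.
   Context: **Conventions.** $q\in\mathbb{C}^\times$ generic (not a root of unity, with fixed $\ln q$), $[x]_q=\frac{q^x-q^{-x}}{q-q^{-1}}$, $[X,Y]=XY-(-1)^{[X][Y]}YX$ with $[X]\in\mathbb{Z}_2$ the parity; $X^{\pm,2}_n$ and $S^2$ are odd, $h^i_n$, $X^{\pm,1}_n$ and $S^1$ are even. $(a_{ij})_{i,j=1,2}=\begin{pmatrix}2&-1\\-1&0\end{pmatrix}$. $\delta(x)=\sum_{n\in\mathbb{Z}}x^n$ and ${}_\ell\partial_zf(z)=\frac{f(q^\ell z)-f(q^{-\ell}z)}{(q-q^{-1})z}$. Identities are identities of formal series, coefficientwise as operators on the Fock space below. **Oscillators.** $a^1_n,a^2_n,b^{12}_n,b^{13}_n,b^{23}_n,c_n$ ($n\in\mathbb{Z}$) and $Q_{a^1},Q_{a^2},Q_{b^{12}},Q_{b^{13}},Q_{b^{23}},Q_c$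 with $[a^i_m,a^j_n]=\delta_{m+n,0}\frac{[a_{ij}m]_q[(k+1)m]_q}{m}$, $[a^i_0,Q_{a^j}]=(k+1)a_{ij}$; $[b^{ij}_m,b^{i'j'}_n]=(-1)^{\delta_{j2}}\delta_{ii'}\delta_{jj'}\delta_{m+n,0}\frac{[m]_q^2}{m}$, $[b^{ij}_0,Q_{b^{i'j'}}]=(-1)^{\delta_{j2}}\delta_{ii'}\delta_{jj'}$; $[c_m,c_n]=\delta_{m+n,0}\frac{[m]_q^2}{m}$, $[c_0,Q_c]=1$; all other commutators vanish. For a pair $(a_n,Q_a)$ put $$a(z;\kappa)=-\sum_{n\ne0}\frac{a_n}{[n]_q}q^{-\kappa|n|}z^{-n}+Q_a+a_0\ln z,\qquad a_\pm(z)=\pm(q-q^{-1})\sum_{n>0}a_{\pm n}z^{\mp n}\pm a_0\ln q .$$ Normal ordering $:\ :$ puts $a_n$ ($n<0$) and $Q$'s to the left of $a_n$ ($n\ge0$). **Fock space.** The operators act on direct sums of Fock modules built by the negative modes on vectors $e^{\lambda_1Q_{a^1}+\lambda_2Q_{a^2}+\mu_{12}Q_{b^{12}}+\mu_{13}Q_{b^{13}}+\mu_{23}Q_{b^{23}}+\nu Q_c}|0\rangle$ with $\lambda_i\in\mathbb{C}$ and $\mu_{12},\mu_{13},\mu_{23},\nu\in\mathbb{Z}$, where all modes with $n\ge0$ kill $|0\rangle$. **Bosonized generators at level $k$.** $X^{\pm,i}(z)=\sum_nX^{\pm,i}_nz^{-n-1}$; $h^1_0=a^1_0+2b^{12}_0+b^{13}_0-b^{23}_0$,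 $h^2_0=a^2_0-b^{12}_0-b^{13}_0$, and for $m\ne0$ $h^1_m=a^1_mq^{-\frac{|m|}2}+b^{12}_mq^{-(\frac k2+1)|m|}(q^{|m|}+q^{-|m|})+b^{13}_mq^{-(\frac k2+2)|m|}-b^{23}_mq^{-(\frac k2+1)|m|}$, $h^2_m=a^2_mq^{-\frac{|m|}2}-b^{12}_mq^{-(\frac k2+1)|m|}-b^{13}_mq^{-(\frac k2+1)|m|}$, $$X^{+,1}(z)=-\tfrac1{(q-q^{-1})z}:e^{-b^{12}(z;-1)}\big(e^{-c(qz;0)}-e^{-c(q^{-1}z;0)}\big):e^{\sqrt{-1}\pi(c_0+b^{12}_0)},$$ $$X^{+,2}(z)=-:e^{-b^{12}_+(qz)-b^{13}_+(qz)+b^{23}(qz;0)}:e^{\sqrt{-1}\pi(c_0+b^{12}_0+b^{13}_0+b^{23}_0)}+:e^{b^{12}(z;0)+b^{13}(z;0)+c(z;0)}:,$$ $$X^{-,1}(z)=\tfrac1{(q-q^{-1})z}:\Big(e^{a^1_+(q^{\frac{k+1}2}z)+b^{12}(q^{k+2}z;1)+b^{13}_+(q^{k+2}z)-b^{23}_+(q^{k+1}z)+c(q^{k+1}z;0)}-e^{a^1_-(q^{-\frac{k+1}2}z)+b^{12}(q^{-k-2}z;1)+b^{13}_-(q^{-k-2}z)-b^{23}_-(q^{-k-1}z)+c(q^{-k-1}z;0)}\Big):e^{-\sqrt{-1}\pi(c_0+b^{12}_0)}$$ $$\qquad+q^{k+1}:e^{a^1_+(q^{\frac{k+1}2}z)-b^{13}(q^{k+1}z;0)+b^{23}(q^{k+1}z;-1)}:e^{\sqrt{-1}\pi(b^{13}_0+b^{23}_0)},$$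 $$X^{-,2}(z)=\tfrac1{(q-q^{-1})z}\Big(q:\big(e^{a^2_+(q^{\frac{k+1}2}z)-b^{23}(q^{k+1}z;0)}-e^{a^2_-(q^{-\frac{k+1}2}z)-b^{23}(q^{-k-1}z;0)}\big):e^{-\sqrt{-1}\pi(c_0+b^{12}_0+b^{13}_0+b^{23}_0)}$$ $$\qquad-:e^{a^2_-(q^{-\frac{k+1}2}z)-b^{12}(q^{-k-1}z;1)-b^{13}(q^{-k-1}z;1)}\big(e^{-c(q^{-k}z;0)}-e^{-c(q^{-k-2}z;0)}\big):\Big).$$ **Screen currents.** $a^{*,i}_m=\frac{[m]_q}{[(k+1)m]_q}a^i_m$ (at $m=0$: $\frac1{k+1}a^i_0$), $Q_{a^{*,i}}=\frac1{k+1}Q_{a^i}$, and $S^i(z)=:e^{-a^{*,i}(z;\frac{k+1}2)}:\tilde S^i(z)$ with $$\tilde S^1(z)=:e^{-b^{12}(z;0)-b^{12}_-(q^{-1}z)-b^{13}_-(q^{-1}z)+b^{23}_-(z)}\;{}_1\partial_z\,e^{-c(q^{-1}z;0)}:\,e^{\sqrt{-1}\pi(c_0+b^{12}_0)}+q:e^{b^{13}(z;0)-b^{23}(qz;0)+b^{23}_+(z)}:\,e^{-\sqrt{-1}\pi(b^{13}_0+b^{23}_0)},$$ $$\tilde S^2(z)=-q^{-1}:e^{b^{23}(z;0)}:\,e^{-\sqrt{-1}\pi(c_0+b^{12}_0+b^{13}_0+b^{23}_0)},$$ where ${}_1\partial_z$ acts only on $e^{-c(q^{-1}z;0)}$, giving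 $\frac{e^{-c(z;0)}-e^{-c(q^{-2}z;0)}}{(q-q^{-1})z}$. *)

(* Defs.v *)
From HB Require Import structures.
From mathcomp Require Import all_boot all_order all_algebra.
From mathcomp Require Import finmap multiset.
From mathcomp Require Import all_classical reals.
From mathcomp Require Import sequences trigo.
From mathcomp.real_closed Require Import complex.
From mathcomp.multinomials Require Import monalg.

Set Implicit Arguments.
Unset Strict Implicit.
Unset Printing Implicit Defensive.

Import Order.TTheory GRing.Theory Num.Theory.
Local Open Scope classical_set_scope.
Local Open Scope ring_scope.

Definition cexp (R : realType) (z : R[i]) : R[i] :=
  Complex (expR (complex.Re z) * cos (complex.Im z))
          (expR (complex.Re z) * sin (complex.Im z)).

(* The indices 1, 2 are the elements 0, 1 of 'I_2. *)
Definition cartan (i j : 'I_2) : int :=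
  if i != j then -1 else if i == 0 then 2 else 0.

(* Parity of X^{+,i}, X^{-,i} and S^i. *)
Definition parity (i : 'I_2) : bool := i == 1.

Inductive osc := Oa of 'I_2 | Ob12 | Ob13 | Ob23 | Oc.

Definition osc_code (s : osc) : 'I_2 + 'I_4 :=
  match s with
  | Oa i => inl i
  | Ob12 => inr 0 | Ob13 => inr 1 | Ob23 => inr 2%:R | Oc => inr 3%:R
  end.

Definition osc_decode (x : 'I_2 + 'I_4) : osc :=
  match x with
  | inl i => Oa i
  | inr l => nth Oc [:: Ob12; Ob13; Ob23; Oc] l
  end.

Lemma osc_codeK : cancel osc_code osc_decode.
Proof. by case. Qed.

HB.instance Definition _ := Finite.copy osc (can_type osc_codeK).

Section FockSpace.
Variable R : realType.
Local Notation C := R[i].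

(* (l1, l2, m12, m13, m23, n) labels the vector
   e^{l1 Q_a1 + l2 Q_a2 + m12 Q_b12 + m13 Q_b13 + m23 Q_b23 + n Q_c} |0>. *)
Definition label : zmodType := (C * C * int * int * int * int)%type.

Definition coord (p : label) (s : osc) : C :=
  let: (l1, l2, m12, m13, m23, n) := p in
  match s with
  | Oa i => if i == 0 then l1 else l2
  | Ob12 => m12%:~R | Ob13 => m13%:~R | Ob23 => m23%:~R | Oc => n%:~R
  end.

(* The label of c Q_{a^i}. *)
Definition Qa (c : C) (i : 'I_2) : label :=
  (if i == 0 then c else 0, if i == 0 then 0 else c, 0, 0, 0, 0).

Definition Qlabel (s : osc) : label :=
  match s with
  | Oa i => Qa 1 i
  | Ob12 => (0, 0, 1, 0, 0, 0)
  | Ob13 => (0, 0, 0, 1, 0, 0)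
  | Ob23 => (0, 0, 0, 0, 1, 0)
  | Oc => (0, 0, 0, 0, 0, 1)
  end.

(* (p, m) is the product of the s_{-(l+1)}, for (s, l) in the multiset m,
   applied to the vector labelled by p.  The Fock space is the direct sum of
   the Fock modules over all labels. *)
Definition basis : choiceType := (label * {mset (osc * nat)%type}%mset)%type.
Definition fock : lmodType C := {malg C[basis]}.

Definition linext (f : basis -> fock) (v : fock) : fock :=
  \sum_(b <- msupp v) v@_b *: f b.

Definition diag (f : label -> C) : fock -> fock :=
  linext (fun b => << f b.1 *g b >>).

(* e^Q, for the combination Q of the Q_s labelled by d *)
Definition translate (d : label) : fock -> fock :=
  linext (fun b => << ((b.1 + d, b.2) : basis) >>).

(* A stands for the formal sum over x in C of (A x) z^x; complex exponents
   come from the factors z^{a_0}. *)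
Definition fseries := C -> fock -> fock.

(* \sum_(y \in A) is the sum of the nonzero terms (0 if there are infinitely
   many); in all the uses below, finitely many terms are nonzero on each
   vector. *)
Definition smul (A B : fseries) : fseries := fun x v =>
  \sum_(y \in [set: C]) A (x - y) (B y v).

Definition sone : fseries := fun x v => if x == 0 then v else 0.

Definition sexp (A : fseries) : fseries := fun x v =>
  \sum_(r \in [set: nat]) (r`!%:R)^-1 *: iter r (smul A) sone x v.

(* A(z) g *)
Definition rmul (A : fseries) (g : fock -> fock) : fseries :=
  fun x v => A x (g v).

End FockSpace.

Section Currents.
Variable R : realType.
Local Notation C := R[i].
Local Notation label := (label R).
Local Notation fock := (fock R).
Local Notation fseries := (fseries R).
Variables lnq k : C.

Definition qpow (x : C) : C := cexp (x * lnq).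
Local Notation q := (qpow 1).
Definition qnum (x : C) : C := (qpow x - qpow (- x)) / (q - q^-1).

(* [s_m, t_(-m)] = contr s t m for m > 0, and [s_0, Q_t] = contr0 s t. *)
Definition contr (s t : osc) (m : nat) : C :=
  match s, t with
  | Oa i, Oa j =>
      qnum ((cartan i j)%:~R * m%:R) * qnum ((k + 1) * m%:R) / m%:R
  | Ob12, Ob12 => - (qnum m%:R ^+ 2 / m%:R)
  | Ob13, Ob13 | Ob23, Ob23 | Oc, Oc => qnum m%:R ^+ 2 / m%:R
  | _, _ => 0
  end.

Definition contr0 (s t : osc) : C :=
  match s, t with
  | Oa i, Oa j => (k + 1) * (cartan i j)%:~R
  | Ob12, Ob12 => -1
  | Ob13, Ob13 | Ob23, Ob23 | Oc, Oc => 1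
  | _, _ => 0
  end.

Definition eigen (s : osc) (p : label) : C :=
  \sum_(t : osc) contr0 s t * coord p t.

(* The operator s_n: negative modes multiply, the zero mode is diagonal, and a
   positive mode is the derivation determined by the commutators. *)
Definition mode (s : osc) (n : int) : fock -> fock :=
  match n with
  | Negz l => linext (fun b => << ((b.1, ((s, l) +` b.2)%mset) : basis R) >>)
  | Posz 0 => diag (eigen s)
  | Posz l.+1 => linext (fun b => \sum_(t : osc)
      << contr s t l.+1 * (b.2 (t, l))%:R
         *g ((b.1, (b.2 `\ (t, l))%mset) : basis R) >>)
  end.

(* e^{sum over s of (c s) s_0} *)
Definition expzero (c : osc -> C) : fock -> fock :=
  diag (fun p => cexp (\sum_(s : osc) c s * eigen s p)).

(* The exponent
     sum over s, n <> 0 of (osci s n) s_n z^{-n}  +  (element labelled Qpart)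
     + sum over s of (const s + lnz s * ln z) s_0;
   the value of osci at n = 0 is never used. *)
Record exponent := Exponent {
  osci : osc -> int -> C;
  Qpart : label;
  const : osc -> C;
  lnz : osc -> C }.

Definition eadd (f g : exponent) : exponent :=
  Exponent (fun s n => osci f s n + osci g s n) (Qpart f + Qpart g)
           (fun s => const f s + const g s) (fun s => lnz f s + lnz g s).

Definition eopp (f : exponent) : exponent :=
  Exponent (fun s n => - osci f s n) (- Qpart f)
           (fun s => - const f s) (fun s => - lnz f s).

(* f(q^l z), where ln (q^l z) = l ln q + ln z *)
Definition qsubst (l : C) (f : exponent) : exponent :=
  Exponent (fun s n => osci f s n * qpow (- (l * n%:~R))) (Qpart f)
           (fun s => const f s + lnz f s * (l * lnq)) (lnz f).

Definition modes (P : pred int) (f : exponent) : fseries := fun x v =>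
  \sum_(n \in [set n : int | P n /\ x = - n%:~R])
    \sum_(s : osc) osci f s n *: mode s n v.

(* e^{sum over s of (const s + lnz s * ln z) s_0} *)
Definition zero_part (f : exponent) : fseries := fun x v =>
  diag (fun p => if \sum_(s : osc) lnz f s * eigen s p == x then 1 else 0)
    (expzero (const f) v).

(* :e^f:, with the modes s_n, n < 0, and the Q's to the left *)
Definition nexp (f : exponent) : fseries :=
  smul (rmul (sexp (modes (fun n => n < 0) f)) (translate (Qpart f)))
       (smul (zero_part f) (sexp (modes (fun n => 0 < n) f))).

(* A pair (a_n, Q_a) with a_n = (wt n) s_n. *)
Record boson := Boson { species : osc; wt : int -> C; Qboson : label }.

Definition pair_of (s : osc) : boson := Boson s (fun=> 1) (Qlabel R s).

Definition astar (i : 'I_2) : boson :=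
  Boson (Oa i)
    (fun m => if m == 0 then (k + 1)^-1
              else qnum m%:~R / qnum ((k + 1) * m%:~R))
    (Qa (k + 1)^-1 i).

(* a(q^l z; kappa) *)
Definition fld (a : boson) (l kappa : C) : exponent :=
  qsubst l (Exponent
    (fun s n => if s == species a
       then - (wt a n / qnum n%:~R * qpow (- (kappa * `|n|%N%:R))) else 0)
    (Qboson a)
    (fun=> 0)
    (fun s => if s == species a then wt a 0 else 0)).

(* a_+(q^l z) and a_-(q^l z) *)
Definition fldp (a : boson) (l : C) : exponent :=
  qsubst l (Exponent
    (fun s n => if (s == species a) && (0 < n)
       then (q - q^-1) * wt a n else 0)
    0
    (fun s => if s == species a then wt a 0 * lnq else 0)
    (fun=> 0)).

Definition fldm (a : boson) (l : C) : exponent :=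
  qsubst l (Exponent
    (fun s n => if (s == species a) && (n < 0)
       then - (q - q^-1) * wt a n else 0)
    0
    (fun s => if s == species a then - (wt a 0 * lnq) else 0)
    (fun=> 0)).

(* e^{eps sqrt(-1) pi (sum of the s_0, s in ss)} *)
Definition phase (eps : C) (ss : seq osc) : fock -> fock :=
  expzero (fun s => if s \in ss then eps * Complex 0 pi else 0).

(* ((q - q^-1) z)^-1 A(z), A(q^l z), and the q-difference operator *)
Definition divz (A : fseries) : fseries :=
  fun x v => (q - q^-1)^-1 *: A (x + 1) v.
Definition dilate (l : C) (A : fseries) : fseries :=
  fun x v => qpow (l * x) *: A x v.
Definition qdiff (l : C) (A : fseries) : fseries :=
  divz (dilate l A - dilate (- l) A).

Local Notation a1 := (pair_of (Oa 0)).
Local Notation a2 := (pair_of (Oa 1)).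
Local Notation b12 := (pair_of Ob12).
Local Notation b13 := (pair_of Ob13).
Local Notation b23 := (pair_of Ob23).
Local Notation c := (pair_of Oc).
Local Notation "f [+] g" := (eadd f g) (at level 50, left associativity).
Local Notation "f [-] g" := (eadd f (eopp g)) (at level 50, left associativity).
Local Notation "[-] f" := (eopp f) (at level 35, right associativity).

(* At m = 0 this is a^1_0 + 2 b^{12}_0 + b^{13}_0 - b^{23}_0, resp.
   a^2_0 - b^{12}_0 - b^{13}_0. *)
Definition hgen (i : 'I_2) (m : int) (v : fock) : fock :=
  let M : C := `|m|%N%:R in
  if i == 0 then
    qpow (- (M / 2)) *: mode (Oa 0) m v
    + (qpow (- ((k / 2 + 1) * M)) * (qpow M + qpow (- M))) *: mode Ob12 m v
    + qpow (- ((k / 2 + 2) * M)) *: mode Ob13 m v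
    - qpow (- ((k / 2 + 1) * M)) *: mode Ob23 m v
  else
    qpow (- (M / 2)) *: mode (Oa 1) m v
    - qpow (- ((k / 2 + 1) * M)) *: mode Ob12 m v
    - qpow (- ((k / 2 + 1) * M)) *: mode Ob13 m v.

Definition Xp1 : fseries :=
  - rmul (divz (nexp ([-] fld b12 0 (-1) [-] fld c 1 0)
                - nexp ([-] fld b12 0 (-1) [-] fld c (-1) 0)))
         (phase 1 [:: Oc; Ob12]).

Definition Xp2 : fseries :=
  - rmul (nexp ([-] fldp b12 1 [-] fldp b13 1 [+] fld b23 1 0))
         (phase 1 [:: Oc; Ob12; Ob13; Ob23])
  + nexp (fld b12 0 0 [+] fld b13 0 0 [+] fld c 0 0).

Definition Xm1 : fseries :=
  rmul (divz
    (nexp (fldp a1 ((k + 1) / 2) [+] fld b12 (k + 2) 1 [+] fldp b13 (k + 2)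
           [-] fldp b23 (k + 1) [+] fld c (k + 1) 0)
     - nexp (fldm a1 (- ((k + 1) / 2)) [+] fld b12 (- k - 2) 1
             [+] fldm b13 (- k - 2) [-] fldm b23 (- k - 1)
             [+] fld c (- k - 1) 0)))
    (phase (-1) [:: Oc; Ob12])
  + qpow (k + 1) *:
    rmul (nexp (fldp a1 ((k + 1) / 2) [-] fld b13 (k + 1) 0
                [+] fld b23 (k + 1) (-1)))
         (phase 1 [:: Ob13; Ob23]).

Definition Xm2 : fseries :=
  divz
    (q *: rmul (nexp (fldp a2 ((k + 1) / 2) [-] fld b23 (k + 1) 0)
                - nexp (fldm a2 (- ((k + 1) / 2)) [-] fld b23 (- k - 1) 0))
               (phase (-1) [:: Oc; Ob12; Ob13; Ob23])
     - (nexp (fldm a2 (- ((k + 1) / 2)) [-] fld b12 (- k - 1) 1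
              [-] fld b13 (- k - 1) 1 [-] fld c (- k) 0)
        - nexp (fldm a2 (- ((k + 1) / 2)) [-] fld b12 (- k - 1) 1
                [-] fld b13 (- k - 1) 1 [-] fld c (- k - 2) 0))).

Definition Xp (i : 'I_2) : fseries := if i == 0 then Xp1 else Xp2.
Definition Xm (i : 'I_2) : fseries := if i == 0 then Xm1 else Xm2.

(* In tS1 the 1-difference in z acts on e^{-c(q^{-1} z; 0)} only. *)
Definition tS1 : fseries :=
  let f := [-] fld b12 0 0 [-] fldm b12 (-1) [-] fldm b13 (-1)
           [+] fldm b23 0 in
  rmul (divz (nexp (f [-] fld c 0 0) - nexp (f [-] fld c (-2) 0)))
       (phase 1 [:: Oc; Ob12])
  + q *: rmul (nexp (fld b13 0 0 [-] fld b23 1 0 [+] fldp b23 0))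
              (phase (-1) [:: Ob13; Ob23]).

Definition tS2 : fseries :=
  - (q^-1 *: rmul (nexp (fld b23 0 0))
                  (phase (-1) [:: Oc; Ob12; Ob13; Ob23])).

Definition screen (i : 'I_2) : fseries :=
  smul (nexp ([-] fld (astar i) 0 ((k + 1) / 2)))
       (if i == 0 then tS1 else tS2).

(* Coefficient of z^x w^y in [X(z), Y(w)], for X, Y of parities s, t. *)
Definition scomm (s t : bool) (X Y : fock -> fock) (v : fock) : fock :=
  X (Y v) - (-1) ^+ (s * t) *: Y (X v).

(* Coefficient of z^x, a series in w, of delta(w/z) A(w). *)
Definition delta_mul (A : fseries) (x : C) : fseries := fun y v =>
  \sum_(n \in [set n : int | x = - n%:~R]) A (y - n%:~R) v.

(* Coefficient of z^x, a series in w, of the q-difference (step k + 1, in w) of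
   - z^-1 delta(w/z) :e^{- a^{*,i}(w; -(k+1)/2)}: *)
Definition total_diff (i : 'I_2) (x : C) : fseries :=
  qdiff (k + 1)
    (- delta_mul (nexp ([-] fld (astar i) 0 (- ((k + 1) / 2)))) (x + 1)).

End Currents.

(* Main.v *)
(* The product of two normally ordered exponentials is their joint normally ordered
   exponential times the exponential of a contraction, a power series in w/z.  For a term
   of X^{+-,i}(z) and a term of S^j(w) this series is rational: it is constant, 1 - a x,
   1 / (1 - a x), (1 - b x) / (1 - a x) or 1 / ((1 - a x) (1 - b x)) with x = w/z, and the
   series in the other order expands the same function at x = oo.  So the (anti)commutator
   of two terms is the sum, over the poles a, of delta(a w / z) times a normally ordered
   exponential in w.  The residues of different pairs of terms at a common pole carry the
   same exponential and cancel; for [X^{-,i}, S^i] two of them survive, the two terms of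
   the q-difference.  The coefficients of all the exponents, multiplied by the
   denominators [m] or [(k+1) m], are integral combinations of powers q^((u + v k) m / 2),
   so that contractions, residues and cancellations are found by computing with such
   combinations.  The contraction of h^i_n with every term of S^j vanishes. *)
From HB Require Import structures.
Require Import Defs.
From mathcomp Require Import all_boot all_order all_algebra.
From mathcomp Require Import finmap multiset.
From mathcomp Require Import all_classical reals sequences exp trigo.
From mathcomp.real_closed Require Import complex.
From mathcomp.multinomials Require Import monalg.
From mathcomp Require Import zify ring.

Set Implicit Arguments.
Unset Strict Implicit.
Unset Printing Implicit Defensive.
Import Order.TTheory GRing.Theory Num.Theory.
Local Open Scope ring_scope.

(** * Exponentials of commuting operators *)

(** An identity between exponentials is reduced to the recursion n c_n = sum of (i + 1) a_i c_(n - i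
    - 1), the logarithmic derivative, which determines the coefficients in characteristic 0. Sums
    over exponents of z are finite only on vectors of given label and energy, because there is no
    negative energy; identities are therefore proved on basis vectors and extended by linearity,
    which itself requires finite supports. The symbolic computation meets one obstacle, the factor
    [a_ij m] [(k+1) m] / m in the commutators of the a's. A contraction is a Laurent polynomial in
    powers of q^m when one exponent is multiplied by [m] and the other by [(k+1) m], whereas the
    exponent obtained at z = q^l w is a sum and requires one common multiplier. Each term of X^- is
    therefore described in both normalizations. The checks treat q and q^k as independent, so that
    one computation with integers serves all generic q and k. *)

Section TriangularSums.
Variable V : nmodType.
Implicit Types G : nat -> nat -> V.

Lemma sum_ord_widen (G : nat -> V) m n : (m <= n)%N ->
  \sum_(i < m) G i = \sum_(i < n) (if (i < m)%N then G i else 0).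
Proof. by move=> le_mn; rewrite (big_ord_widen n G le_mn) big_mkcond. Qed.

Lemma triangular_exchange G n :
  \sum_(i < n) \sum_(j < n - i.+1) G i j
  = \sum_(j < n) \sum_(i < n - j.+1) G i j.
Proof.
under eq_bigr => i _ do rewrite (@sum_ord_widen (G i) _ n) ?leq_subr//.
rewrite exchange_big; apply: eq_bigr => j _ /=.
rewrite (@sum_ord_widen (G^~ j) (n - j.+1) n) ?leq_subr//; apply: eq_bigr => i _.
congr (if _ then _ else _); have := ltn_ord i; have := ltn_ord j; lia.
Qed.

Lemma triangular_exchange_le G n :
  \sum_(i < n) \sum_(j < n - i) G i j = \sum_(j < n) \sum_(i < n - j) G i j.
Proof.
under eq_bigr => i _ do rewrite (@sum_ord_widen (G i) _ n) ?leq_subr//.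
rewrite exchange_big; apply: eq_bigr => j _ /=.
rewrite (@sum_ord_widen (G^~ j) (n - j) n) ?leq_subr//; apply: eq_bigr => i _.
congr (if _ then _ else _); have := ltn_ord i; have := ltn_ord j; lia.
Qed.

Lemma triangular_diagonals G n :
  \sum_(i < n) \sum_(j < i.+1) G j (i - j)%N
  = \sum_(j < n) \sum_(i < n - j) G j i.
Proof.
under eq_bigr => i _ do rewrite (@sum_ord_widen (fun j => G j (i - j)%N) _ n) //.
rewrite exchange_big; apply: eq_bigr => j _ /=.
have le_jn : (j <= n)%N by rewrite ltnW.
rewrite -(big_mkord xpredT (fun i => if (j < i.+1)%N then G j (i - j)%N else 0)).
rewrite (big_cat_nat (n := j)) //= big_nat_cond big1 ?add0r; last first.
  by move=> i /andP[/andP[_ lt_ij] _]; rewrite ltnS leqNgt lt_ij.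
rewrite -{1}[j : nat]add0n big_addn big_mkord; apply: eq_bigr => i _.
by rewrite ltnS leq_addl addnK.
Qed.

End TriangularSums.

Section Exponential.
Variables (F : numFieldType) (V : lmodType F).
Implicit Types (A B : nat -> {linear V -> V}) (n r : nat) (v : V).

(* A stands for the series of the (A i) t^(i + 1); eexp A n is the coefficient
   of t^n in its exponential. *)
Fixpoint epow A r n v : V :=
  if r is r'.+1 then \sum_(i < n) A i (epow A r' (n - i.+1) v)
  else if n == 0%N then v else 0.

Definition eexp A n v : V := \sum_(r < n.+1) r`!%:R^-1 *: epow A r n v.

Lemma epow_linear A r n : linear (epow A r n).
Proof.
elim: r n => [|r IHr] n a u v /=; first by case: ifP; rewrite ?scaler0 ?addr0.
by rewrite scaler_sumr -big_split; apply: eq_bigr => i _; rewrite IHr linearP.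
Qed.
HB.instance Definition _ A r n :=
  GRing.isLinear.Build F V V *:%R (epow A r n) (epow_linear A r n).

Lemma eexp_linear A n : linear (eexp A n).
Proof.
move=> a u v; rewrite /eexp scaler_sumr -big_split; apply: eq_bigr => r _ /=.
by rewrite linearP scalerDr !scalerA mulrC.
Qed.
HB.instance Definition _ A n :=
  GRing.isLinear.Build F V V *:%R (eexp A n) (eexp_linear A n).

Lemma epow_gt A r n v : (n < r)%N -> epow A r n v = 0.
Proof.
elim: r n => //= r IHr n lt_nr; apply: big1 => i _.
by rewrite IHr ?raddf0 //; have := ltn_ord i; lia.
Qed.

Lemma eexp0 A v : eexp A 0 v = v.
Proof. by rewrite /eexp big_ord1 /= fact0 invr1 scale1r. Qed.

Definition commuting A (B : nat -> {linear V -> V}) :=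
  forall i j v, A i (B j v) = B j (A i v).

(** This is the coefficient of t^n in t d/dt A^(r+1) = (r+1) (t A') A^r; commutation moves the
    differentiated factor to the front. *)
Lemma epow_rec A r n v : commuting A A ->
  n%:R *: epow A r.+1 n v
  = r.+1%:R *: \sum_(i < n) i.+1%:R *: A i (epow A r (n - i.+1) v).
Proof.
move=> cA; elim: r n => [|r IHr] n.
  rewrite scale1r /= scaler_sumr; apply: eq_bigr => i _.
  rewrite subn_eq0; case: leqP => lt_ni; last by rewrite linear0 !scaler0.
  by congr (_%:R *: _); have := ltn_ord i; lia.
transitivity (\sum_(i < n) i.+1%:R *: A i (epow A r.+1 (n - i.+1) v)
   + \sum_(i < n) A i ((n - i.+1)%:R *: epow A r.+1 (n - i.+1) v)).
  rewrite scaler_sumr -big_split; apply: eq_bigr => i _ /=.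
  by rewrite linearZ -scalerDl -natrD subnKC //.
under [X in _ + X]eq_bigr => i _.
  rewrite IHr linearZ /= linear_sum; under eq_bigr => j _ do rewrite linearZ cA /=.
over.
rewrite -scaler_sumr.
rewrite (triangular_exchange (fun i j =>
  j.+1%:R *: A j (A i (epow A r (n - i.+1 - j.+1) v)))).
rewrite -[r.+2]add1n natrD scalerDl scale1r; congr (_ + _ *: _).
apply: eq_bigr => j _; rewrite /= linear_sum scaler_sumr; apply: eq_bigr => i _.
by rewrite -!subnDA addnC.
Qed.

(** This is the coefficient of t^n in t d/dt exp A = (t A') exp A, from [epow_rec] with (r+1) /
    (r+1)! = 1 / r!. *)
Lemma eexp_rec A n v : commuting A A ->
  n%:R *: eexp A n v = \sum_(i < n) i.+1%:R *: A i (eexp A (n - i.+1) v).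
Proof.
move=> cA; rewrite /eexp big_ord_recl scalerDr scaler_sumr.
have -> : n%:R *: (0`!%:R^-1 *: (if n == 0 then v else 0)) = 0 :> V.
  by case: n => [|n] /=; rewrite ?scale0r ?scaler0.
rewrite add0r.
transitivity (\sum_(r < n) \sum_(i < n)
   i.+1%:R *: A i (r`!%:R^-1 *: epow A r (n - i.+1) v)).
  apply: eq_bigr => r _; rewrite scalerA mulrC -scalerA epow_rec // scalerA.
  rewrite lift0 factS natrM invfM mulrAC mulVf ?pnatr_eq0 // mul1r.
  rewrite scaler_sumr; apply: eq_bigr => i _.
  by rewrite (linearZZ (A i)) !scalerA mulrC.
rewrite exchange_big; apply: eq_bigr => i _; rewrite linear_sum scaler_sumr.
(* Powers above the degree vanish, so all the inner sums may share the bound n. *)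
rewrite (@sum_ord_widen V (fun r => i.+1%:R *: A i (r`!%:R^-1 *: epow A r (n - i.+1) v))
  (n - i.+1).+1 n); last by have := ltn_ord i; lia.
apply: eq_bigr => r _; case: ltnP => // lt_r.
by rewrite epow_gt // scaler0 linear0 scaler0.
Qed.

(** The factor n is invertible for n > 0, so the recursion determines all coefficients from the
    first. [eexpD] and [eexp_exchange] follow by checking it for the product side. *)
Lemma eexp_unique A (G : nat -> V) v : commuting A A -> G 0%N = v ->
  (forall n, n%:R *: G n = \sum_(i < n) i.+1%:R *: A i (G (n - i.+1)%N)) ->
  forall n, G n = eexp A n v.
Proof.
move=> cA G0 recG n; have [m] := ubnP n; elim: m n => // m IHm [|n] lt_nm.
  by rewrite eexp0.
have n1_neq0 : n.+1%:R != 0 :> F by rewrite pnatr_eq0.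
apply: (scalerI n1_neq0); rewrite recG eexp_rec //; apply: eq_bigr => i _.
by rewrite IHm //; lia.
Qed.

Lemma epow_commute A (B : {linear V -> V}) :
  (forall i v, B (A i v) = A i (B v)) ->
  forall r n v, B (epow A r n v) = epow A r n (B v).
Proof.
move=> cAB; elim=> [|r IHr] n v /=; first by case: ifP => // _; rewrite linear0.
by rewrite linear_sum; apply: eq_bigr => i _; rewrite cAB IHr.
Qed.

Lemma eexp_commute A (B : {linear V -> V}) :
  (forall i v, B (A i v) = A i (B v)) ->
  forall n v, B (eexp A n v) = eexp A n (B v).
Proof.
move=> cAB n v; rewrite linear_sum; apply: eq_bigr => r _.
by rewrite linearZ /= epow_commute.
Qed.

Lemma eexp_commute2 A B : commuting A B ->
  forall m n v, eexp A m (eexp B n v) = eexp B n (eexp A m v).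
Proof.
move=> cAB m n v; apply: eexp_commute => j u.
by rewrite (eexp_commute (B := B j)).
Qed.

(** One half of the Leibniz rule: the part of t d/dt (exp A . G) where the derivative falls on exp
    A. *)
Lemma eexp_conv_rec A (G : nat -> V) n : commuting A A ->
  \sum_(i < n.+1) i%:R *: eexp A i (G (n - i)%N)
  = \sum_(j < n) j.+1%:R *: A j (\sum_(i < (n - j.+1).+1) eexp A i (G (n - j.+1 - i)%N)).
Proof.
move=> cA; rewrite big_ord_recl scale0r add0r.
transitivity (\sum_(i < n) \sum_(j < i.+1) (fun j l =>
    j.+1%:R *: A j (eexp A l (G (n - (l + j).+1)%N))) j (i - j)%N).
  apply: eq_bigr => i _; rewrite lift0 eexp_rec //; apply: eq_bigr => j _ /=.
  by rewrite subSS subnK // -ltnS.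
rewrite (triangular_diagonals (fun j l =>
    j.+1%:R *: A j (eexp A l (G (n - (l + j).+1)%N)))).
apply: eq_bigr => j _ /=; rewrite -subSn; last exact: ltn_ord.
rewrite subSS linear_sum scaler_sumr; apply: eq_bigr => i _.
by congr (_ *: A j (eexp A i (G _))); lia.
Qed.

Lemma eexpD A B (AB : nat -> {linear V -> V}) : commuting A A -> commuting B B -> commuting A B ->
  (forall i v, AB i v = A i v + B i v) ->
  forall n v, eexp AB n v = \sum_(i < n.+1) eexp A i (eexp B (n - i) v).
Proof.
move=> cA cB cAB defAB n v; symmetry; move: n.
have cABc : commuting AB AB.
  by move=> i j u; rewrite !defAB !linearD !cAB (cA i j) (cB i j) addrACA.
apply: (eexp_unique cABc) => [|n]; first by rewrite big_ord1 !eexp0.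
under [RHS]eq_bigr => i _ do rewrite defAB scalerDr.
rewrite big_split /= -(eexp_conv_rec (fun m => eexp B m v)) //.
transitivity (\sum_(i < n.+1) i%:R *: eexp A i (eexp B (n - i) v)
  + \sum_(i < n.+1) (n - i)%:R *: eexp A i (eexp B (n - i) v)).
  rewrite scaler_sumr -big_split; apply: eq_bigr => i _ /=.
  by rewrite -scalerDl -natrD subnKC // -ltnS.
congr (_ + _).
(* The derivative of exp B: reversing the sum and commuting the factors gives it the form of the
   other half. *)
transitivity (\sum_(i < n.+1) i%:R *: eexp B i (eexp A (n - i) v)).
  rewrite (reindex_inj rev_ord_inj); apply: eq_bigr => i _ /=.
  by rewrite subSS subKn 1?eexp_commute2 // -ltnS.
rewrite (eexp_conv_rec (fun m => eexp A m v)) //; apply: eq_bigr => j _.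
congr (_ *: B j _); rewrite (reindex_inj rev_ord_inj); apply: eq_bigr => i _ /=.
by rewrite subSS subKn 1?eexp_commute2 // -ltnS.
Qed.

(** The substitution t -> a t, by which the dilation z -> q^l z acts on the mode exponentials. *)
Lemma eexp_scale A (A' : nat -> {linear V -> V}) (a : F) : (forall i v, A' i v = a ^+ i.+1 *: A i v) ->
  forall n v, eexp A' n v = a ^+ n *: eexp A n v.
Proof.
move=> defA'.
have epowE r n v : epow A' r n v = a ^+ n *: epow A r n v.
  elim: r n v => [|r IHr] n v /=.
    by case: eqP => [->|_]; rewrite ?scale1r ?scaler0.
  rewrite scaler_sumr; apply: eq_bigr => i _.
  by rewrite defA' IHr linearZ scalerA -exprD subnKC.
move=> n v; rewrite scaler_sumr; apply: eq_bigr => r _.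
by rewrite epowE !scalerA mulrC.
Qed.

(** Commutation with [P i] is a derivation whose only nonzero value is the scalar [gam i], at [A i];
    hence its value at exp A is gam_i t^(i+1) exp A. *)
Lemma eexp_derivation A (P : nat -> {linear V -> V}) (gam : nat -> F) :
  commuting A A ->
  (forall i j v, P i (A j v) = A j (P i v) + (if i == j then gam i else 0) *: v) ->
  forall i n v, P i (eexp A n v)
    = eexp A n (P i v) + (if (i < n)%N then gam i *: eexp A (n - i.+1) v else 0).
Proof.
move=> cA cPA i n; have [m] := ubnP n; elim: m n => // m IHm [|n] lt_nm v.
  by rewrite !eexp0 addr0.
have n1_neq0 : n.+1%:R != 0 :> F by rewrite pnatr_eq0.
apply: (scalerI n1_neq0); rewrite scalerDr -linearZ /= !eexp_rec // linear_sum.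
transitivity (\sum_(j < n.+1) (j.+1%:R *: A j (eexp A (n.+1 - j.+1) (P i v))
  + (if (j < n.+1)%N && (i < n - j)%N
       then j.+1%:R *: (gam i *: A j (eexp A (n - j - i.+1) v)) else 0)
  + (if j == i :> nat then i.+1%:R *: (gam i *: eexp A (n - i) v) else 0))).
  apply: eq_bigr => j _; rewrite linearZ /= cPA scalerDr; congr (_ + _); last first.
    by rewrite eq_sym; case: eqP => [->|_]; rewrite // scale0r scaler0.
  rewrite subSS IHm; last by lia.
  rewrite linearD scalerDr ltn_ord /=; congr (_ + _); case: ltnP => _.
    by rewrite linearZ.
  by rewrite linear0 scaler0.
rewrite !big_split /= -addrA; congr (_ + _).
rewrite -[X in _ + X]big_mkcond /=; case: ltnP => [lt_in|le_ni]; last first.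
  rewrite scaler0 [X in _ + X]big1 ?addr0; last by move=> j; have := ltn_ord j; lia.
  by apply: big1 => j _; case: ifP => //; lia.
rewrite [X in _ + X](big_pred1 (Ordinal lt_in)) //.
rewrite subSS.
(* The part i + 1 of the weight is the term j = i, where [P i] meets [A i]; the part n - i comes
   from [eexp_rec] in degree n - i. *)
have -> : n.+1%:R = (n - i)%:R + i.+1%:R :> F by rewrite -natrD; congr _%:R; lia.
rewrite scalerDl; congr (_ + _).
rewrite scalerA mulrC -scalerA eexp_rec // scaler_sumr.
rewrite -[LHS]big_mkcond /=.
rewrite [RHS](@sum_ord_widen V (fun j => gam i *:
  (j.+1%:R *: A j (eexp A (n - i - j.+1) v))) (n - i) n.+1); last by lia.
rewrite big_mkcond; apply: eq_bigr => j _.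
rewrite ltn_ord /= ltn_subRL addnC -ltn_subRL; case: ifP => // _.
by rewrite !scalerA mulrC; congr (_ *: A j (eexp A _ v)); lia.
Qed.

(** In exp P(s) exp A(t) = c(s t) exp A(t) exp P(s), c is the exponential of the sum of gam_i (s
    t)^(i+1). For fixed m the right side satisfies, as a function of n, the recursion that
    characterizes exp P. *)
Lemma eexp_exchange A (P : nat -> {linear V -> V}) (gam c : nat -> F) :
  commuting A A -> commuting P P ->
  (forall i j v, P i (A j v) = A j (P i v) + (if i == j then gam i else 0) *: v) ->
  c 0%N = 1 ->
  (forall n, n%:R * c n = \sum_(i < n) i.+1%:R * gam i * c (n - i.+1)%N) ->
  forall n m v, eexp P n (eexp A m v)
    = \sum_(j < n.+1) c j *: (if (j <= m)%N then eexp A (m - j) (eexp P (n - j) v) else 0).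
Proof.
move=> cA cP cPA c0 recc n m v; symmetry; move: n.
apply: (eexp_unique cP) => [|n].
  by rewrite big_ord1 c0 scale1r subn0 !eexp0.
pose E j l := if (j <= m)%N then eexp A (m - j) (eexp P l v) else 0.
pose T j i := if (j <= m)%N then eexp A (m - j) (P i (eexp P (n - j - i.+1) v)) else 0.
have PE i j l : P i (E j l) = (if (j <= m)%N then eexp A (m - j) (P i (eexp P l v)) else 0)
    + gam i *: E (j + i.+1)%N l.
  rewrite /E; case: leqP => le_jm; last first.
    by rewrite linear0 add0r ifN ?scaler0 //; lia.
  rewrite (eexp_derivation cA cPA); congr (_ + _).
  have -> : (i < m - j)%N = (j + i.+1 <= m)%N by lia.
  by case: ifP; rewrite ?scaler0 // -subnDA.
(* The weight n splits into n - j, which differentiates exp P, and j, which differentiates c. *)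
transitivity (\sum_(j < n.+1) ((n - j)%:R *: (c j *: E j (n - j)%N)
   + j%:R *: (c j *: E j (n - j)%N))).
  rewrite scaler_sumr; apply: eq_bigr => j _.
  by rewrite -scalerDl -natrD subnK // -ltnS.
transitivity (\sum_(i < n) (\sum_(j < n - i) i.+1%:R *: (c j *: T j i)
   + \sum_(j < n - i) i.+1%:R * gam i * c j *: E (i + j).+1 (n - (i + j).+1)%N));
    last first.
  apply: eq_bigr => i _; rewrite linear_sum scaler_sumr -big_split -subSn // subSS.
  apply: eq_bigr => j _ /=.
  rewrite (linearZZ (P i)) -/(E j (n - i.+1 - j)%N) PE !scalerDr !scalerA /T.
  rewrite -!subnDA [(i.+1 + j)%N]addnC [(j + i.+1)%N]addnS [(i + j)%N]addnC.
  by congr (_ + _ *: _); ring.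
rewrite !big_split; congr (_ + _) => /=.
  rewrite big_ord_recr /= subnn scale0r addr0.
  rewrite (triangular_exchange_le (fun i j => i.+1%:R *: (c j *: T j i))).
  apply: eq_bigr => j _; rewrite /E /T; case: ifP => _; last first.
    by rewrite !scaler0 big1 // => i _; rewrite !scaler0.
  rewrite scalerA mulrC -scalerA -(linearZZ (eexp A _)) eexp_rec //.
  rewrite (linear_sum (eexp A _)) scaler_sumr; apply: eq_bigr => i _.
  by rewrite (linearZZ (eexp A _)) !scalerA mulrC.
rewrite big_ord_recl scale0r add0r -(triangular_diagonals (fun i j =>
  i.+1%:R * gam i * c j *: E (i + j).+1 (n - (i + j).+1)%N)).
apply: eq_bigr => j _; rewrite lift0 scalerA recc scaler_suml.
by apply: eq_bigr => i _; rewrite subSS subnKC // -ltnS.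
Qed.

(** Applied with [P D] the vectors of energy D on one label, and [sg] equal to 1 for creation and -1
    for annihilation. *)
Lemma eexp_graded A (P : int -> V -> Prop) (sg : int) :
  (forall D, P D 0) -> (forall D u v, P D u -> P D v -> P D (u + v)) ->
  (forall D a v, P D v -> P D (a *: v)) ->
  (forall i D v, P D v -> P (D + sg * i.+1%:Z) (A i v)) ->
  forall n D v, P D v -> P (D + sg * n%:Z) (eexp A n v).
Proof.
move=> P0 PD PZ PA n D v Pv.
have Psum m (G : 'I_m -> V) D' : (forall i, P D' (G i)) -> P D' (\sum_i G i).
  by move=> PG; apply: big_ind => // ? ? ? ?; exact: PD.
suff powP r n' : P (D + sg * n'%:Z) (epow A r n' v).
  by apply: Psum => r; apply: PZ; exact: powP.
elim: r n' => [|r IHr] n' /=.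
  by case: eqP => [->|_] //; rewrite mulr0 addr0.
apply: Psum => i.
have -> : D + sg * n'%:Z = D + sg * (n' - i.+1)%N%:Z + sg * i.+1%:Z.
  by rewrite -addrA -mulrDr -PoszD subnK.
exact/PA/IHr.
Qed.

Lemma eexp_scaleD A B (H : nat -> {linear V -> V}) (a : F) :
  commuting A A -> commuting B B -> commuting A B ->
  (forall i v, H i v = a ^+ i.+1 *: A i v + B i v) ->
  forall n v, eexp H n v = \sum_(i < n.+1) a ^+ i *: eexp A i (eexp B (n - i) v).
Proof.
move=> cA cB cAB defH n v; pose A' i : {linear V -> V} := a ^+ i.+1 \*: A i.
rewrite (@eexpD A' B H) //.
- by apply: eq_bigr => i _; rewrite (@eexp_scale A A' a).
- move=> i j u; rewrite /= (linearZZ (A i)) (linearZZ (A j)) /= cA.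
  by rewrite !scalerA mulrC.
- by move=> i j u; rewrite /= cAB (linearZZ (B j)).
Qed.

(** Extended by zero to negative degrees, so that degrees can be shifted by integers without side
    conditions. *)
Definition ezexp A (a : int) v : V := if a is Posz n then eexp A n v else 0.

Lemma ezexp_linear A a : linear (ezexp A a).
Proof. by move=> c u v; case: a => n; rewrite /= ?linearP // scaler0 addr0. Qed.
HB.instance Definition _ A a :=
  GRing.isLinear.Build F V V *:%R (ezexp A a) (ezexp_linear A a).

Lemma ezexp_lt0 A (a : int) v : a < 0 -> ezexp A a v = 0.
Proof. by case: a. Qed.

Lemma ezexp_commute A (B : {linear V -> V}) :
  (forall i v, B (A i v) = A i (B v)) ->
  forall a v, B (ezexp A a v) = ezexp A a (B v).
Proof. by move=> cAB [n|n] v /=; [exact: eexp_commute | rewrite linear0]. Qed.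

Lemma ezexp_commute2 A B : commuting A B ->
  forall a b v, ezexp A a (ezexp B b v) = ezexp B b (ezexp A a v).
Proof.
move=> cAB [m|m] [n|n] v //=; rewrite ?linear0 //; exact: eexp_commute2.
Qed.

End Exponential.

(** * Moving annihilators past creators *)

Section Exchange.
Variables (F : numFieldType) (V : lmodType F).
Variables (A P : nat -> {linear V -> V}) (gam c : nat -> F).
Hypotheses (cA : commuting A A) (cP : commuting P P).
Hypothesis (cPA : forall i j v,
  P i (A j v) = A j (P i v) + (if i == j then gam i else 0) *: v).
Hypotheses (c0 : c 0%N = 1) (recc : forall n,
  n%:R * c n = \sum_(i < n) i.+1%:R * gam i * c (n - i.+1)%N).

Lemma ezexp_exchange n (b : int) v : eexp P n (ezexp A b v)
  = \sum_(j < n.+1) c j *: ezexp A (b - j%:Z) (eexp P (n - j) v).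
Proof.
case: b => m /=.
  rewrite (eexp_exchange cA cP cPA c0 recc); apply: eq_bigr => j _; congr (_ *: _).
  case: leqP => [le_jm|lt_mj]; first by rewrite subzn.
  by rewrite ezexp_lt0 //; lia.
by rewrite linear0 big1 // => j _; rewrite ezexp_lt0 ?scaler0 //; lia.
Qed.

Lemma sum_ord_trunc (G : nat -> V) m n : (m <= n)%N ->
  (forall i, (m <= i)%N -> G i = 0) -> \sum_(i < n) G i = \sum_(i < m) G i.
Proof.
move=> le_mn G0; rewrite (sum_ord_widen G le_mn); apply: eq_bigr => i _.
by case: ltnP => // /G0.
Qed.

Variable (E : int -> {linear V -> V}).

(* Moves the annihilators P past the creators A; M and J cut the mode sums where all the
   remaining terms vanish. *)
Lemma vertex_product (Tf : {linear V -> V}) (w : nat -> V) M J (a b : int) :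
  (forall i v, Tf (A i v) = A i (Tf v)) ->
  (forall n m, (M <= n)%N -> eexp P n (w m) = 0) ->
  (b + M%:Z <= J%:Z) ->
  \sum_(n < J + M) E (a + n%:Z) (Tf (eexp P n (\sum_(m < M) ezexp A (b + m%:Z) (w m))))
  = \sum_(j < J) c j *: \sum_(n < M) \sum_(m < M)
      E (a + j%:Z + n%:Z) (ezexp A (b - j%:Z + m%:Z) (Tf (eexp P n (w m)))).
Proof.
move=> cTA w0 le_J.
pose G j n := c j *: \sum_(m < M)
      E (a + j%:Z + n%:Z) (ezexp A (b - j%:Z + m%:Z) (Tf (eexp P n (w m)))).
transitivity (\sum_(n < J + M) \sum_(j < n.+1) G j (n - j)%N).
  apply: eq_bigr => n _; rewrite (linear_sum (eexp P n)) (linear_sum Tf).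
  rewrite (linear_sum (E _)) /G.
  under [RHS]eq_bigr => j _ do rewrite scaler_sumr.
  rewrite exchange_big; apply: eq_bigr => m _ /=.
  rewrite ezexp_exchange (linear_sum Tf) (linear_sum (E _)); apply: eq_bigr => j _.
  rewrite (linearZZ Tf) (linearZZ (E _)) /= (ezexp_commute (B := Tf)) //.
  have -> : a + n%:Z = a + j%:Z + (n - j)%N%:Z by have := ltn_ord j; lia.
  by have -> : b + m%:Z - j%:Z = b - j%:Z + m%:Z by lia.
(* Resummation by the degree j of the contraction. It stops at J, where the creators reach negative
   degree, and the annihilators stop at M, where they kill [w]. *)
rewrite triangular_diagonals.
rewrite (@sum_ord_trunc (fun j => \sum_(i < J + M - j) G j i) J) ?leq_addr // => [|j le_Jj].
  apply: eq_bigr => j _; rewrite (@sum_ord_trunc (G j) M); first last.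
  - move=> n le_Mn; rewrite /G big1 ?scaler0 // => m _.
    by rewrite w0 // linear0 !(linear0 (ezexp _ _)) linear0.
  - by have := ltn_ord j; lia.
  by rewrite /G -scaler_sumr.
apply: big1 => n _; rewrite /G big1 ?scaler0 // => m _.
by rewrite (@ezexp_lt0 _ _ A) ?(linear0 (E _)) //; have := ltn_ord m; lia.
Qed.

End Exchange.

(** * Sums over the integers *)

Section FiniteSums.
Variables (T : choiceType) (F : pzRingType) (V : lmodType F).
Implicit Types G : T -> V.

Lemma fsum_fin (I : finType) (h : I -> T) G : injective h ->
  (forall y, (forall i, y != h i) -> G y = 0) ->
  \sum_(y \in [set: T]%classic) G y = \sum_i G (h i).
Proof.
move=> inj_h G0; rewrite (@fsbigTE _ _ _ _ [fset h i | i in I]%fset) /=.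
  by rewrite big_imfset /= ?big_enum // => i j _ _ /inj_h.
move=> y y_nin; apply: G0 => i; apply: contraNneq y_nin => ->.
by apply: in_imfset.
Qed.

Lemma fsum_single (y0 : T) G : (forall y, y != y0 -> G y = 0) ->
  \sum_(y \in [set: T]%classic) G y = G y0.
Proof.
move=> G0; rewrite (@fsum_fin unit (fun=> y0)) ?big_const ?card_unit /= ?addr0 //.
- by case; case.
- by move=> y /(_ tt); exact: G0.
Qed.

Lemma fsum_inj (I : choiceType) (h : I -> T) G : injective h ->
  (forall y, (forall i, y != h i) -> G y = 0) ->
  (exists A : {fset I}, forall i, i \notin A -> G (h i) = 0) ->
  \sum_(y \in [set: T]%classic) G y = \sum_(i \in [set: I]%classic) G (h i).
Proof.
move=> inj_h G0 [A AP]; rewrite [RHS](@fsbigTE _ _ _ _ A) //.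
rewrite (@fsbigTE _ _ _ _ [fset h i | i in A]%fset) /=.
  by rewrite big_imfset // => i j _ _ /inj_h.
move=> y y_nin; have [[i yi]|nex] := pselect (exists i, y = h i).
  rewrite yi AP //; apply: contra y_nin => iA; rewrite yi; exact: in_imfset.
by apply: G0 => i; apply/eqP => yi; apply: nex; exists i.
Qed.

(** A sum over all of [T] is 0 by convention when infinitely many terms are nonzero, so linearity of
    such sums holds only under this condition. *)
Definition fin_support G := exists A : {fset T}, forall y, y \notin A -> G y = 0.

Lemma fsum_linear (a : F) G G1 G2 : fin_support G1 -> fin_support G2 ->
  (forall y, G y = a *: G1 y + G2 y) ->
  \sum_(y \in [set: T]%classic) G y
  = a *: (\sum_(y \in [set: T]%classic) G1 y) + \sum_(y \in [set: T]%classic) G2 y.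
Proof.
move=> [A1 A1P] [A2 A2P] GE; pose A := (A1 `|` A2)%fset.
have A10 y : y \notin A -> G1 y = 0.
  by rewrite inE negb_or => /andP[/A1P].
have A20 y : y \notin A -> G2 y = 0.
  by rewrite inE negb_or => /andP[_ /A2P].
rewrite !(@fsbigTE _ _ _ _ A) //; last by move=> y yA; rewrite GE A10 // A20 // scaler0 addr0.
by rewrite scaler_sumr -big_split; apply: eq_bigr.
Qed.

Lemma fsum_scale (a : F) G : fin_support G ->
  \sum_(y \in [set: T]%classic) a *: G y = a *: (\sum_(y \in [set: T]%classic) G y).
Proof.
move=> finG; rewrite (@fsum_linear a (fun y => a *: G y) G (fun=> 0)).
- by rewrite [X in _ + X]fsbig1 // addr0.
- by [].
- by exists fset0.
- by move=> y /=; rewrite addr0.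
Qed.

Lemma fin_support_scale (a : T -> F) G : fin_support G -> fin_support (fun y => a y *: G y).
Proof. by move=> [A AP]; exists A => y /AP ->; rewrite scaler0. Qed.

Lemma fin_supportD G1 G2 : fin_support G1 -> fin_support G2 ->
  fin_support (fun y => G1 y + G2 y).
Proof.
move=> [A1 A1P] [A2 A2P]; exists (A1 `|` A2)%fset => y.
by rewrite inE negb_or => /andP[/A1P -> /A2P ->]; rewrite addr0.
Qed.

Lemma fin_support_sum n (G : T -> 'I_n -> V) : (forall i, fin_support (G^~ i)) ->
  fin_support (fun y => \sum_(i < n) G y i).
Proof.
elim: n G => [|n IHn] G finG.
  by exists fset0 => y _; rewrite big_ord0.
have [A AP] := fin_supportD (IHn (fun y i => G y (widen_ord (leqnSn n) i))
  (fun i => finG _)) (finG ord_max).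
by exists A => y yA; rewrite big_ord_recr /= AP.
Qed.

Lemma fsum_sum n (G : T -> 'I_n -> V) : (forall i, fin_support (G^~ i)) ->
  \sum_(y \in [set: T]%classic) \sum_(i < n) G y i
  = \sum_(i < n) \sum_(y \in [set: T]%classic) G y i.
Proof.
elim: n G => [|n IHn] G finG.
  by rewrite big_ord0 fsbig1 // => y _; rewrite big_ord0.
rewrite big_ord_recr -IHn //= -[X in X + _]scale1r.
by apply: fsum_linear => // [|y]; [exact: fin_support_sum | rewrite big_ord_recr scale1r].
Qed.

End FiniteSums.

Lemma fsum_shift (V : nmodType) (G : int -> V) (i : int) :
  \sum_(t \in [set: int]%classic) G (t + i) = \sum_(t \in [set: int]%classic) G t.
Proof.
rewrite [RHS](@reindex_fsbigT _ _ _ _ _ (fun t => t + i)) //.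
by exists (fun t => t - i) => t; rewrite ?addrK ?subrK.
Qed.

Lemma fin_support_quadrant (F : pzRingType) (V : lmodType F) (G : int -> V) (lo hi : int) :
  (forall t, t < lo -> G t = 0) -> (forall t, hi < t -> G t = 0) -> fin_support G.
Proof.
move=> Glo Ghi.
exists [fset (lo + n%:Z)%R | n in iota 0 `|hi - lo|%N.+1]%fset => t.
apply: contraNeq => Gt; apply/imfsetP; exists `|t - lo|%N.
  have := contra_neqN (Glo t) Gt; have := contra_neqN (Ghi t) Gt.
  rewrite mem_iota; lia.
have := contra_neqN (Glo t) Gt; lia.
Qed.

Lemma fsum_shift_scale (F : numFieldType) (V : lmodType F) (N Phi : int -> V) (al : F) (e : int) :
  al != 0 -> (forall i, Phi i = N (i + e)) -> fin_support Phi ->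
  \sum_(t \in [set: int]%classic) al ^ t *: N t
  = al ^ e *: (\sum_(t \in [set: int]%classic) al ^ t *: Phi t).
Proof.
move=> al0 PhiE finPhi; rewrite -(fsum_shift _ e) -fsum_scale; last first.
  exact: fin_support_scale.
by apply: eq_fsbigr => t _; rewrite scalerA expfzDr // mulrC PhiE.
Qed.

Lemma scale4_congr (F : pzRingType) (V : lmodType F) (a b c d : F) (u : V) :
  a * b * c = d -> a *: (b *: (c *: u)) = d *: u.
Proof. by move=> <-; rewrite !scalerA. Qed.

Lemma fsum_reflect (V : nmodType) (G : int -> V) (w : int) :
  \sum_(t \in [set: int]%classic) G (w - t) = \sum_(t \in [set: int]%classic) G t.
Proof.
rewrite [RHS](@reindex_fsbigT _ _ _ _ _ (fun t => w - t)) //.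
by exists (fun t => w - t) => t; rewrite opprB addrC subrK.
Qed.

(** The two orders of a product sum the same vectors [Phi i] with different scalars. Where the
    difference of the scalars is a combination of functions [e l], so is the difference of the sums;
    [e l] will be a geometric progression on the integers, that is, a delta function. *)
Lemma fsum_delta_combine (F : comPzRingType) (V : lmodType F) (Phi : int -> V)
    (I : Type) (P : seq I) (r : I -> F) (e : I -> int -> F) (s s' : int -> F) (ka ka' sg K : F) :
  fin_support Phi ->
  (forall i, ka * s i - sg * (ka' * s' i) = \sum_(l <- P) r l * e l i) ->
  (ka * K) *: (\sum_(i \in [set: int]%classic) s i *: Phi i)
    - sg *: ((ka' * K) *: (\sum_(i \in [set: int]%classic) s' i *: Phi i))
  = \sum_(l <- P) (K * r l) *: (\sum_(i \in [set: int]%classic) e l i *: Phi i).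
Proof.
move=> finPhi scalE.
have fin (c : int -> F) : fin_support (fun i => c i *: Phi i) by exact: fin_support_scale.
have -> : \sum_(l <- P) (K * r l) *: (\sum_(i \in [set: int]%classic) e l i *: Phi i)
  = \sum_(i \in [set: int]%classic) (\sum_(l <- P) K * (r l * e l i)) *: Phi i.
  elim: P {scalE} => [|l P IHP].
    by rewrite big_nil fsbig1 // => i _; rewrite big_nil scale0r.
  rewrite big_cons IHP.
  rewrite -(@fsum_linear _ _ _ _ (fun i => (\sum_(m <- l :: P) K * (r m * e m i)) *: Phi i)) //.
  by move=> i; rewrite big_cons scalerDl scalerA mulrA.
rewrite scalerA -scaleNr addrC -[X in X + _](@fsum_scale _ _ _ _ _ (fin _)).
rewrite addrC -(@fsum_linear _ _ _ _ (fun i => (\sum_(l <- P) K * (r l * e l i)) *: Phi i)) //.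
  exact: (fin_support_scale (fun=> _) (fin s')).
move=> i; rewrite scalerA [in X in _ + X]scalerA -scalerDl -mulr_sumr -scalE.
by congr (_ *: _); ring.
Qed.

(** * Substitution at the support of a delta function *)

Section Delta.
Variables (F : numFieldType) (V : lmodType F).
Variables (A B H : nat -> {linear V -> V}) (al : F).
Hypothesis al_neq0 : al != 0.
Hypothesis expH : forall n v,
  eexp H n v = \sum_(i < n.+1) al ^+ i *: eexp A i (eexp B (n - i) v).

Lemma ezexp_fin_support (c d e : int) v :
  fin_support (fun t => ezexp A (t + d) (ezexp B (c - t + e) v)).
Proof.
apply: (@fin_support_quadrant _ _ _ (- d) (c + e)) => t lt_t.
  by rewrite ezexp_lt0 //; lia.
by rewrite (@ezexp_lt0 _ _ B) ?linear0 //; lia.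
Qed.

Lemma ezexp_split (c : int) v :
  ezexp H c v = \sum_(t \in [set: int]%classic) al ^ t *: ezexp A t (ezexp B (c - t) v).
Proof.
case: c => n; last first.
  rewrite fsbig1 // => -[t|t] _; last by rewrite scaler0.
  by rewrite (@ezexp_lt0 _ _ B) ?linear0 ?scaler0 //; lia.
rewrite (@fsum_fin _ _ _ 'I_n.+1 (fun i => Posz i)).
- rewrite [LHS]expH; apply: eq_bigr => i _; congr (_ *: _).
  by rewrite subzn -1?ltnS.
- by move=> i j [] /val_inj.
move=> [t|t] t_out; last by rewrite scaler0.
rewrite (@ezexp_lt0 _ _ B) ?linear0 ?scaler0 //.
suff : (n < t)%N by lia.
by rewrite ltnNge; apply/negP => le_tn; have := t_out (Ordinal (le_tn : (t < n.+1)%N)); rewrite eqxx.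
Qed.

Variables (P Q K : nat -> {linear V -> V}) (Tr : {linear V -> V}) (M : nat) (v : V).
Hypothesis expK : forall n, eexp K n v
  = \sum_(i < n.+1) al ^- i *: eexp P i (eexp Q (n - i) v).
Hypothesis PQ0 : forall i m, (M <= i + m)%N -> eexp P i (eexp Q m v) = 0.

(** The coefficient form of delta(al w/z) F(z, w) = delta(al w/z) F(al w, w). Creators of degree i
    receive al^i and annihilators al^-i; shifting t by the degree of the annihilators absorbs the
    latter. *)
Lemma delta_product (c : int) :
  \sum_(n < M) ezexp H (c + n%:Z) (Tr (eexp K n v))
  = \sum_(t \in [set: int]%classic) al ^ t *:
      \sum_(n < M) \sum_(m < M) ezexp A (t + n%:Z) (ezexp B (c - t + m%:Z)
        (Tr (eexp P n (eexp Q m v)))).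
Proof.
pose W i m := Tr (eexp P i (eexp Q m v)).
pose G i m := al ^- i *: ezexp H (c + i%:Z + m%:Z) (W i m).
have GE i m : G i m = \sum_(t \in [set: int]%classic)
    al ^ t *: ezexp A (t + i%:Z) (ezexp B (c - t + m%:Z) (W i m)).
  rewrite /G ezexp_split -fsum_scale; last first.
    apply: fin_support_scale; have [D DP] := ezexp_fin_support (c + i%:Z) 0 m%:Z (W i m).
    by exists D => t /DP; rewrite addr0 addrAC.
  rewrite -(fsum_shift _ i%:Z); apply: eq_fsbigr => t _; rewrite scalerA.
  rewrite expfzDr // mulrCA -exprnP mulVf ?expf_neq0 // mulr1.
  by have -> : c + i%:Z + m%:Z - (t + i%:Z) = c - t + m%:Z by lia.
transitivity (\sum_(n < M) \sum_(i < n.+1) G i (n - i)%N).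
  apply: eq_bigr => n _; rewrite expK (linear_sum Tr) (linear_sum (ezexp _ _)).
  apply: eq_bigr => i _; rewrite (linearZZ Tr) (linearZZ (ezexp _ _)) /= /G.
  by have -> : c + n%:Z = c + i%:Z + (n - i)%N%:Z by have := ltn_ord i; lia.
rewrite triangular_diagonals.
transitivity (\sum_(i < M) \sum_(m < M) G i m).
  apply: eq_bigr => i _; symmetry; apply: sum_ord_trunc; first exact: leq_subr.
  by move=> m le_m; rewrite /G /W PQ0 ?linear0 ?scaler0 //; lia.
have finG i m : fin_support (fun t => al ^ t *: ezexp A (t + i%:Z) (ezexp B (c - t + m%:Z) (W i m))).
  by apply: fin_support_scale; exact: ezexp_fin_support.
under eq_bigr => i _ do under eq_bigr => m _ do rewrite GE.
under eq_bigr => i _ do rewrite -fsum_sum //.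
rewrite -fsum_sum => [|i]; last by apply: fin_support_sum => m.
apply: eq_fsbigr => t _; rewrite scaler_sumr; apply: eq_bigr => i _.
by rewrite scaler_sumr.
Qed.

End Delta.

Section LinearCombinations.
Variables (F : comPzRingType) (V : lmodType F) (I J : finType).
Variables (M : I -> {linear V -> V}) (N : J -> {linear V -> V}) (g : I -> J -> F).
Hypothesis cMN : forall s t v, M s (N t v) = N t (M s v) + g s t *: v.

Lemma lincomb_exchange (a : I -> F) (b : J -> F) v :
  \sum_s a s *: M s (\sum_t b t *: N t v)
  = \sum_t b t *: N t (\sum_s a s *: M s v)
    + (\sum_s \sum_t a s * b t * g s t) *: v.
Proof.
transitivity (\sum_s \sum_t ((a s * b t) *: N t (M s v) + (a s * b t * g s t) *: v)).
  apply: eq_bigr => s _; rewrite (linear_sum (M s)) scaler_sumr; apply: eq_bigr => t _.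
  by rewrite (linearZZ (M s)) /= cMN scalerDr scalerDr !scalerA.
under eq_bigr do rewrite big_split.
rewrite big_split /= scaler_suml; congr (_ + _); last first.
  by apply: eq_bigr => s _; rewrite scaler_suml.
rewrite exchange_big; apply: eq_bigr => t _; rewrite (linear_sum (N t)) scaler_sumr.
by apply: eq_bigr => s _; rewrite (linearZZ (N t)) /= scalerA mulrC.
Qed.

End LinearCombinations.

(** Extension by zero to the integers, so that an expansion at x = 0 and one at x = oo, the latter
    read at a reflected index, can be compared coefficientwise. *)
Definition int_series (V : nmodType) (c : nat -> V) (i : int) : V :=
  if i is Posz n then c n else 0.

(** * Rational contractions *)

Section Contractions.
Variable F : fieldType.
Implicit Types (a b : F) (g c : nat -> F).

(* c is the exponential of the sum of the g_(n - 1) x^n / n, n > 0 *)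
Definition exp_of g c := c 0%N = 1 /\
  forall n, n%:R * c n = \sum_(i < n) g i * c (n - i.+1)%N.

(** The expansions at x = 0 of 1 - a x, 1 / (1 - a x), (1 - b x) / (1 - a x) and, for distinct a and
    b, 1 / ((1 - a x) (1 - b x)). *)
Definition zero_series a : nat -> F := fun n =>
  match n with 0%N => 1 | 1%N => - a | _ => 0 end.
Definition pole_series a : nat -> F := fun n => a ^+ n.
Definition moebius_series a b : nat -> F := fun n =>
  if n is m.+1 then (a - b) * a ^+ m else 1.
Definition poles_series a b : nat -> F := fun n =>
  (a ^+ n.+1 - b ^+ n.+1) / (a - b).

Lemma exp_of_recl g c : c 0%N = 1 ->
  (forall n, n.+1%:R * c n.+1 = \sum_(i < n) g i * c (n - i)%N + g n) -> exp_of g c.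
Proof.
move=> c0 recc; split=> // -[|n]; first by rewrite big_ord0 mul0r.
by rewrite recc big_ord_recr /= subnn c0 mulr1.
Qed.

(** This expresses log (1 - a x) = - sum of a^n x^n / n; the logarithms of the other three functions
    are sums of such series up to sign. *)
Lemma exp_of_zero a : exp_of (fun i => - a ^+ i.+1) (zero_series a).
Proof.
apply: exp_of_recl => // -[|n]; first by rewrite big_ord0 add0r expr1 mul1r.
rewrite mulr0 big_ord_recr /= subSnn /= mulrNN -exprSr.
rewrite big1 ?add0r ?subrr // => i _.
by rewrite subSn 1?ltnW // -[(n - i)%N]prednK ?subn_gt0 // mulr0.
Qed.

Lemma exp_of_pole a : exp_of (fun i => a ^+ i.+1) (pole_series a).
Proof.
apply: exp_of_recl => // n; rewrite /pole_series.
under eq_bigr => i _ do rewrite -exprD addSn subnKC 1?ltnW //.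
by rewrite sumr_const card_ord -mulrSr mulr_natl.
Qed.

Lemma exp_of_moebius a b : exp_of (fun i => a ^+ i.+1 - b ^+ i.+1) (moebius_series a b).
Proof.
split=> // n; case: n => [|n]; first by rewrite big_ord0 mul0r.
elim: n => [|n IHn]; first by rewrite big_ord1 /= !expr1 expr0 mul1r !mulr1.
rewrite 2!big_ord_recr /= !subSS subSnn subnn /= expr0 !mulr1.
transitivity (a * (n.+1%:R * ((a - b) * a ^+ n)) + (a - b) * a ^+ n.+1).
  by rewrite exprS -[n.+2]addn1 natrD; ring.
rewrite IHn big_ord_recr /= subnn mulr1 mulrDr mulr_sumr -!addrA; congr (_ + _).
  apply: eq_bigr => i _; rewrite !subSS subSn 1?ltnW //=.
  by rewrite -[(n - i)%N]prednK ?subn_gt0 //= !exprS; ring.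
by rewrite !exprS; ring.
Qed.

Lemma exp_of_poles a b : a != b ->
  exp_of (fun i => a ^+ i.+1 + b ^+ i.+1) (poles_series a b).
Proof.
move=> ab; have ab0 : a - b != 0 by rewrite subr_eq0.
(* Multiplying the series by 1 - a x leaves 1 / (1 - b x). *)
have recP n : poles_series a b n.+1 = a * poles_series a b n + b ^+ n.+1.
  by rewrite /poles_series !exprS; field.
have pole0 : poles_series a b 0 = 1 by rewrite /poles_series !expr1 divff.
split=> // n.
elim: n => [|n IHn]; first by rewrite big_ord0 mul0r.
transitivity (a * (n%:R * poles_series a b n) + a * poles_series a b n + n.+1%:R * b ^+ n.+1).
  by rewrite recP -[n.+1]addn1 natrD addn1; ring.
rewrite IHn big_ord_recr /= subnn pole0 mulr1.
transitivity (\sum_(i < n) a * ((a ^+ i.+1 + b ^+ i.+1) * poles_series a b (n - i.+1))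
  + \sum_(i < n) (a ^+ i.+1 * b ^+ (n - i) + b ^+ n.+1) + a ^+ n.+1 + b ^+ n.+1); last first.
  rewrite -big_split -addrA; congr (_ + _); apply: eq_bigr => i _ /=.
  rewrite subSS -[(n - i)%N]prednK ?subn_gt0 // recP -subnS.
  have -> : b ^+ n.+1 = b ^+ i.+1 * b ^+ (n - i.+1).+1.
    by rewrite -exprD; congr (_ ^+ _); have := ltn_ord i; lia.
  by ring.
rewrite -mulr_sumr -!addrA; congr (_ + _).
rewrite big_split /= sumr_const card_ord -[b ^+ n.+1 *+ n]mulr_natl -[n.+1]addn1 natrD.
have -> : a * poles_series a b n = \sum_(i < n) a ^+ i.+1 * b ^+ (n - i) + a ^+ n.+1.
  (* The complete homogeneous symmetric polynomial of degree n in a and b. *)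
  have -> : poles_series a b n = \sum_(i < n.+1) a ^+ i * b ^+ (n - i).
    rewrite /poles_series subrXX mulrC mulKf // (reindex_inj rev_ord_inj).
    by apply: eq_bigr => i _ /=; rewrite subSS subKn // -ltnS.
  rewrite mulr_sumr big_ord_recr /= subnn expr0 mulr1 -exprS; congr (_ + _).
  by apply: eq_bigr => i _; rewrite mulrA -exprS.
by rewrite !addn1; ring.
Qed.

(** Here and in the next four lemmas the second series is read at w - i because it stands for x^w
    times a series in 1/x, w being the degree of the function at infinity. The relation between [ka]
    and [ka'] makes both series expand one rational function. For 1 - a x = - a x (1 - 1/(a x)) both
    expansions are finite and agree; each pole contributes a delta function. *)
Lemma zero_exchange a (ka ka' sg : F) : a != 0 -> ka = - (sg * ka' / a) -> forall i : int,
  ka * int_series (zero_series a) i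
    - sg * (ka' * int_series (zero_series a^-1) (1 - i)) = 0.
Proof.
move=> a0 ->; case=> [[|[|n]]|n].
- by rewrite subr0 /=; field.
- by rewrite subrr /=; field.
- by rewrite (_ : 1 - n.+2%:Z = Negz n) /=; [ring | lia].
- by rewrite (_ : 1 - Negz n = n.+2%:Z) /=; [ring | lia].
Qed.

Lemma trivial_exchange (ka ka' sg : F) : ka = sg * ka' -> forall i : int,
  ka * int_series (fun n => (n == 0%N)%:R) i
    - sg * (ka' * int_series (fun n => (n == 0%N)%:R) (0 - i)) = 0.
Proof.
move=> ->; case=> [[|n]|n].
- by rewrite subr0 /=; ring.
- by rewrite (_ : 0 - n.+1%:Z = Negz n) /=; [ring | lia].
- by rewrite (_ : 0 - Negz n = n.+1%:Z) /=; [ring | lia].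
Qed.

Lemma pole_exchange a (ka ka' sg : F) : a != 0 -> ka = - (sg * ka' * a) -> forall i : int,
  ka * int_series (pole_series a) i
    - sg * (ka' * int_series (pole_series a^-1) (-1 - i)) = ka * a ^ i.
Proof.
move=> a0 ->; case=> n.
- by rewrite (_ : -1 - n%:Z = Negz n) /=; [rewrite /pole_series -exprnP; ring | lia].
- rewrite (_ : -1 - Negz n = n%:Z) /=; last lia.
  by rewrite NegzE -exprnN /pole_series exprVn exprS; field; rewrite a0 expf_neq0.
Qed.

Lemma moebius_exchange a b (ka ka' sg : F) : a != 0 -> b != 0 -> ka = sg * ka' * a / b ->
  forall i : int,
  ka * int_series (moebius_series a b) i
    - sg * (ka' * int_series (moebius_series a^-1 b^-1) (0 - i)) = ka * (1 - b / a) * a ^ i.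
Proof.
move=> a0 b0 ->; case=> [[|n]|n].
- by rewrite subr0 /= expr0z; field; rewrite a0 b0.
- rewrite (_ : 0 - n.+1%:Z = Negz n) /=; last lia.
  by rewrite -exprnP exprS; field; rewrite a0 b0.
- rewrite (_ : 0 - Negz n = n.+1%:Z) /=; last lia.
  by rewrite NegzE -exprnN exprVn exprS; field; rewrite a0 b0 expf_neq0.
Qed.

Lemma poles_exchange a b (ka ka' sg : F) : a != 0 -> b != 0 -> a != b -> ka = sg * ka' * a * b ->
  forall i : int,
  ka * int_series (poles_series a b) i
    - sg * (ka' * int_series (poles_series a^-1 b^-1) (-2 - i))
  = ka * a / (a - b) * a ^ i - ka * b / (a - b) * b ^ i.
Proof.
move=> a0 b0 ab ->; have ab0 : a - b != 0 by rewrite subr_eq0.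
have ba0 : b - a != 0 by rewrite subr_eq0 eq_sym.
case=> [n|[|n]].
- rewrite (_ : -2 - n%:Z = Negz n.+1) /=; last lia.
  by rewrite /poles_series -!exprnP !exprS; field.
- rewrite (_ : -2 - Negz 0 = Negz 0) /=; last lia.
  by rewrite NegzE -!exprnN !expr1; field; rewrite a0 b0 ab0.
- rewrite (_ : -2 - Negz n.+1 = n%:Z) /=; last lia.
  rewrite NegzE -!exprnN /poles_series !exprVn !exprS.
  by field; rewrite !expf_neq0 ?a0 ?b0 ?ab0 ?mulN1r.
Qed.

End Contractions.

Lemma eq_sum2_swap (V : nmodType) (I J : finType) (F : I -> J -> V) (G : J -> I -> V) :
  (forall i j, F i j = G j i) ->
  \sum_(i : I) \sum_(j : J) F i j = \sum_(j : J) \sum_(i : I) G j i.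
Proof.
by move=> FG; rewrite exchange_big; apply: eq_bigr => j _; apply: eq_bigr.
Qed.

Lemma mulr_natACA (F : comPzRingType) (a b : F) (m n m' n' : nat) :
  (m * n = m' * n')%N -> a * m%:R * (b * n%:R) = b * m'%:R * (a * n'%:R).
Proof. by move=> e; rewrite mulrACA [RHS]mulrACA -!natrM e [b * a]mulrC. Qed.

Lemma scale_congr (F : pzRingType) (V : lmodType F) (a b : F) (u v : V) :
  a = b -> u = v -> a *: u = b *: v.
Proof. by move=> -> ->. Qed.

(** The disjunctions here and in [lower_scalar] treat an absent oscillator: removing it from a
    multiset changes nothing, so the vectors or energies do not match, but the coefficient is 0. *)
Lemma scale_natD (F : pzRingType) (V : lmodType F) (a : F) (m n : nat) (u u' w : V) :
  n = 0%N \/ u = u' -> (a * m%:R) *: u = w ->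
  (a * (m + n)%:R) *: u = (a * n%:R) *: u' + w.
Proof.
rewrite natrD mulrDr scalerDl addrC => -[->|->] -> //.
by rewrite mulr0 !scale0r.
Qed.

Lemma lower_scalar (F : comPzRingType) (a : F) (m e e' l : nat) :
  m = 0%N \/ e = (l + e')%N ->
  a * m%:R * e'%:R = e%:R * (a * m%:R) - l%:R * (a * m%:R).
Proof.
case=> ->; first by rewrite !(mulr0, mul0r) subr0.
by rewrite natrD mulrDl addrAC subrr add0r mulrC.
Qed.

(** * The Fock space *)

Section Fock.
Variable R : realType.
Local Notation C := R[i].
Local Notation label := (label R).
Local Notation basis := (basis R).
Local Notation fock := (fock R).
Implicit Types (f : basis -> fock) (b : basis) (u v : fock) (h : label -> C) (a : C).

Lemma linextEw f (d : {fset basis}) v : (msupp v `<=` d)%fset ->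
  linext f v = \sum_(b <- d) v@_b *: f b.
Proof.
move=> le_vd; apply: big_fset_incl => // b _ /mcoeff_outdom ->; exact: scale0r.
Qed.

Lemma linext_linear f : linear (linext f).
Proof.
move=> a u v; pose d := (msupp u `|` msupp v `|` msupp (a *: u + v))%fset.
have le_u : (msupp u `<=` d)%fset by rewrite /d -fsetUA fsubsetUl.
have le_v : (msupp v `<=` d)%fset.
  by apply: fsubset_trans (fsubsetUl _ _); apply: fsubsetUr.
rewrite (linextEw f le_u) (linextEw f le_v) (linextEw f (fsubsetUr _ _ : _ `<=` d)%fset).
rewrite scaler_sumr -big_split; apply: eq_bigr => b _ /=.
by rewrite mcoeffD mcoeffZ scalerDl scalerA.
Qed.
HB.instance Definition _ f :=
  GRing.isLinear.Build C fock fock *:%R (linext f) (linext_linear f).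

(* Opaque, since comparing two distinct << b >> by conversion does not terminate in
   practice. *)
Lemma ket_subproof : {e : basis -> fock | forall b, e b = << b >>}.
Proof. by exists (fun b => << b >>). Qed.

Definition ket b : fock := sval ket_subproof b.

Lemma ketE b : ket b = << b >>.
Proof. exact: (svalP ket_subproof). Qed.

Lemma mcoeff_ket b b' : (ket b)@_b' = (b == b')%:R.
Proof. by rewrite ketE mcoeffU. Qed.

Lemma scale_ket (c : C) b : << c *g b >> = c *: ket b.
Proof.
by rewrite ketE; apply/malgP => b'; rewrite mcoeffU (mcoeffZ c) mcoeffU mulrnAr mulr1.
Qed.

Lemma linextU f b : linext f (ket b) = f b.
Proof.
rewrite ketE (linextEw f (msuppU_le (k := b) (x := 1))) big_seq_fset1.
by rewrite mcoeffUU scale1r.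
Qed.

Lemma fock_sum v : v = \sum_(b <- msupp v) v@_b *: ket b.
Proof. by rewrite [LHS]monalgE; apply: eq_bigr => b _; rewrite scale_ket. Qed.

Lemma eq_linear (S T : {linear fock -> fock}) :
  (forall b, S (ket b) = T (ket b)) -> forall v, S v = T v.
Proof.
move=> eqST v; rewrite [v]fock_sum !linear_sum; apply: eq_bigr => b _.
by rewrite !linearZZ eqST.
Qed.

HB.instance Definition _ h := GRing.Linear.copy (diag h) (linext _).
HB.instance Definition _ (d : label) := GRing.Linear.copy (translate d) (linext _).

Lemma diagU h b : diag h (ket b) = h b.1 *: ket b.
Proof. by rewrite /diag linextU scale_ket. Qed.

Lemma translateU d b : translate d (ket b) = ket (b.1 + d, b.2).
Proof. by rewrite /translate linextU ketE. Qed.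

Definition energy_of (m : {mset (osc * nat)%type}%mset) : nat :=
  \sum_(x <- m) x.2.+1.

Lemma energy_ofD x m : energy_of (x +` m)%mset = (x.2.+1 + energy_of m)%N.
Proof.
rewrite /energy_of -[x.2.+1 in RHS]/((fun y : osc * nat => y.2.+1) x).
rewrite -(big_cons _ _ x m xpredT (fun y => y.2.+1)); apply: perm_big.
by rewrite -[m in X in perm_eq X _]seq_mset_id -mset_cons perm_eq_seq_mset.
Qed.

Definition energy : fock -> fock :=
  linext (fun b => ((energy_of b.2)%:R : C) *: ket b).
HB.instance Definition _ := GRing.Linear.copy energy (linext _).

Lemma energyU b : energy (ket b) = ((energy_of b.2)%:R : C) *: ket b.
Proof. by rewrite /energy linextU. Qed.

(** Membership in the Fock module of label p, expressed by the action of all functions of the label,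
    and in its part of energy D. The energy is an integer so that it can be lowered without
    truncation. *)
Definition homog (p : label) (D : int) v :=
  (forall h, diag h v = h p *: v) /\ energy v = (D%:~R : C) *: v.

Lemma diagZ h a v : diag h (a *: v) = a *: diag h v.
Proof. exact: (linearZZ (diag h)). Qed.

Lemma translateZ d a v : translate d (a *: v) = a *: translate d v.
Proof. exact: (linearZZ (translate d)). Qed.

Lemma energyZ a v : energy (a *: v) = a *: energy v.
Proof. exact: (linearZZ energy). Qed.

Lemma homog_diag p D v h : homog p D v -> diag h v = h p *: v.
Proof. by case=> hv _; exact: hv. Qed.

Lemma homog_energy p D v : homog p D v -> energy v = (D%:~R : C) *: v.
Proof. by case. Qed.

Lemma homogU b : homog b.1 (energy_of b.2) (ket b).
Proof. by split=> [h|]; [exact: diagU | exact: energyU]. Qed.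

Lemma homogD p D u v : homog p D u -> homog p D v -> homog p D (u + v).
Proof.
move=> hu hv; split=> [h|].
  by rewrite (linearD (diag h)) /= (homog_diag h hu) (homog_diag h hv) scalerDr.
by rewrite (linearD energy) /= (homog_energy hu) (homog_energy hv) scalerDr.
Qed.

Lemma homogZ p D a v : homog p D v -> homog p D (a *: v).
Proof.
move=> hv; split=> [h|].
  by rewrite diagZ (homog_diag h hv) !scalerA mulrC.
by rewrite energyZ (homog_energy hv) !scalerA mulrC.
Qed.

Lemma homog0 p D : homog p D 0.
Proof. by split=> [h|]; rewrite scaler0; [exact: (linear0 (diag h)) | exact: (linear0 energy)]. Qed.

Lemma homog_sum p D I (r : seq I) (P : pred I) (G : I -> fock) :
  (forall i, P i -> homog p D (G i)) -> homog p D (\sum_(i <- r | P i) G i).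
Proof.
move=> homG; apply: (big_ind (homog p D)); last exact: homG.
  exact: homog0.
by move=> u v; exact: homogD.
Qed.

Lemma energyE v b : (energy v)@_b = (energy_of b.2)%:R * v@_b.
Proof.
have vE : v@_b = \sum_(b' <- msupp v) v@_b' * (b' == b)%:R.
  rewrite {1}[v]fock_sum (raddf_sum (mcoeff b)) /=; apply: eq_bigr => b' _.
  by rewrite (mcoeffZ v@_b') mcoeff_ket.
rewrite {}vE mulr_sumr /energy /linext (raddf_sum (mcoeff b)) /=.
apply: eq_bigr => b' _; rewrite (mcoeffZ v@_b') (mcoeffZ (energy_of b'.2)%:R) mcoeff_ket.
have [->|ne] := eqVneq b' b; first by rewrite mulrCA.
by rewrite !mulr0.
Qed.

(** Basis vectors have natural energies. This is the source of all finiteness: annihilators of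
    degree above the energy give 0. *)
Lemma homog_lt0 p (D : int) v : D < 0 -> homog p D v -> v = 0.
Proof.
move=> D_lt0 /homog_energy/malgP ev; apply/malgP => b; rewrite mcoeff0; move: (ev b) => {ev}.
rewrite energyE mcoeffZ => /eqP; rewrite -subr_eq0 -mulrBl mulf_eq0 => /orP[|/eqP //].
rewrite -[(energy_of b.2)%:R]/((energy_of b.2)%:Z%:~R) -rmorphB /= intr_eq0; lia.
Qed.

Lemma diag_translate d h v :
  diag h (translate d v) = translate d (diag (fun p => h (p + d)) v).
Proof.
apply: (eq_linear (S := diag h \o translate d)
                  (T := translate d \o diag (fun p => h (p + d)))) => b /=.
by rewrite translateU !diagU /= translateZ translateU.
Qed.

Lemma energy_translate d v : energy (translate d v) = translate d (energy v).
Proof.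
apply: (eq_linear (S := energy \o translate d) (T := translate d \o energy)) => b /=.
by rewrite translateU !energyU translateZ translateU.
Qed.

Lemma homog_translate p D d v : homog p D v -> homog (p + d) D (translate d v).
Proof.
move=> hv; split=> [h|].
  by rewrite diag_translate (homog_diag _ hv) translateZ.
by rewrite energy_translate (homog_energy hv) translateZ.
Qed.

Lemma translate_comp d d' v : translate d (translate d' v) = translate (d' + d) v.
Proof.
apply: (eq_linear (S := translate d \o translate d') (T := translate (d' + d))) => b /=.
by rewrite !translateU /= addrA.
Qed.

Variables lnq k : C.
Local Notation mode := (mode lnq k).
Local Notation contr := (contr lnq k).
Arguments Defs.mode : simpl never.

Lemma mode_linear s n : linear (mode s n).
Proof. by move=> a u v; case: n => [[|l]|l]; rewrite /mode linearP. Qed.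
HB.instance Definition _ s n :=
  GRing.isLinear.Build C fock fock *:%R (mode s n) (mode_linear s n).

Lemma modeZ s n a v : mode s n (a *: v) = a *: mode s n v.
Proof. exact: (linearZZ (mode s n)). Qed.

Lemma mode_negU s l b : mode s (Negz l) (ket b) = ket (b.1, ((s, l) +` b.2)%mset).
Proof. by rewrite /mode linextU ketE. Qed.

Lemma mode_posU s l b : mode s (Posz l.+1) (ket b)
  = \sum_(t : osc) (contr s t l.+1 * (b.2 (t, l))%:R)
       *: ket (b.1, (b.2 `\ (t, l))%mset).
Proof.
by rewrite /mode linextU; apply: eq_bigr => t _; rewrite scale_ket.
Qed.

Lemma mode_negC s t l l' v :
  mode s (Negz l) (mode t (Negz l') v) = mode t (Negz l') (mode s (Negz l) v).
Proof.
apply: (eq_linear (S := mode s (Negz l) \o mode t (Negz l'))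
                  (T := mode t (Negz l') \o mode s (Negz l))) => b /=.
by rewrite !mode_negU /= msetDCA.
Qed.

Lemma mode_posposU s t l l' b :
  mode s (Posz l.+1) (mode t (Posz l'.+1) (ket b)) = \sum_(x : osc) \sum_(y : osc)
    (contr t x l'.+1 * (b.2 (x, l'))%:R
      * (contr s y l.+1 * ((b.2 `\ (x, l'))%mset (y, l))%:R))
    *: ket (b.1, (b.2 `\ (x, l') `\ (y, l))%mset).
Proof.
rewrite mode_posU (linear_sum (mode s (Posz l.+1))) /=; apply: eq_bigr => x _.
rewrite modeZ mode_posU scaler_sumr; apply: eq_bigr => y _; exact: scalerA.
Qed.

Lemma mode_posC s t l l' v :
  mode s (Posz l.+1) (mode t (Posz l'.+1) v) = mode t (Posz l'.+1) (mode s (Posz l.+1) v).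
Proof.
apply: (eq_linear (S := mode s (Posz l.+1) \o mode t (Posz l'.+1))
                  (T := mode t (Posz l'.+1) \o mode s (Posz l.+1))) => b /=.
rewrite (mode_posposU s t l l') (mode_posposU t s l' l).
apply: eq_sum2_swap => y x /=.
apply: scale_congr.
  apply: mulr_natACA; rewrite !msetB1E.
  (* Removals of distinct oscillators do not affect each other's multiplicities; if they coincide,
     both orders are the same expression. *)
  have [[-> ->]|] := eqVneq (x, l) (y, l'); first by [].
  by rewrite !subn0 mulnC.
by congr (ket (_, _)); rewrite -!msetBDA msetDC.
Qed.

Lemma mode_posneg s t l l' v :
  mode s (Posz l.+1) (mode t (Negz l') v)
  = mode t (Negz l') (mode s (Posz l.+1) v)
    + (if l == l' then contr s t l.+1 else 0) *: v.
Proof.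
set c : C := if _ then _ else _.
apply: (eq_linear (S := mode s (Posz l.+1) \o mode t (Negz l'))
  (T := mode t (Negz l') \o mode s (Posz l.+1) \+ c \*: idfun)) => -[b1 b2] /=.
rewrite mode_negU !mode_posU (linear_sum (mode t _)) /=.
under [X in _ = X + _]eq_bigr => x _ do rewrite modeZ mode_negU /=.
have -> : c *: ket (b1, b2) = \sum_(x : osc)
    (if x == t then c *: ket (b1, b2) else 0).
  by rewrite -big_mkcond big_pred1_eq.
rewrite -big_split; apply: eq_bigr => x _ /=.
rewrite mset1DE; apply: scale_natD.
  have [b2x0|b2x] := posnP (b2 (x, l)); [by left | right].
  congr (ket (_, _)); apply/msetP => y; rewrite mset1DE !msetB1E mset1DE.
  by have [->|_] := eqVneq y (x, l); rewrite ?subn0 // addnBA.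
rewrite xpair_eqE andbC /c; have [->|_] := eqVneq l l'; last first.
  by rewrite mulr0 !scale0r if_same.
have [->|_] := eqVneq x t; last by rewrite mulr0 scale0r.
by rewrite mulr1 msetD1K.
Qed.

Lemma translate_neg s l d v :
  translate d (mode s (Negz l) v) = mode s (Negz l) (translate d v).
Proof.
apply: (eq_linear (S := translate d \o mode s (Negz l))
                  (T := mode s (Negz l) \o translate d)) => b /=.
by rewrite mode_negU !translateU mode_negU.
Qed.

Lemma translate_pos s l d v :
  translate d (mode s (Posz l.+1) v) = mode s (Posz l.+1) (translate d v).
Proof.
apply: (eq_linear (S := translate d \o mode s (Posz l.+1))
                  (T := mode s (Posz l.+1) \o translate d)) => b /=.
rewrite translateU !mode_posU (linear_sum (translate d)); apply: eq_bigr => t _ /=.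
by rewrite translateZ translateU.
Qed.

Lemma homog_neg s l p D v : homog p D v -> homog p (D + l.+1%:Z) (mode s (Negz l) v).
Proof.
move=> hv; split=> [h|].
  have -> : diag h (mode s (Negz l) v) = mode s (Negz l) (diag h v).
    apply: (eq_linear (S := diag h \o mode s (Negz l))
                      (T := mode s (Negz l) \o diag h)) => b /=.
    by rewrite mode_negU !diagU modeZ mode_negU.
  by rewrite (homog_diag h hv) modeZ.
have -> : energy (mode s (Negz l) v) = mode s (Negz l) (energy v)
    + (l.+1%:R : C) *: mode s (Negz l) v.
  apply: (eq_linear (S := energy \o mode s (Negz l)) (T := mode s (Negz l) \o energy
    \+ (l.+1%:R : C) \*: mode s (Negz l))) => b /=.
  rewrite mode_negU !energyU modeZ mode_negU -scalerDl energy_ofD natrD addrC //.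
by rewrite (homog_energy hv) modeZ -scalerDl rmorphD.
Qed.

Lemma homog_pos s l p D v : homog p D v -> homog p (D - l.+1%:Z) (mode s (Posz l.+1) v).
Proof.
move=> hv; split=> [h|].
  have -> : diag h (mode s (Posz l.+1) v) = mode s (Posz l.+1) (diag h v).
    apply: (eq_linear (S := diag h \o mode s (Posz l.+1))
                      (T := mode s (Posz l.+1) \o diag h)) => b /=.
    rewrite diagU modeZ !mode_posU (linear_sum (diag h)) scaler_sumr /=; apply: eq_bigr => t _.
    by rewrite diagZ diagU !scalerA mulrC.
  by rewrite (homog_diag h hv) modeZ.
have -> : energy (mode s (Posz l.+1) v) = mode s (Posz l.+1) (energy v)
    - (l.+1%:R : C) *: mode s (Posz l.+1) v.
  apply: (eq_linear (S := energy \o mode s (Posz l.+1)) (T := mode s (Posz l.+1) \o energy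
    \- (l.+1%:R : C) \*: mode s (Posz l.+1))) => b /=.
  rewrite energyU modeZ !mode_posU (linear_sum energy) !scaler_sumr -sumrB /=.
  apply: eq_bigr => t _; rewrite energyZ energyU !scalerA -scalerBl /=.
  apply: scale_congr; last by [].
  apply: lower_scalar; have [b2x0|b2x] := posnP (b.2 (t, l)); [by left | right].
  by rewrite -(energy_ofD (t, l)) msetB1K // -mset_gt0.
by rewrite (homog_energy hv) modeZ -scalerBl rmorphB.
Qed.

End Fock.

(** * Normally ordered exponentials *)

Section LinearFunctions.
Variables (F : pzRingType) (U V : lmodType F) (S : U -> V).
Hypothesis linS : linear S.

Lemma linear_fun0 : S 0 = 0.
Proof. by rewrite -[X in S X](addNr 0) -scaleN1r linS scaleN1r addNr. Qed.

Lemma linear_funD u v : S (u + v) = S u + S v.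
Proof. by rewrite -[X in S (X + _)]scale1r linS scale1r. Qed.

Lemma linear_funZ a v : S (a *: v) = a *: S v.
Proof. by rewrite -[X in S X]addr0 linS linear_fun0 addr0. Qed.

End LinearFunctions.

Section Nexp.
Variable R : realType.
Local Notation C := R[i].
Local Notation label := (label R).
Local Notation fock := (fock R).
Local Notation fseries := (fseries R).
Implicit Types (A B : fseries) (u v : fock) (x y : C).

Lemma smul_fin_support A B x v :
  (forall y, linear (A y)) -> (forall y, linear (B y)) ->
  (forall b, fin_support (fun y => A (x - y) (B y (ket b)))) ->
  fin_support (fun y => A (x - y) (B y v)).
Proof.
move=> linA linB finAB.
rewrite [v]fock_sum; apply: (big_ind (fun w => fin_support (fun y => A (x - y) (B y w)))).
- by exists fset0 => y _; rewrite (linear_fun0 (linB y)) (linear_fun0 (linA _)).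
- move=> v1 v2 [D1 D1P] [D2 D2P]; exists (D1 `|` D2)%fset => y.
  rewrite inE negb_or => /andP[yD1 yD2].
  by rewrite (linear_funD (linB y)) (linear_funD (linA _)) D1P // D2P // addr0.
- move=> b _; have [D DP] := finAB b; exists D => y yD.
  by rewrite (linear_funZ (linB y)) (linear_funZ (linA _)) DP // scaler0.
Qed.

Lemma smul_linear A B x :
  (forall y, linear (A y)) -> (forall y, linear (B y)) ->
  (forall b, fin_support (fun y => A (x - y) (B y (ket b)))) ->
  linear (smul A B x).
Proof.
move=> linA linB finAB.
have fin v := smul_fin_support v linA linB finAB.
move=> a u v; apply: (fsum_linear (fin u) (fin v)) => y.
by rewrite (linB y) (linA (x - y)); clear.
Qed.

(* A(z) is the series of the (a n) z^(sg n) *)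
Definition nat_series (sg : C) (a : nat -> fock -> fock) A :=
  (forall n v, A (sg * n%:R) v = a n v) /\
  (forall x v, (forall n, x != sg * n%:R) -> A x v = 0).

Lemma nat_series_linear sg a A : nat_series sg a A ->
  (forall n, linear (a n)) -> forall x, linear (A x).
Proof.
move=> [aA A0] lina x c u v.
have [[n ->]|nat_x] := pselect (exists n : nat, x = sg * n%:R).
  by rewrite !aA lina.
have x0 n : x != sg * n%:R by apply/eqP => xn; apply: nat_x; exists n.
by rewrite !A0 // scaler0 addr0.
Qed.

Lemma smul_nat_series sg (a b : nat -> {linear fock -> fock}) A B : sg != 0 ->
  nat_series sg a A -> nat_series sg b B ->
  nat_series sg (fun n v => \sum_(i < n.+1) a i (b (n - i)%N v)) (smul A B).
Proof.
move=> sg0 [aA A0] [bB B0]; split=> [n v|x v nat_x].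
  rewrite /smul (@fsum_fin _ _ _ 'I_n.+1 (fun i => sg * (n - i)%:R)) /=.
  - apply: eq_bigr => i _; have le_in : (i <= n)%N by rewrite -ltnS.
    by rewrite -mulrBr -natrB ?leq_subr // subKn // aA bB.
  - move=> i j /(mulfI sg0) /eqP; rewrite eqr_nat => /eqP e.
    by apply: val_inj => /=; have := ltn_ord i; have := ltn_ord j; lia.
  move=> y y_nin; have [[m ym]|nat_y] := pselect (exists m : nat, y = sg * m%:R).
    rewrite ym -mulrBr; have [le_mn|lt_nm] := leqP m n.
      have lt_n : (n - m < n.+1)%N by rewrite ltnS leq_subr.
      by have := y_nin (Ordinal lt_n); rewrite /= subKn // ym eqxx.
    rewrite A0 // => i; rewrite (inj_eq (mulfI sg0)) subr_eq -natrD eqr_nat; lia.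
  rewrite B0 => [|m]; last by apply/eqP => ym; apply: nat_y; exists m.
  have [[m ->]|nat_x] := pselect (exists m : nat, sg * n%:R - y = sg * m%:R).
    by rewrite aA linear0.
  by rewrite A0 // => m; apply/eqP => xm; apply: nat_x; exists m.
apply: fsbig1 => y _; have [[m ym]|nat_y] := pselect (exists m : nat, y = sg * m%:R).
  rewrite A0 // => n; apply: contra (nat_x (n + m)%N); rewrite ym subr_eq => /eqP ->.
  by rewrite natrD mulrDr.
rewrite B0 => [|m]; last by apply/eqP => ym; apply: nat_y; exists m.
have [[m xm]|nat_xy] := pselect (exists m : nat, x - y = sg * m%:R).
  by rewrite xm aA linear0.
by rewrite A0 // => m; apply/eqP => xm; apply: nat_xy; exists m.
Qed.

(** The series has no constant term, so at the exponent sg n only the powers r <= n contribute, and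
    the infinite sum in [sexp] becomes the finite one in [eexp]. *)
Lemma sexp_nat_series sg (a : nat -> {linear fock -> fock}) A : sg != 0 ->
  nat_series sg (fun n v => if n is m.+1 then a m v else 0) A ->
  nat_series sg (fun n v => eexp a n v) (sexp A).
Proof.
move=> sg0 aA.
have lin_a' n : linear (fun v => if n is m.+1 then a m v else 0 : fock).
  by move=> c u v; case: n => [|n]; rewrite ?linearP // scaler0 addr0.
pose a' n : {linear fock -> fock} :=
  HB.pack (fun v => if n is m.+1 then a m v else 0 : fock)
    (GRing.isLinear.Build C fock fock *:%R _ (lin_a' n)).
have aA' : nat_series sg a' A by [].
have powA r : nat_series sg (fun n v => epow a r n v) (iter r (smul A) (@sone R)).
  elim: r => [|r IHr].
    split=> [n v|x v nat_x] /=; rewrite /sone.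
      by rewrite mulf_eq0 (negPf sg0) pnatr_eq0.
    by have := nat_x 0%N; rewrite mulr0 => /negPf ->.
  have [P1 P2] := @smul_nat_series _ a' (fun n => epow a r n) _ _ sg0 aA' IHr.
  split=> [n v|x v nat_x]; last exact: P2.
  rewrite iterS P1 big_ord_recl add0r; apply: eq_bigr => i _.
  by rewrite lift0.
split=> [n v|x v nat_x].
  rewrite /sexp (@fsum_fin _ _ _ 'I_n.+1 (@nat_of_ord _)); last 2 first.
  - exact: val_inj.
  - move=> r r_nin; rewrite (powA r).1 epow_gt ?scaler0 // ltnNge.
    by apply/negP => le_rn; have := r_nin (Ordinal (le_rn : (r < n.+1)%N)); rewrite eqxx.
  by apply: eq_bigr => r _; rewrite (powA r).1.
by apply: fsbig1 => r _; rewrite (powA r).2 ?scaler0.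
Qed.

Variables lnq k : C.
Local Notation mode := (mode lnq k).
Local Notation eigen := (eigen k).
Local Notation nexp := (nexp lnq k).
Implicit Types (f g : exponent R) (p : label).

Definition ann f l v := \sum_(s : osc) osci f s (Posz l.+1) *: mode s (Posz l.+1) v.
Definition cre f l v := \sum_(s : osc) osci f s (Negz l) *: mode s (Negz l) v.

Lemma ann_linear f l : linear (ann f l).
Proof.
move=> a u v; rewrite scaler_sumr -big_split; apply: eq_bigr => s _ /=.
by rewrite linearP scalerDr !scalerA mulrC.
Qed.
HB.instance Definition _ f l :=
  GRing.isLinear.Build C fock fock *:%R (ann f l) (ann_linear f l).

Lemma cre_linear f l : linear (cre f l).
Proof.
move=> a u v; rewrite scaler_sumr -big_split; apply: eq_bigr => s _ /=.
by rewrite linearP scalerDr !scalerA mulrC.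
Qed.
HB.instance Definition _ f l :=
  GRing.isLinear.Build C fock fock *:%R (cre f l) (cre_linear f l).

Lemma homog_ann f l p D v : homog p D v -> homog p (D - l.+1%:Z) (ann f l v).
Proof. by move=> hv; apply: homog_sum => s _; apply: homogZ; apply: homog_pos. Qed.

Lemma homog_cre f l p D v : homog p D v -> homog p (D + l.+1%:Z) (cre f l v).
Proof. by move=> hv; apply: homog_sum => s _; apply: homogZ; apply: homog_neg. Qed.

Definition eann f n v := eexp (fun l => ann f l) n v.
Definition ecre f n v := eexp (fun l => cre f l) n v.
HB.instance Definition _ f n := GRing.Linear.copy (eann f n) (eexp _ n).
HB.instance Definition _ f n := GRing.Linear.copy (ecre f n) (eexp _ n).

Definition ecrez f (a : int) v := ezexp (fun l => cre f l) a v.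
HB.instance Definition _ f a := GRing.Linear.copy (ecrez f a) (ezexp _ a).

(* On the label p, the zero modes of f act by zscal f p times z^(zpow f p). *)
Definition zpow f p : C := \sum_(s : osc) lnz f s * eigen s p.
Definition zscal f p : C := cexp (\sum_(s : osc) const f s * eigen s p).

Lemma modes_at (P : pred int) f n v : P n ->
  modes lnq k P f (- n%:~R) v = \sum_(s : osc) osci f s n *: mode s n v.
Proof.
move=> Pn; rewrite /modes (_ : [set _ | _]%classic = [set n]%classic) ?fsbig_set1 //.
apply/seteqP; split=> m /= => [[_ /oppr_inj /eqP]|->] //.
by rewrite eqr_int => /eqP.
Qed.

Lemma modes_out (P : pred int) f x v : (forall n, P n -> x != - n%:~R) ->
  modes lnq k P f x v = 0.
Proof.
move=> xP; rewrite /modes (_ : [set _ | _]%classic = set0) ?fsbig_set0 //.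
by apply/seteqP; split=> n //= [/xP/eqP].
Qed.

Lemma sexp_neg f :
  nat_series 1 (ecre f) (sexp (modes lnq k (fun n => n < 0) f)).
Proof.
apply: sexp_nat_series; first exact: oner_neq0.
split=> [[|n] v|x v nat_x].
- rewrite mulr0 modes_out // => n n_lt0; rewrite eq_sym oppr_eq0 intr_eq0; lia.
- rewrite mul1r (_ : n.+1%:R = - (Negz n)%:~R) ?modes_at //.
  by rewrite NegzE rmorphN opprK.
- apply: modes_out => -[//|n] _.
  by rewrite NegzE rmorphN opprK; have := nat_x n.+1; rewrite mul1r.
Qed.

Lemma sexp_pos f :
  nat_series (- 1) (eann f) (sexp (modes lnq k (fun n => 0 < n) f)).
Proof.
apply: sexp_nat_series; first by rewrite oppr_eq0 oner_neq0.
split=> [[|n] v|x v nat_x].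
- rewrite mulr0 modes_out // => n n_lt0; rewrite eq_sym oppr_eq0 intr_eq0; lia.
- by rewrite mulN1r (_ : n.+1%:R = n.+1%:Z%:~R) ?modes_at.
- by apply: modes_out => -[n _|//]; have := nat_x n; rewrite mulN1r.
Qed.

Lemma zero_part_linear f x : linear (zero_part k f x).
Proof.
move=> a u v; rewrite /zero_part /expzero (linearP (diag _)) /=.
exact: (linearP (diag _)).
Qed.

Lemma zero_part_homog f x p D v : homog p D v ->
  zero_part k f x v = if zpow f p == x then zscal f p *: v else 0.
Proof.
move=> hv; rewrite /zero_part /expzero (homog_diag _ hv) diagZ (homog_diag _ hv).
rewrite -/(zpow f p) -/(zscal f p); case: eqP => _; first by rewrite scale1r.
by rewrite scale0r scaler0.
Qed.

Lemma homog_eann f n p D v : homog p D v -> homog p (D - n%:Z) (eann f n v).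
Proof.
rewrite -mulN1r; apply: (@eexp_graded _ _ _ (homog p) (-1)).
- exact: homog0.
- by move=> D' u' v'; exact: homogD.
- by move=> D' a v'; exact: homogZ.
by move=> l D' v' hv'; rewrite mulN1r; exact: homog_ann.
Qed.

Lemma homog_ecre f n p D v : homog p D v -> homog p (D + n%:Z) (ecre f n v).
Proof.
rewrite -[n%:Z]mul1r; apply: (@eexp_graded _ _ _ (homog p) (1)).
- exact: homog0.
- by move=> D' u' v'; exact: homogD.
- by move=> D' a v'; exact: homogZ.
by move=> l D' v' hv'; rewrite mul1r; exact: homog_cre.
Qed.

Lemma homog_ecrez f a p D v : homog p D v -> homog p (D + a) (ecrez f a v).
Proof. by case: a => n hv; [exact: homog_ecre | exact: homog0]. Qed.

Lemma eann_eq0 f n p D v : homog p D v -> D < n%:Z -> eann f n v = 0.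
Proof. by move=> /(homog_eann f n) hv lt_Dn; apply: homog_lt0 hv; lia. Qed.

Definition inner f : fseries :=
  smul (zero_part k f) (sexp (modes lnq k (fun n => 0 < n) f)).

Lemma inner_at f p D v n : homog p D v ->
  inner f (zpow f p - n%:R) v = zscal f p *: eann f n v.
Proof.
move=> hv; rewrite /inner /smul.
have [P0 P1] := sexp_pos f.
rewrite (@fsum_single _ _ _ (- 1 * n%:R)) => [|y ne_y].
  by rewrite P0 (zero_part_homog _ _ (homog_eann f n hv)) mulN1r opprK subrK eqxx.
have [[m ym]|nat_y] := pselect (exists m : nat, y = - 1 * m%:R).
  rewrite ym P0 (zero_part_homog _ _ (homog_eann f m hv)) ifN // mulN1r opprK.
  apply: contra ne_y; rewrite -addrA -subr_eq0 opprD addNKr oppr_eq0 addrC subr_eq0.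
  by rewrite ym => /eqP ->.
by rewrite P1 ?(linear_fun0 (zero_part_linear _ _)) // => m; apply/eqP => ym; apply: nat_y; exists m.
Qed.

Lemma inner_out f p D v y : homog p D v -> (forall n : nat, y != zpow f p - n%:R) ->
  inner f y v = 0.
Proof.
move=> hv y_out; have [P0 P1] := sexp_pos f; apply: fsbig1 => z _.
have [[m zm]|nat_z] := pselect (exists m : nat, z = - 1 * m%:R); last first.
  by rewrite P1 ?(linear_fun0 (zero_part_linear _ _)) // => m; apply/eqP => zm; apply: nat_z; exists m.
rewrite zm P0 (zero_part_homog _ _ (homog_eann f m hv)) ifN // mulN1r opprK.
by apply: contra (y_out m) => /eqP ->; rewrite addrK.
Qed.

Lemma inner_ge f p D v n : homog p D v -> D < n%:Z -> inner f (zpow f p - n%:R) v = 0.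
Proof. by move=> hv lt_Dn; rewrite (inner_at _ _ hv) (eann_eq0 _ hv) // scaler0. Qed.

(** The bound [B] is any number above the energy, so that several exponentials can share it. *)
Lemma nexp_sum f p D v x (B : nat) : homog p D v -> D < B%:Z ->
  nexp f x v = zscal f p *: \sum_(n < B)
    sexp (modes lnq k (fun n => n < 0) f) (x - zpow f p + n%:R)
      (translate (Qpart f) (eann f n v)).
Proof.
move=> hv lt_DB.
have linP y := nat_series_linear (sexp_neg f) (fun n => linearP (ecre f n)) y.
rewrite /nexp -/(inner f) [LHS]/smul.
rewrite (@fsum_fin _ _ _ 'I_B (fun n => zpow f p - n%:R)) /rmul.
- rewrite scaler_sumr; apply: eq_bigr => n _.
  rewrite (inner_at _ _ hv) (linearZZ (translate _)) (linear_funZ (linP _)) /=.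
  by rewrite opprB addrA addrAC -addrA.
- by move=> i j /addrI /oppr_inj /eqP; rewrite eqr_nat => /eqP /val_inj.
move=> y y_out; suff -> : inner f y v = 0 by rewrite linear0 (linear_fun0 (linP _)).
have [[n yn]|nat_y] := pselect (exists n : nat, y = zpow f p - n%:R).
  rewrite yn (inner_ge _ hv) // (lt_le_trans lt_DB) // lez_nat leqNgt.
  by apply/negP => lt_n; have := y_out (Ordinal lt_n); rewrite yn eqxx.
by apply: (inner_out hv) => n; apply/eqP => yn; apply: nat_y; exists n.
Qed.

(** On the label p only exponents of z in the coset [zpow f p] + Z occur; from here on they are
    numbered by the integer a. *)
Lemma nexp_homog f p D v (a : int) (B : nat) : homog p D v -> D < B%:Z ->
  nexp f (zpow f p + a%:~R) v
  = zscal f p *: \sum_(n < B) ecrez f (a + n%:Z) (translate (Qpart f) (eann f n v)).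
Proof.
move=> hv lt_DB; rewrite (nexp_sum _ _ hv lt_DB); congr (_ *: _).
apply: eq_bigr => n _.
have -> : zpow f p + a%:~R - zpow f p + n%:R = (a + n%:Z)%:~R.
  by rewrite [X in X + _]addrC addKr rmorphD.
case: (a + n) => m.
  by rewrite -[X in sexp _ X]mul1r (sexp_neg f).1.
rewrite [RHS]/ecrez /=; apply: (sexp_neg f).2 => i; rewrite mul1r -[i%:R]/(i%:Z%:~R) eqr_int; lia.
Qed.

Lemma nexp_out f p D v x : homog p D v -> (forall a : int, x != zpow f p + a%:~R) ->
  nexp f x v = 0.
Proof.
move=> hv x_out; rewrite (@nexp_sum _ _ _ _ _ (`|D|.+1) hv); last by lia.
rewrite big1 ?scaler0 // => n _; have [P0 P1] := sexp_neg f; apply: P1 => m.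
apply: contra (x_out (m%:Z - n%:Z)); rewrite mul1r => /eqP e.
rewrite rmorphB /= -[m%:~R]/(m%:R) -e; apply/eqP.
by rewrite [X in _ = _ + X]addrK addrC subrK.
Qed.

Lemma nexp_linear f x : linear (nexp f x).
Proof.
have linE y := nat_series_linear (sexp_neg f) (fun n => linearP (ecre f n)) y.
have linP y := nat_series_linear (sexp_pos f) (fun n => linearP (eann f n)) y.
(* The only exponents left, since annihilators of degree above the energy of b vanish. *)
pose supp b := [fset zpow f b.1 - n%:R | n in iota 0 (energy_of b.2).+1]%fset.
have linI y : linear (inner f y).
  apply: smul_linear => // [z|b]; first exact: zero_part_linear.
  exists [fset (- 1) * n%:R | n in iota 0 (energy_of b.2).+1]%fset => z z_out.
  have [P0 P1] := sexp_pos f.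
  have [[m zm]|nat_z] := pselect (exists m : nat, z = - 1 * m%:R); last first.
    by rewrite P1 ?(linear_fun0 (zero_part_linear _ _)) // => m; apply/eqP => zm; apply: nat_z; exists m.
  rewrite zm P0 (eann_eq0 _ (homogU b)) ?(linear_fun0 (zero_part_linear _ _)) // ltz_nat ltnNge -ltnS.
  apply: contra z_out => lt_m; by apply/imfsetP; exists m; [rewrite mem_iota | by []].
have linT y : linear (translate (Qpart f) \o inner f y).
  by move=> a u v; rewrite /= linI linearP.
rewrite /nexp -/(inner f).
have -> : smul (rmul (sexp (modes lnq k (fun n => n < 0) f)) (translate (Qpart f)))
    (inner f) = smul (sexp (modes lnq k (fun n => n < 0) f))
    (fun y => translate (Qpart f) \o inner f y) by [].
apply: smul_linear => // b; exists (supp b) => y y_out /=.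
suff -> : inner f y (ket b) = 0.
  by rewrite linear0 (linear_fun0 (linE _)).
have hb := homogU b.
have [[n yn]|nat_y] := pselect (exists n : nat, y = zpow f b.1 - n%:R); last first.
  by apply: (inner_out hb) => n; apply/eqP => yn; apply: nat_y; exists n.
rewrite yn (inner_ge _ hb) // ltz_nat ltnNge -ltnS; apply: contra y_out => lt_n.
by apply/imfsetP; exists n; [rewrite mem_iota | by []].
Qed.
HB.instance Definition _ f x :=
  GRing.isLinear.Build C fock fock *:%R (nexp f x) (nexp_linear f x).

End Nexp.

Lemma cexpD (R : realType) (x y : R[i]) : cexp (x + y) = cexp x * cexp y.
Proof.
case: x y => [a b] [c d]; rewrite /cexp /= expRD cosD sinD.
by congr Complex; ring.
Qed.

Lemma cexp0 (R : realType) : cexp 0 = 1 :> R[i].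
Proof. by rewrite /cexp /= expR0 cos0 sin0 mulr1 mulr0. Qed.

(** * Products of two normally ordered exponentials *)

Section Products.
Variable R : realType.
Local Notation C := R[i].
Local Notation label := (label R).
Local Notation fock := (fock R).
Variables lnq k : C.
Local Notation mode := (mode lnq k).
Local Notation contr := (contr lnq k).
Local Notation eigen := (eigen k).
Local Notation nexp := (nexp lnq k).
Local Notation ann := (ann lnq k).
Local Notation cre := (cre lnq k).
Local Notation eann := (eann lnq k).
Local Notation ecrez := (ecrez lnq k).
Local Notation zpow := (zpow k).
Local Notation zscal := (zscal k).
Implicit Types (f g : exponent R) (p : label) (u v : fock).

Definition contraction f g l : C :=
  \sum_(s : osc) \sum_(t : osc) osci f s (Posz l.+1) * osci g t (Negz l) * contr s t l.+1.

Lemma cre_commuting f g : commuting (fun l => cre f l) (fun l => cre g l).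
Proof.
move=> i j v; have H := @lincomb_exchange C fock osc osc
  (fun s => mode s (Negz i)) (fun s => mode s (Negz j)) (fun _ _ => 0).
rewrite [LHS]H.
  by rewrite [X in _ + X](_ : _ = 0) ?addr0 // big1 ?scale0r // => s _;
     rewrite big1 // => t _; rewrite mulr0.
by move=> s t u; rewrite scale0r addr0; exact: mode_negC.
Qed.

Lemma ann_commuting f g : commuting (fun l => ann f l) (fun l => ann g l).
Proof.
move=> i j v; have H := @lincomb_exchange C fock osc osc
  (fun s => mode s (Posz i.+1)) (fun s => mode s (Posz j.+1)) (fun _ _ => 0).
rewrite [LHS]H.
  by rewrite [X in _ + X](_ : _ = 0) ?addr0 // big1 ?scale0r // => s _;
     rewrite big1 // => t _; rewrite mulr0.
by move=> s t u; rewrite scale0r addr0; exact: mode_posC.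
Qed.

Lemma ann_cre f g i j v : ann f i (cre g j v)
  = cre g j (ann f i v) + (if i == j then contraction f g i else 0) *: v.
Proof.
have H := @lincomb_exchange C fock osc osc
  (fun s => mode s (Posz i.+1)) (fun s => mode s (Negz j))
  (fun s t => if i == j then contr s t i.+1 else 0).
rewrite [LHS]H.
  apply: (congr1 (fun y => _ + y *: v)); case: eqP => [<-|_]; first by [].
  by apply: big1 => s _; apply: big1 => t _; rewrite mulr0.
by move=> s t u; exact: mode_posneg.
Qed.

Lemma translate_ann d f l v : translate d (ann f l v) = ann f l (translate d v).
Proof.
rewrite /ann (linear_sum (translate d)); apply: eq_bigr => s _ /=.
by rewrite translateZ; apply: scale_congr; [by [] | exact: translate_pos].
Qed.

Lemma translate_cre d f l v : translate d (cre f l v) = cre f l (translate d v).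
Proof.
rewrite /cre (linear_sum (translate d)); apply: eq_bigr => s _ /=.
by rewrite translateZ; apply: scale_congr; [by [] | exact: translate_neg].
Qed.

Lemma translate_eann d f n v : translate d (eann f n v) = eann f n (translate d v).
Proof. exact: (eexp_commute (B := translate d) (translate_ann d f)). Qed.

Lemma coordD p p' s : Defs.coord (p + p') s = Defs.coord p s + Defs.coord p' s.
Proof.
case: p p' => [[[[[p1 p2] p3] p4] p5] p6] [[[[[r1 r2] r3] r4] r5] r6].
by case: s => [i||||] /=; rewrite ?rmorphD //; case: ifP.
Qed.

Lemma eigenD s p p' : eigen s (p + p') = eigen s p + eigen s p'.
Proof.
by rewrite /Defs.eigen -big_split; apply: eq_bigr => t _; rewrite coordD mulrDr.
Qed.

Lemma zpowD f p p' : zpow f (p + p') = zpow f p + zpow f p'.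
Proof. by rewrite /zpow -big_split; apply: eq_bigr => s _; rewrite eigenD mulrDr. Qed.

Lemma zscalD f p p' : zscal f (p + p') = zscal f p * zscal f p'.
Proof.
rewrite /zscal -cexpD -big_split; congr cexp; apply: eq_bigr => s _.
by rewrite eigenD mulrDr.
Qed.

(** The coefficient of z^a w^b in :e^{f(z) + g(w)}: on v, without the zero modes, for M above the
    energy of v. *)
Definition nprod f g M v (a b : int) : fock :=
  \sum_(n < M) \sum_(m < M) ecrez f (a + n%:Z) (ecrez g (b + m%:Z)
    (translate (Qpart f) (translate (Qpart g) (eann f n (eann g m v))))).

(** Normal ordering is symmetric; this is what makes the two orders of a product comparable. *)
Lemma nprodC f g M v a b : nprod f g M v a b = nprod g f M v b a.
Proof.
apply: eq_sum2_swap => n m.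
have -> : translate (Qpart f) (translate (Qpart g) (eann f n (eann g m v)))
        = translate (Qpart g) (translate (Qpart f) (eann g m (eann f n v))).
  rewrite (translate_comp (Qpart f)) (translate_comp (Qpart g)) addrC.
  apply: (congr1 (translate _)); exact: (eexp_commute2 (ann_commuting f g)).
exact: (ezexp_commute2 (cre_commuting f g)).
Qed.

(* c is the exponential of the contraction of f and g *)
Definition exp_contraction f g (c : nat -> C) :=
  exp_of (fun i => i.+1%:R * contraction f g i) c.

Lemma nprod_lt f g M v a b : (b + M%:Z <= 0) -> nprod f g M v a b = 0.
Proof.
move=> lt_b; apply: big1 => n _; apply: big1 => m _.
rewrite [ecrez g _ _]ezexp_lt0; last by have := ltn_ord m; lia.
exact: (linear0 (ecrez f _)).
Qed.

Lemma nprod_fin_support f g M v a b : fin_support (fun i => nprod f g M v (a + i) (b - i)).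
Proof.
apply: (@fin_support_quadrant C fock _ (- a - M%:Z) (b + M%:Z)) => t lt_t.
  by rewrite nprodC nprod_lt //; lia.
by rewrite nprod_lt //; lia.
Qed.

Lemma nexp_homog_homog g p D v b M : homog p D v -> D < M%:Z ->
  homog (p + Qpart g) (D + b) (nexp g (zpow g p + b%:~R) v).
Proof.
move=> hv lt_DM; rewrite (nexp_homog _ _ _ _ hv lt_DM); apply: homogZ.
apply: homog_sum => m _; rewrite (_ : D + b = D - m%:Z + (b + m%:Z)); last by lia.
apply: homog_ecrez; apply: homog_translate; exact: homog_eann.
Qed.

(** Besides the contraction c of the oscillators, the zero modes of f crossing e^{Q_g} give z^w and
    the scalar [zscal f (Qpart g)]. *)
Lemma nexp_mul f g c (w : int) p D v (a b : int) M :
  exp_contraction f g c -> zpow f (Qpart g) = w%:~R ->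
  homog p D v -> D < M%:Z ->
  nexp f (zpow f p + a%:~R) (nexp g (zpow g p + b%:~R) v)
  = (zscal f (Qpart g) * (zscal f p * zscal g p)) *:
     \sum_(i \in [set: int]%classic)
        int_series c i *: nprod f g M v (a - w + i) (b - i).
Proof.
move=> [c0 recc] zw hv lt_DM; pose J := (`|b| + M)%N.
have hu := nexp_homog_homog g b hv lt_DM.
(* f acts on the label translated by Q_g, and the exponent counted from there is a - w. *)
have -> : zpow f p + a%:~R = zpow f (p + Qpart g) + (a - w)%:~R.
  by rewrite zpowD zw rmorphB /= addrAC addrA addrNK.
have lt_J : D + b < (J + M)%N%:Z by rewrite /J; lia.
rewrite (nexp_homog _ _ _ _ hu lt_J) (nexp_homog _ _ _ _ hv lt_DM).
under eq_bigr => n _ do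
  rewrite (linearZZ (eann f n)) (linearZZ (translate _)) (linearZZ (ecrez f _)) /=.
rewrite -scaler_sumr scalerA; apply: scale_congr.
  by rewrite zscalD [zscal f p * _]mulrC -mulrA.
have VP := @vertex_product C fock (fun l => cre g l) (fun l => ann f l)
  (contraction f g) c (cre_commuting g g) (ann_commuting f f) (ann_cre f g) c0 recc
  (fun a => ecrez f a) (translate (Qpart f))
  (fun m => translate (Qpart g) (eann g m v)) M J (a - w) b (translate_cre _ _).
rewrite [LHS]VP; last first.
- by rewrite /J; lia.
- move=> n m le_Mn; rewrite -[eexp _ _ _]/(eann f n _) -translate_eann.
  rewrite (eann_eq0 _ _ _ (homog_eann lnq k g m hv)) ?(linear0 (translate _)) //; lia.
rewrite (@fsum_fin _ C fock 'I_J (fun j => Posz j)).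
- apply: eq_bigr => j _; apply: scale_congr; first by [].
  apply: eq_bigr => n _; apply: eq_bigr => m _.
  by rewrite -[eexp _ _ _]/(eann f n _) -translate_eann.
- by move=> i j [] /val_inj.
move=> [j|j] j_out; last by rewrite scale0r.
rewrite nprod_lt ?scaler0 //.
suff : (J <= j)%N by rewrite /J; lia.
by rewrite leqNgt; apply/negP => lt_jJ; have := j_out (Ordinal lt_jJ); rewrite eqxx.
Qed.

End Products.

Lemma eq_on_kets (R : realType) (S T : fock R -> fock R) : linear S -> linear T ->
  (forall b, S (ket b) = T (ket b)) -> forall v, S v = T v.
Proof.
move=> linS linT eqST v; rewrite [v]fock_sum.
apply: (big_ind (fun u => S u = T u)).
- by rewrite (linear_fun0 linS) (linear_fun0 linT).
- by move=> u1 u2 e1 e2; rewrite (linear_funD linS) (linear_funD linT) e1 e2.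
- by move=> b _; rewrite (linear_funZ linS) (linear_funZ linT) eqST.
Qed.

Lemma scale_split (F : pzRingType) (V : lmodType F) (a b c d : F) (u : V) :
  c = d * a -> (c + b) *: u = d *: (a *: u) + b *: u.
Proof. by move=> ->; rewrite scalerDl scalerA. Qed.

(** * The exponential of f(q^l w) + g(w) *)

Section Commutators.
Variable R : realType.
Local Notation C := R[i].
Local Notation label := (label R).
Local Notation fock := (fock R).
Variables lnq k : C.
Local Notation eigen := (eigen k).
Local Notation nexp := (nexp lnq k).
Local Notation ann := (ann lnq k).
Local Notation cre := (cre lnq k).
Local Notation eann := (eann lnq k).
Local Notation zpow := (zpow k).
Local Notation zscal := (zscal k).
Local Notation nprod := (nprod lnq k).
Local Notation qpow := (qpow lnq).
Local Notation qsubst := (qsubst lnq).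
Implicit Types (f g : exponent R) (p : label) (u v : fock).

Lemma qpowD x y : qpow (x + y) = qpow x * qpow y.
Proof. by rewrite /Defs.qpow mulrDl cexpD. Qed.

Lemma qpow0 : qpow 0 = 1.
Proof. by rewrite /Defs.qpow mul0r cexp0. Qed.

Lemma qpowVK x : qpow x * qpow (- x) = 1.
Proof. by rewrite -qpowD subrr qpow0. Qed.

Lemma qpow_neq0 x : qpow x != 0.
Proof.
apply/eqP => qx0; have := qpowVK x; rewrite qx0 mul0r => /esym/eqP.
by rewrite oner_eq0.
Qed.

Lemma qpowN x : qpow (- x) = (qpow x)^-1.
Proof. by apply: (mulfI (qpow_neq0 x)); rewrite qpowVK divff ?qpow_neq0. Qed.

Lemma qpowMn x n : qpow (x * n%:R) = qpow x ^+ n.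
Proof.
elim: n => [|n IHn]; first by rewrite mulr0 qpow0.
by rewrite -addn1 natrD mulrDr mulr1 qpowD IHn exprD.
Qed.

Lemma qpowMz x (a : int) : qpow (x * a%:~R) = qpow x ^ a.
Proof.
case: a => n; first exact: qpowMn.
by rewrite NegzE rmorphN mulrN qpowN qpowMn exprnN.
Qed.

Lemma cre_qsubst l f g i v :
  cre (eadd (qsubst l f) g) i v = qpow l ^+ i.+1 *: cre f i v + cre g i v.
Proof.
rewrite /cre scaler_sumr -big_split; apply: eq_bigr => s _ /=.
apply: scale_split; rewrite [osci f s _ * _]mulrC; apply: (congr1 ( *%R^~ _)).
by rewrite NegzE rmorphN mulrN opprK qpowMn.
Qed.

Lemma ann_qsubst l f g i v :
  ann (eadd (qsubst l f) g) i v = (qpow l)^-1 ^+ i.+1 *: ann f i v + ann g i v.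
Proof.
rewrite /ann scaler_sumr -big_split; apply: eq_bigr => s _ /=.
apply: scale_split; rewrite [osci f s _ * _]mulrC; apply: (congr1 ( *%R^~ _)).
by rewrite qpowN exprVn qpowMn.
Qed.

Lemma zpow_eadd l f g p : zpow (eadd (qsubst l f) g) p = zpow f p + zpow g p.
Proof. by rewrite /zpow -big_split; apply: eq_bigr => s _; rewrite /= mulrDl. Qed.

Lemma zscal_eadd l f g p :
  zscal (eadd (qsubst l f) g) p = qpow (l * zpow f p) * (zscal f p * zscal g p).
Proof.
rewrite /zscal /Defs.qpow -!cexpD; congr cexp.
have -> : l * zpow f p * lnq = \sum_(s : osc) lnz f s * (l * lnq) * eigen s p.
  by rewrite mulrAC mulr_sumr; apply: eq_bigr => s _; rewrite mulrCA mulrA.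
rewrite -!big_split; apply: eq_bigr => s _.
by rewrite /= !mulrDl [RHS]addrA [X in X + _]addrC.
Qed.

(** Setting z = q^l w in :e^{f(z) + g(w)}: sums over all ways to share the power of w between the
    two variables, with weight q^(l t); this is [delta_product] together with the zero modes. *)
Lemma nexp_eadd l f g p D v (c : int) (M : nat) : homog p D v -> D < M%:Z ->
  nexp (eadd (qsubst l f) g) (zpow f p + zpow g p + c%:~R) v
  = (qpow (l * zpow f p) * (zscal f p * zscal g p)) *:
     \sum_(t \in [set: int]%classic) qpow l ^ t *: nprod f g M v t (c - t).
Proof.
move=> hv lt_DM; set h := eadd _ _.
rewrite -(zpow_eadd l) (nexp_homog _ _ _ _ hv lt_DM) -zscal_eadd.
apply: scale_congr; first by [].
have expH := @eexp_scaleD C fock (fun i => cre f i) (fun i => cre g i) (fun i => cre h i)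
  (qpow l) (cre_commuting _ _ f f) (cre_commuting _ _ g g) (cre_commuting _ _ f g)
  (cre_qsubst l f g).
have expK n : eexp (fun i => ann h i) n v = \sum_(i < n.+1) qpow l ^- i *:
    eexp (fun i => ann f i) i (eexp (fun i => ann g i) (n - i) v).
  under eq_bigr => i _ do rewrite -exprVn.
  exact: (@eexp_scaleD C fock (fun i => ann f i) (fun i => ann g i) (fun i => ann h i)
    (qpow l)^-1 (ann_commuting _ _ f f) (ann_commuting _ _ g g) (ann_commuting _ _ f g)
    (ann_qsubst l f g)).
have PQ0 i m : (M <= i + m)%N ->
    eexp (fun i => ann f i) i (eexp (fun i => ann g i) m v) = 0.
  move=> le_M; have := homog_eann lnq k f i (homog_eann lnq k g m hv).
  by apply: homog_lt0; lia.
rewrite [LHS](delta_product (qpow_neq0 l) expH (translate (Qpart h)) expK PQ0 c).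
apply: eq_fsbigr => t _; apply: scale_congr; first by [].
apply: eq_bigr => n _; apply: eq_bigr => m _.
have -> : translate (Qpart f) (translate (Qpart g) (eann f n (eann g m v)))
  = translate (Qpart h) (eann f n (eann g m v)) by rewrite translate_comp addrC.
by [].
Qed.

End Commutators.

Lemma commutator_linear (F : comPzRingType) (V : lmodType F) (S T : {linear V -> V}) (c : F) :
  linear (fun v => S (T v) - c *: T (S v)).
Proof.
move=> a u v; rewrite (linearP T a u) (linearP S a u) (linearP S) (linearP T) /=.
rewrite scalerDr scalerA [c * a]mulrC -scalerA.
by rewrite scalerBr opprD addrACA.
Qed.

(** * Commutators as sums of delta functions *)

Section Exchange.
Variable R : realType.
Local Notation C := R[i].
Local Notation label := (label R).
Local Notation fock := (fock R).
Variables lnq k : C.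
Local Notation nexp := (nexp lnq k).
Local Notation zpow := (zpow k).
Local Notation zscal := (zscal k).
Local Notation nprod := (nprod lnq k).
Local Notation qpow := (qpow lnq).
Local Notation qsubst := (qsubst lnq).
Implicit Types (f g : exponent R) (p : label) (u v : fock).

Lemma nexp_out_homog f p D v x : homog p D v -> (forall a : int, x != zpow f p + a%:~R) ->
  nexp f x v = 0.
Proof. exact: nexp_out. Qed.

Definition is_int (x : C) : bool := `[< exists a : int, x = a%:~R >].

Lemma nexp_notin f g (w : int) x y b : zpow f (Qpart g) = w%:~R ->
  (forall a : int, x != zpow f b.1 + a%:~R) -> nexp f x (nexp g y (ket b)) = 0.
Proof.
move=> zw x_out; have hb := homogU b.
have [[c yc]|y_out] := pselect (exists c : int, y = zpow g b.1 + c%:~R); last first.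
  rewrite (nexp_out_homog hb) ?(linear0 (nexp f x)) // => a; apply/eqP => ya.
  by apply: y_out; exists a.
have hM : ((energy_of b.2)%:Z < (energy_of b.2).+1%:Z) by lia.
rewrite yc (nexp_out_homog (nexp_homog_homog lnq k g c hb hM)) // => a.
apply: contra (x_out (w + a)) => /eqP ->.
by rewrite zpowD zw rmorphD addrA.
Qed.

(** With (r, l) = [rl] and u the second variable, the coefficient of z^x u^y in r z^w delta(q^l u/z)
    :e^{f(q^l u) + g(u)}:. Only integral powers of z occur in it, whence [is_int]. *)
Definition residue f g (w : int) (x y : C) (rl : C * C) v : fock :=
  (if is_int x then rl.1 * qpow (rl.2 * (w%:~R - x)) else 0)
    *: nexp (eadd (qsubst rl.2 f) g) (x + y - w%:~R) v.

Lemma residue_linear f g w x y (P : seq (C * C)) :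
  linear (fun v => \sum_(rl <- P) residue f g w x y rl v).
Proof.
move=> a u v; rewrite scaler_sumr -big_split; apply: eq_bigr => rl _.
rewrite /residue (linearP (nexp _ _)) /= scalerDr !scalerA.
by rewrite [a * _]mulrC.
Qed.

(* [r alpha^i], i in Z, is the expansion of the delta function at z = alpha w *)
Lemma nexp_exchange f g (c c' : nat -> C) (w : int) (sg : C) (P : seq (C * C)) :
  exp_contraction lnq k f g c -> exp_contraction lnq k g f c' ->
  zpow f (Qpart g) = w%:~R -> zpow g (Qpart f) = w%:~R ->
  (forall p, exists a : int, zpow f p = a%:~R) ->
  (forall i : int, zscal f (Qpart g) * int_series c i
      - sg * (zscal g (Qpart f) * int_series c' (w - i))
    = \sum_(rl <- P) rl.1 * qpow rl.2 ^ i) ->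
  forall x y v, nexp f x (nexp g y v) - sg *: nexp g y (nexp f x v)
    = \sum_(rl <- P) residue f g w x y rl v.
Proof.
move=> ec ec' zw zw' intf scalE x y.
apply: eq_on_kets; [|exact: residue_linear|].
  exact: (commutator_linear (nexp f x) (nexp g y)).
move=> b; have hb := homogU b; have [e0 e0E] := intf b.1.
(* If x or y lies outside the coset of exponents allowed on this basis vector, both sides vanish;
   the main case follows. *)
have [[a xa]|x_out] := pselect (exists a : int, x = zpow f b.1 + a%:~R); last first.
  have xF (a : int) : x != zpow f b.1 + a%:~R.
    by apply/eqP => xa; apply: x_out; exists a.
  rewrite (nexp_notin _ zw xF) (nexp_out_homog hb xF) (linear0 (nexp g y)) scaler0 subr0.
  rewrite big1 // => rl _; rewrite /residue ifN ?scale0r //; apply/asboolP => -[a xa].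
  by apply: x_out; exists (a - e0); rewrite e0E rmorphB /= addrC subrK.
have intx : is_int x by apply/asboolP; exists (e0 + a); rewrite xa e0E rmorphD.
have [[d yd]|y_out] := pselect (exists d : int, y = zpow g b.1 + d%:~R); last first.
  have yF (d : int) : y != zpow g b.1 + d%:~R.
    by apply/eqP => yd; apply: y_out; exists d.
  rewrite (nexp_notin _ zw' yF) (nexp_out_homog hb yF) (linear0 (nexp f x)) scaler0 subr0.
  rewrite big1 // => rl _; rewrite /residue (nexp_out_homog hb) ?scaler0 // => d.
  apply/eqP => yd; apply: y_out; exists (d + w - a).
  have -> : y = x + y - w%:~R + w%:~R - x by rewrite subrK addrC addKr.
  rewrite yd xa zpow_eadd rmorphB rmorphD /=; ring.
pose M := (energy_of b.2).+1; have hM : ((energy_of b.2)%:Z < M%:Z) by rewrite /M; lia.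
rewrite {1 2}xa {1 2}yd (nexp_mul _ _ ec zw hb hM) (nexp_mul _ _ ec' zw' hb hM).
set K := zscal f b.1 * zscal g b.1; rewrite [zscal g b.1 * _]mulrC -/K.
pose Phi i := nprod f g M (ket b) (a - w + i) (d - i).
have finPhi : fin_support Phi by exact: nprod_fin_support.
(* By the symmetry of [nprod] and the reflection i -> w - i, the second order is a sum over the same
   [Phi]. *)
have E2 : \sum_(i \in [set: int]%classic) int_series c' i *: nprod g f M (ket b) (d - w + i) (a - i)
  = \sum_(i \in [set: int]%classic) int_series c' (w - i) *: Phi i.
  rewrite -[LHS](fsum_reflect _ w); apply: eq_fsbigr => i _.
  apply: scale_congr; first by [].
  by rewrite nprodC; apply: (congr2 (nprod f g M (ket b))); lia.
apply: (etrans (congr1 (fun z => _ - sg *: (_ *: z)) E2)).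
apply: (etrans (fsum_delta_combine K finPhi scalE)); apply: eq_bigr => -[r l] _.
rewrite /residue intx /=.
have -> : x + y - w%:~R = zpow f b.1 + zpow g b.1 + (a + d - w)%:~R.
  by rewrite xa yd !rmorphD rmorphN /=; ring.
have E3 := nexp_eadd lnq k l f g (a + d - w) hb hM.
have E4 := fsum_shift_scale (N := fun t => nprod f g M (ket b) t (a + d - w - t))
  (e := a - w) (qpow_neq0 lnq l) _ finPhi.
apply: esym; apply: (etrans (congr1 (fun z => _ *: z) (etrans E3 (congr1 (fun z => _ *: z) (E4 _))))).
  move=> i; rewrite /Phi [i + _]addrC.
  by apply: (congr2 (nprod f g M (ket b))); lia.
apply: scale4_congr; rewrite -/K -qpowMz.
have -> : r * qpow (l * (w%:~R - x)) * (qpow (l * zpow f b.1) * K) * qpow (l * (a - w)%:~R)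
  = K * r * qpow (l * (w%:~R - x) + l * zpow f b.1 + l * (a - w)%:~R).
  by rewrite !qpowD; ring.
(* The powers of q from the residue, the zero modes and the index shift cancel because x = zpow f
   b.1 + a. *)
have -> : l * (w%:~R - x) + l * zpow f b.1 + l * (a - w)%:~R = 0.
  by rewrite xa rmorphB /=; ring.
by rewrite qpow0 mulr1.
Qed.

End Exchange.

Lemma term_comp (F : comPzRingType) (V : lmodType F) (S D : {linear V -> V})
    (a b h : F) (z z' : V) :
  D z = h *: z' -> a *: S (D (b *: z)) = (a * b * h) *: S z'.
Proof. by move=> e; rewrite (linearZZ D) /= e scalerA (linearZZ S) /= scalerA mulrA. Qed.

Lemma divide_residues (F : fieldType) (I : Type) (P : seq I) (r e : I -> F)
    (h z c sg d z' c' : F) : h != 0 ->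
  h * z * c - sg * (d * z' * c') = \sum_(l <- P) r l * e l ->
  z * c - sg * d / h * (z' * c') = \sum_(l <- P) r l / h * e l.
Proof.
move=> h0 E; have -> : z * c - sg * d / h * (z' * c')
    = (h * z * c - sg * (d * z' * c')) / h by field.
by rewrite E mulr_suml; apply: eq_bigr => l _; rewrite mulrAC.
Qed.

Lemma scale_sub_divide (F : fieldType) (V : lmodType F) (a h sg d : F) (u v : V) :
  h != 0 ->
  (a * h) *: u - sg *: ((a * d) *: v) = (a * h) *: (u - (sg * d / h) *: v).
Proof.
move=> h0; rewrite scalerBr !scalerA; congr (_ - _ *: _); by field.
Qed.

Lemma scale_divide (F : fieldType) (V : lmodType F) (a h r e : F) (u : V) :
  h != 0 -> (a * h) *: ((r / h * e) *: u) = a *: ((r * e) *: u).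
Proof. by move=> h0; rewrite !scalerA; congr (_ *: _); field. Qed.

(** * Terms of the currents, with their sign operators *)

Section Terms.
Variable R : realType.
Local Notation C := R[i].
Local Notation label := (label R).
Local Notation fock := (fock R).
Variables lnq k : C.
Local Notation nexp := (nexp lnq k).
Local Notation zpow := (zpow k).
Local Notation zscal := (zscal k).
Local Notation nprod := (nprod lnq k).
Local Notation qpow := (qpow lnq).
Local Notation qsubst := (qsubst lnq).
Implicit Types (f g : exponent R) (p : label) (u v : fock).

(** Only e^{Q_g} changes labels, and a multiplicative function of the label acquires its value at
    Q_g when it passes. *)
Lemma diag_nexp (h : label -> C) g y v :
  (forall p p', h (p + p') = h p * h p') ->
  diag h (nexp g y v) = h (Qpart g) *: nexp g y (diag h v).
Proof.
move=> hM; move: v; apply: eq_on_kets.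
- exact: (linearP (diag h \o nexp g y)).
- exact: (linearP (h (Qpart g) \*: (nexp g y \o diag h))).
move=> b; have hb := homogU b.
rewrite [in RHS](homog_diag h hb) (linearZZ (nexp g y)) /= scalerA.
have [[c yc]|y_out] := pselect (exists c : int, y = zpow g b.1 + c%:~R); last first.
  rewrite (nexp_out_homog lnq hb) ?(linear0 (diag h)) ?scaler0 // => a; apply/eqP => ya.
  by apply: y_out; exists a.
have hM' : ((energy_of b.2)%:Z < (energy_of b.2).+1%:Z) by lia.
rewrite yc (homog_diag h (nexp_homog_homog lnq k g c hb hM')).
by rewrite hM mulrC.
Qed.

Lemma diag_comp (h h' : label -> C) v : diag h (diag h' v) = diag (fun p => h p * h' p) v.
Proof.
apply: (eq_linear (S := diag h \o diag h') (T := diag (fun p => h p * h' p))) => b /=.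
by rewrite !diagU (linearZZ (diag h)) /= diagU scalerA mulrC.
Qed.

Definition delta0 (n : nat) : C := (n == 0%N)%:R.

Lemma exp_contraction0 f g : (forall l, contraction lnq k f g l = 0) ->
  exp_contraction lnq k f g delta0.
Proof.
move=> fg0; split=> // -[|n]; first by rewrite big_ord0 mul0r.
by rewrite mulr0 big1 // => i _; rewrite fg0 mulr0 mul0r.
Qed.

Section Merge.
Variables A g : exponent R.
Hypothesis Ag0 : forall l, contraction lnq k A g l = 0.
Hypothesis zA0 : zpow A (Qpart g) = 0.
Hypothesis sA0 : zscal A (Qpart g) = 1.
Variables (d x : C).

(** With trivial contraction only the term i = 0 of [nexp_mul] survives, and the sum over y becomes
    that of [nexp_eadd] at l = 0. Finite support is proved along with the value because the passage
    to all vectors requires it. *)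
Lemma merge_ket b : let G y := nexp A (x - y) (nexp g (y + d) (ket b)) in
  fin_support G /\ \sum_(y \in [set: C]%classic) G y = nexp (eadd A g) (x + d) (ket b).
Proof.
move=> G; have hb := homogU b.
have hM : ((energy_of b.2)%:Z < (energy_of b.2).+1%:Z) by lia.
have zA : zpow A (Qpart g) = 0%:~R by rewrite zA0.
have G0 y : (forall j : int, y != zpow g b.1 - d + j%:~R) -> G y = 0.
  move=> y_out; rewrite /G (nexp_out_homog lnq hb) ?(linear0 (nexp A (x - y))) // => j.
  by apply: contra (y_out j) => /eqP yj; rewrite -[y](addrK d) yj addrAC.
have E : eadd A g = eadd (qsubst 0 A) g.
  rewrite /eadd /Defs.qsubst /=; congr Exponent.
  - by apply: funext => s; apply: funext => n; rewrite mul0r oppr0 qpow0 mulr1.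
  - by apply: funext => s; rewrite mul0r mulr0 addr0.
have [[c xc]|x_out] := pselect (exists c : int, x + d = zpow A b.1 + zpow g b.1 + c%:~R);
    last first.
  have Gz y : G y = 0.
    have [[j yj]|y_out] := pselect (exists j : int, y = zpow g b.1 - d + j%:~R); last first.
      by apply: G0 => j; apply/eqP => yj; apply: y_out; exists j.
    apply: (nexp_notin lnq _ zA) => a; apply/eqP => xa; apply: x_out; exists (a + j).
    rewrite rmorphD /= -[x](subrK y) xa yj; ring.
  split; first by exists fset0.
  rewrite fsbig1 // (nexp_out_homog lnq hb) // => c; apply/eqP => xc; apply: x_out.
  by exists c; rewrite xc E zpow_eadd.
pose h (j : int) : C := zpow g b.1 - d + j%:~R.
have inj_h : injective h by move=> i j /addrI/eqP; rewrite eqr_int => /eqP.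
have Gh j : G (h j) = (zscal A b.1 * zscal g b.1)
    *: nprod A g (energy_of b.2).+1 (ket b) (c - j) j.
  rewrite /G.
  have -> : x - h j = zpow A b.1 + (c - j)%:~R.
    by rewrite -[x](addrK d) xc /h rmorphB /=; ring.
  have -> : h j + d = zpow g b.1 + j%:~R by rewrite /h addrAC subrK.
  apply: (etrans (nexp_mul (c - j) j (exp_contraction0 Ag0) zA hb hM)).
  rewrite sA0 mul1r; apply: scale_congr; first by [].
  rewrite (@fsum_single _ _ _ 0) => [|i i_neq0].
    by rewrite /= /delta0 eqxx scale1r subr0 addr0 subr0.
  by case: i i_neq0 => [[|n]|n] //= _; rewrite ?scale0r.
have finh : fin_support (fun j => G (h j)).
  have [D DP] := nprod_fin_support lnq k A g (energy_of b.2).+1 (ket b) 0 c.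
  exists [fset (c - j) | j in D]%fset => j jD; rewrite Gh.
  have -> : nprod A g (energy_of b.2).+1 (ket b) (c - j) j = 0.
    rewrite -(DP (c - j)).
      by apply: (congr2 (nprod A g _ _)); lia.
    apply: contra jD => cjD; apply/imfsetP; exists (c - j) => //=; lia.
  exact: scaler0.
split.
  have [D DP] := finh; exists [fset h j | j in D]%fset => y y_nin.
  have [[j yj]|y_out] := pselect (exists j : int, y = h j); last first.
    by apply: G0 => j; apply/eqP => yj; apply: y_out; exists j.
  rewrite yj DP //; apply: contra y_nin => jD; apply/imfsetP; by exists j.
rewrite (fsum_inj inj_h G0 finh) xc E.
apply: esym; apply: (etrans (nexp_eadd lnq k 0 A g c hb hM)).
rewrite mul0r qpow0 mul1r -fsum_scale; last first.
  have [D DP] := nprod_fin_support lnq k A g (energy_of b.2).+1 (ket b) 0 c.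
  by exists D => t /DP; rewrite add0r => ->; rewrite scaler0.
rewrite -[LHS](fsum_reflect _ c); apply: eq_fsbigr => j _.
rewrite Gh exp1rz scale1r; apply: scale_congr; first by [].
by apply: (congr2 (nprod A g _ _)); lia.
Qed.

Lemma merge_fin_support v : fin_support (fun y => nexp A (x - y) (nexp g (y + d) v)).
Proof.
apply: (smul_fin_support (A := nexp A) (B := fun y => nexp g (y + d))) => [y|y|b].
- exact: nexp_linear.
- exact: nexp_linear.
- by have [] := merge_ket b.
Qed.

Lemma merge v : \sum_(y \in [set: C]%classic) nexp A (x - y) (nexp g (y + d) v)
  = nexp (eadd A g) (x + d) v.
Proof.
move: v; apply: eq_on_kets; last by move=> b; have [] := merge_ket b.
  apply: (smul_linear (A := nexp A) (B := fun y => nexp g (y + d))) => [y|y|b].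
  - exact: nexp_linear.
  - exact: nexp_linear.
  - by have [] := merge_ket b.
exact: nexp_linear.
Qed.

End Merge.

(* the series coef z^(-shift) :e^expo: g, g acting by the character char on the labels *)
Record term := Term {
  coef : C; shift : C; expo : exponent R; char : label -> C }.

Definition tser (t : term) : fseries R := fun x v =>
  coef t *: nexp (expo t) (x + shift t) (diag (char t) v).

Definition character (h : label -> C) := forall p p', h (p + p') = h p * h p'.

Definition mergeable A t := [/\ forall l, contraction lnq k A (expo t) l = 0,
  zpow A (Qpart (expo t)) = 0 & zscal A (Qpart (expo t)) = 1].

Definition merge_term A t := Term (coef t) (shift t) (eadd A (expo t)) (char t).

Lemma smul_terms A (ts : seq term) : foldr (fun t P => mergeable A t /\ P) True ts ->
  forall x v, smul (nexp A) (fun x v => \sum_(t <- ts) tser t x v) x v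
  = \sum_(t <- ts) tser (merge_term A t) x v.
Proof.
move=> Ats x v.
suff [] : fin_support (fun y => nexp A (x - y) (\sum_(t <- ts) tser t y v)) /\
  \sum_(y \in [set: C]%classic) nexp A (x - y) (\sum_(t <- ts) tser t y v)
  = \sum_(t <- ts) tser (merge_term A t) x v by [].
elim: ts Ats => [_|t ts IHts /= [[A1 A2 A3] /IHts [finT sumT]]].
  have z y : nexp A (x - y) (\sum_(t <- [::]) tser t y v) = 0.
    by rewrite big_nil (linear0 (nexp A (x - y))).
  split; first by exists fset0 => y _; exact: z.
  by rewrite [RHS]big_nil; apply: fsbig1 => y _; exact: z.
have finA := merge_fin_support A1 A2 A3 (shift t) x (diag (char t) v).
have GE y : nexp A (x - y) (\sum_(t' <- t :: ts) tser t' y v)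
    = coef t *: nexp A (x - y) (nexp (expo t) (y + shift t) (diag (char t) v))
      + nexp A (x - y) (\sum_(t' <- ts) tser t' y v).
  by rewrite big_cons (linearD (nexp A (x - y))) (linearZZ (nexp A (x - y))).
split; last first.
  rewrite [RHS]big_cons; apply: (etrans (fsum_linear finA finT GE)).
  apply: (congr2 (fun z z' => coef t *: z + z')); last exact: sumT.
  exact: (merge A1 A2 A3).
have [D DP] := fin_supportD (fin_support_scale (fun=> coef t) finA) finT.
by exists D => y yD; rewrite GE; exact: DP.
Qed.

(** Moving both characters to the right leaves a different scalar in each order. Dividing by the
    scalar of the first order, which is nonzero, reduces the claim to [nexp_exchange]. *)
Lemma term_exchange (t u : term) (c c' : nat -> C) (w : int) (sg : C) (P : seq (C * C)) :
  character (char t) -> character (char u) -> char t (Qpart (expo u)) != 0 ->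
  exp_contraction lnq k (expo t) (expo u) c -> exp_contraction lnq k (expo u) (expo t) c' ->
  zpow (expo t) (Qpart (expo u)) = w%:~R -> zpow (expo u) (Qpart (expo t)) = w%:~R ->
  (forall p, exists a : int, zpow (expo t) p = a%:~R) ->
  (forall i : int,
      char t (Qpart (expo u)) * zscal (expo t) (Qpart (expo u)) * int_series c i
      - sg * (char u (Qpart (expo t)) * zscal (expo u) (Qpart (expo t))
                * int_series c' (w - i))
    = \sum_(rl <- P) rl.1 * qpow rl.2 ^ i) ->
  forall x y v, tser t x (tser u y v) - sg *: tser u y (tser t x v)
    = \sum_(rl <- P) (coef t * coef u) *: residue lnq k (expo t) (expo u) w
        (x + shift t) (y + shift u) rl (diag (fun p => char t p * char u p) v).
Proof.
move=> ct cu ct0 ec ec' zw zw' intt scalE x y v.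
set f := expo t; set g := expo u; set h := char t (Qpart g).
set V := diag (fun p => char t p * char u p) v.
have Etu : tser t x (tser u y v) = (coef t * coef u * h) *:
    nexp f (x + shift t) (nexp g (y + shift u) V).
  rewrite /V -diag_comp.
  exact: (term_comp (D := diag (char t)) (nexp f _) _ _ (diag_nexp _ _ _ ct)).
have Eut : tser u y (tser t x v) = (coef t * coef u * char u (Qpart f)) *:
    nexp g (y + shift u) (nexp f (x + shift t) V).
  have -> : V = diag (char u) (diag (char t) v).
    rewrite diag_comp /V; apply: (congr1 (fun h' => diag h' v)).
    by apply: funext => p; rewrite mulrC.
  rewrite [coef t * coef u]mulrC.
  exact: (term_comp (D := diag (char u)) (nexp g _) _ _ (diag_nexp _ _ _ cu)).
have NE := @nexp_exchange R lnq k f g c c' w (sg * char u (Qpart f) / h)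
  [seq (rl.1 / h, rl.2) | rl <- P] ec ec' zw zw' intt _ (x + shift t) (y + shift u) V.
rewrite Etu Eut.
have scalE' i : zscal f (Qpart g) * int_series c i - sg * char u (Qpart f) / h *
    (zscal g (Qpart f) * int_series c' (w - i))
  = \sum_(rl <- [seq (rl.1 / h, rl.2) | rl <- P]) rl.1 * qpow rl.2 ^ i.
  rewrite big_map /=; exact: (divide_residues ct0 (scalE i)).
have NE' := NE scalE'.
have -> : (coef t * coef u * h) *: nexp f (x + shift t) (nexp g (y + shift u) V)
  - sg *: ((coef t * coef u * char u (Qpart f)) *:
      nexp g (y + shift u) (nexp f (x + shift t) V))
  = (coef t * coef u * h) *: (nexp f (x + shift t) (nexp g (y + shift u) V) -
      (sg * char u (Qpart f) / h) *: nexp g (y + shift u) (nexp f (x + shift t) V)).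
  exact: (scale_sub_divide _ _ _ _ _ ct0).
apply: (etrans (congr1 (fun z => _ *: z) NE')).
rewrite big_map scaler_sumr; apply: eq_bigr => rl _.
rewrite /residue; case: ifP => _; last by rewrite !scale0r !scaler0.
exact: (scale_divide _ _ _ _ ct0).
Qed.

End Terms.

(** * Symbolic exponents *)

(* (u, v) stands for the exponent (u + v k) / 2 of q. *)
Definition qexponent := (int * int)%type.
Definition qadd (d e : qexponent) : qexponent := (d.1 + e.1, d.2 + e.2).
Definition qopp (e : qexponent) : qexponent := (- e.1, - e.2).
Definition qscale (a : int) (e : qexponent) : qexponent := (a * e.1, a * e.2).

(* (c, e) stands for the monomial c (q^m)^e. *)
Definition laurent := seq (int * qexponent).
Definition lneg (L : laurent) : laurent := [seq (- x.1, x.2) | x <- L].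
Definition lshift (e : qexponent) (L : laurent) : laurent := [seq (x.1, qadd x.2 e) | x <- L].
Definition lmul (L M : laurent) : laurent :=
  flatten [seq [seq (x.1 * y.1, qadd x.2 y.2) | y <- M] | x <- L].
Definition lcoef (L : laurent) (e : qexponent) : int :=
  foldr (fun x a => if x.2 == e then x.1 + a else a) 0 L.
(** Monomials may be repeated, so total coefficients are compared. Distinct pairs (u, v) count as
    distinct monomials: the test is sufficient for equality of values at every q and k. *)
Definition leqL (L M : laurent) : bool :=
  all (fun e => lcoef L e == lcoef M e) (map snd L ++ map snd M).

Section LaurentSums.
Variables (F : comPzRingType) (g : qexponent -> F).

Definition lsum (L : laurent) : F := \sum_(x <- L) x.1%:~R * g x.2.

Lemma lsum_lcoef (L : laurent) (K : seq qexponent) : uniq K ->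
  {subset map snd L <= K} -> lsum L = \sum_(e <- K) (lcoef L e)%:~R * g e.
Proof.
move=> uniqK; elim: L => [|x L IHL] sub.
  by rewrite /lsum big_nil big1 // => e _; rewrite /= mul0r.
rewrite /lsum big_cons -/(lsum L) IHL => [|e eL]; last by apply: sub; rewrite inE eL orbT.
have xK : x.2 \in K by apply: sub; rewrite inE eqxx.
rewrite (bigD1_seq x.2) //= [RHS](bigD1_seq x.2) //= eqxx addrA rmorphD mulrDl.
by congr (_ + _); apply: eq_bigr => e ne; rewrite /= eq_sym (negPf ne).
Qed.

Lemma eq_lsum (L M : laurent) : leqL L M -> lsum L = lsum M.
Proof.
move=> /allP LM; pose K := undup (map snd L ++ map snd M).
have KE e : (e \in K) = (e \in map snd L) || (e \in map snd M).
  by rewrite mem_undup mem_cat.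
rewrite (@lsum_lcoef L K) ?undup_uniq // => [|e eL]; last by rewrite KE eL.
rewrite (@lsum_lcoef M K) ?undup_uniq // => [|e eM]; last by rewrite KE eM orbT.
by rewrite big_seq [RHS]big_seq; apply: eq_bigr => e; rewrite mem_undup => /LM/eqP ->.
Qed.

Lemma lsum_cat L M : lsum (L ++ M) = lsum L + lsum M.
Proof. exact: big_cat. Qed.

Lemma lsum_flatten (I : Type) (r : seq I) (G : I -> laurent) :
  lsum (flatten [seq G i | i <- r]) = \sum_(i <- r) lsum (G i).
Proof.
elim: r => [|i r IHr]; first by rewrite big_nil /lsum big_nil.
by rewrite big_cons /= lsum_cat IHr.
Qed.

Lemma lsum_neg L : lsum (lneg L) = - lsum L.
Proof.
rewrite /lsum /lneg big_map -sumrN; apply: eq_bigr => x _.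
by rewrite rmorphN mulNr.
Qed.

Hypothesis gM : forall d e, g (qadd d e) = g d * g e.

Lemma lsum_shift e L : lsum (lshift e L) = lsum L * g e.
Proof.
rewrite /lsum /lshift big_map mulr_suml; apply: eq_bigr => x _ /=.
by rewrite gM mulrA.
Qed.

Lemma lsum_mul L M : lsum (lmul L M) = lsum L * lsum M.
Proof.
rewrite /lmul lsum_flatten {2}/lsum mulr_suml; apply: eq_bigr => x _.
rewrite /lsum big_map mulr_sumr; apply: eq_bigr => y _ /=.
by rewrite gM rmorphM mulrACA.
Qed.

End LaurentSums.

Definition osc_idx (s : osc) : nat :=
  match s with Oa i => i | Ob12 => 2 | Ob13 => 3 | Ob23 => 4 | Oc => 5 end.
Definition osc_of (i : nat) : osc := nth Oc [:: Oa 0; Oa 1; Ob12; Ob13; Ob23] i.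
Definition idxs := iota 0 6.

Lemma osc_idxK : cancel osc_idx osc_of.
Proof. by case=> // -[[|[|]]] //= lt2; congr Oa; apply: val_inj. Qed.

Lemma osc_idx_lt s : (osc_idx s < 6)%N.
Proof. by case: s => // -[[|[|]]]. Qed.

Lemma osc_ofK i : (i < 6)%N -> osc_idx (osc_of i) = i.
Proof. by case: i => [|[|[|[|[|[|]]]]]]. Qed.

Lemma sum_osc (V : nmodType) (G : osc -> V) :
  \sum_(s : osc) G s = \sum_(i <- idxs) G (osc_of i).
Proof.
rewrite -(big_map osc_of xpredT) -[LHS]big_enum; apply: perm_big; apply: uniq_perm.
- exact: enum_uniq.
- rewrite map_inj_in_uniq ?iota_uniq // => i j.
  by rewrite !mem_iota => /osc_ofK {2}<- /osc_ofK {2}<- ->.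
move=> s; rewrite mem_enum -[s in RHS]osc_idxK; apply/esym/map_f.
by rewrite mem_iota osc_idx_lt.
Qed.

(* Symbolic form of an exponent: the oscillator coefficients at n and -n, n > 0,
   multiplied by the denominator of the species, and the zero modes. *)
Record sexponent := SExponent {
  spos : nat -> laurent; sneg : nat -> laurent;
  sQ : nat -> int; scst : nat -> qexponent; slnz : nat -> int }.

Definition sadd (u v : sexponent) := SExponent
  (fun i => spos u i ++ spos v i) (fun i => sneg u i ++ sneg v i)
  (fun i => sQ u i + sQ v i) (fun i => qadd (scst u i) (scst v i))
  (fun i => slnz u i + slnz v i).
Definition sopp (u : sexponent) := SExponent
  (fun i => lneg (spos u i)) (fun i => lneg (sneg u i))
  (fun i => - sQ u i) (fun i => qopp (scst u i)) (fun i => - slnz u i).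
Definition ssubst (l : qexponent) (u : sexponent) := SExponent
  (fun i => lshift (qopp l) (spos u i)) (fun i => lshift l (sneg u i))
  (sQ u) (fun i => qadd (scst u i) (qscale (slnz u i) l)) (slnz u).

(** The two oscillator coefficients have opposite signs since [-n] = - [n]. *)
Definition sfld (s : nat) (l kappa : qexponent) := SExponent
  (fun i => if i == s then [:: (-1, qopp (qadd kappa l))] else [::])
  (fun i => if i == s then [:: (1, qadd l (qopp kappa))] else [::])
  (fun i => if i == s then 1 else 0) (fun i => if i == s then l else (0, 0))
  (fun i => if i == s then 1 else 0).
(** The exponent d is the one for which the denominator is [d m], and (q - q^-1) [d m] = q^(d m) -
    q^(-d m). *)
Definition sfldp (s : nat) (d l : qexponent) := SExponent
  (fun i => if i == s then [:: (1, qadd d (qopp l)); (-1, qadd (qopp d) (qopp l))] else [::])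
  (fun=> [::]) (fun=> 0) (fun i => if i == s then d else (0, 0)) (fun=> 0).
Definition sfldm (s : nat) (d l : qexponent) := SExponent (fun=> [::])
  (fun i => if i == s then [:: (-1, qadd d l); (1, qadd (qopp d) l)] else [::])
  (fun=> 0) (fun i => if i == s then qopp d else (0, 0)) (fun=> 0).

(* eta i j stands for the commutator of the species i and j, multiplied by m
   and divided by their denominators. *)
Definition eta (i j : nat) : laurent :=
  match i, j with
  | 0, 0 => [:: (1, (2, 0)); (1, (-2, 0))]
  | 0, 1 | 1, 0 | 2, 2 => [:: (-1, (0, 0))]
  | 3, 3 | 4, 4 | 5, 5 => [:: (1, (0, 0))]
  | _, _ => [::]
  end.
Definition eta0 (i j : nat) : int :=
  match i, j with
  | 0, 0 => 2 | 0, 1 | 1, 0 | 2, 2 => -1 | 3, 3 | 4, 4 | 5, 5 => 1 | _, _ => 0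
  end.

Definition scontr (u v : sexponent) : laurent :=
  flatten [seq flatten [seq lmul (eta i j) (lmul (spos u i) (sneg v j)) | j <- idxs] | i <- idxs].
Definition skap (u v : sexponent) : qexponent :=
  foldr qadd (0, 0) [seq foldr qadd (0, 0) [seq qscale (eta0 i j * sQ v j) (scst u i)
    | j <- idxs] | i <- idxs].
Definition szpow (u v : sexponent) : int :=
  foldr +%R 0 [seq foldr +%R 0 [seq eta0 i j * slnz u i * sQ v j | j <- idxs] | i <- idxs].

Arguments Defs.coord : simpl never.

(** * Exponents represented by symbolic ones *)

Section Representation.
Variable R : realType.
Local Notation C := R[i].
Local Notation label := (label R).
Variables lnq k : C.
Local Notation qpow := (qpow lnq).
Local Notation qnum := (qnum lnq).
Local Notation q := (qpow 1).
Hypothesis q_not_root : forall n : nat, (0 < n)%N -> q ^+ n != 1.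
Hypothesis k_generic : forall m : nat, (0 < m)%N -> qnum ((k + 1) * m%:R) != 0.
Hypothesis k1_neq0 : k + 1 != 0.
Implicit Types (f g : exponent R) (p : label) (u v : sexponent) (e d : qexponent).

Definition ex e : C := (e.1%:~R + e.2%:~R * k) / 2.
Definition qex (m : C) e : C := qpow (ex e * m).
Definition lev (L : laurent) (m : C) : C := lsum (qex m) L.

Lemma exD d e : ex (qadd d e) = ex d + ex e.
Proof. by rewrite /ex !rmorphD /=; field. Qed.

Lemma exN e : ex (qopp e) = - ex e.
Proof. by rewrite /ex !rmorphN /=; field. Qed.

Lemma exZ a e : ex (qscale a e) = a%:~R * ex e.
Proof. by rewrite /ex !rmorphM /=; field. Qed.

Lemma ex0 : ex (0, 0) = 0.
Proof. by rewrite /ex /= mul0r addr0 mul0r. Qed.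

Lemma qexD m d e : qex m (qadd d e) = qex m d * qex m e.
Proof. by rewrite /qex exD mulrDl qpowD. Qed.

Lemma lev_eq L M m : leqL L M -> lev L m = lev M m.
Proof. exact: eq_lsum. Qed.

Definition den (fl : bool) (s : osc) (m : C) : C :=
  if s is Oa _ then (if fl then qnum ((k + 1) * m) else qnum m) else qnum m.
Definition den0 (fl : bool) (s : osc) : C :=
  if s is Oa _ then (if fl then k + 1 else 1) else 1.

(* fl tells the normalization of a: by [(k+1)n] (as in S) or by [n]. *)
Record rep (fl : bool) f u : Prop := Rep {
  rep_pos : forall s l, osci f s (Posz l.+1) * den fl s l.+1%:R
    = lev (spos u (osc_idx s)) l.+1%:R;
  rep_neg : forall s l, osci f s (Negz l) * den fl s l.+1%:R
    = lev (sneg u (osc_idx s)) l.+1%:R;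
  rep_Q : forall s, Defs.coord (Qpart f) s * den0 fl s = (sQ u (osc_idx s))%:~R;
  rep_const : forall s, const f s * den0 fl s = lnq * ex (scst u (osc_idx s));
  rep_lnz : forall s, lnz f s * den0 fl s = (slnz u (osc_idx s))%:~R }.

Lemma qq_neq0 : q - q^-1 != 0.
Proof.
have q0 := qpow_neq0 lnq 1; rewrite subr_eq0; apply/eqP => e.
by have := q_not_root (n := 2) isT; rewrite expr2 {2}e divff ?eqxx.
Qed.

Lemma qnum_neq0 m : (0 < m)%N -> qnum m%:R != 0.
Proof.
move=> m_gt0; rewrite /Defs.qnum mulf_neq0 ?invr_eq0 ?qq_neq0 // subr_eq0.
have q0 := qpow_neq0 lnq m%:R; apply/eqP => e.
have := q_not_root (n := m * 2) _; rewrite muln_gt0 m_gt0 => /(_ isT).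
by rewrite exprM -qpowMn mul1r expr2 {2}e qpowVK eqxx.
Qed.

Lemma den_neq0 fl s m : (0 < m)%N -> den fl s m%:R != 0.
Proof.
by move=> m_gt0; case: s fl => [i||||] [] /=; [exact: k_generic | exact: qnum_neq0..].
Qed.

Lemma den0_neq0 fl s : den0 fl s != 0.
Proof. by case: s fl => [i||||] [] /=; [exact: k1_neq0 | exact: oner_neq0..]. Qed.

Lemma qnumN x : qnum (- x) = - qnum x.
Proof. by rewrite /Defs.qnum opprK -mulNr opprB. Qed.

Lemma lev_cat L M m : lev (L ++ M) m = lev L m + lev M m.
Proof. exact: lsum_cat. Qed.

Lemma rep_add fl f g u v : rep fl f u -> rep fl g v -> rep fl (eadd f g) (sadd u v).
Proof.
move=> [f1 f2 f3 f4 f5] [g1 g2 g3 g4 g5]; split=> [s l|s l|s|s|s] /=.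
- by rewrite mulrDl f1 g1 lev_cat.
- by rewrite mulrDl f2 g2 lev_cat.
- by rewrite coordD mulrDl f3 g3 rmorphD.
- by rewrite mulrDl f4 g4 exD mulrDr.
- by rewrite mulrDl f5 g5 rmorphD.
Qed.

Lemma coord0 s : Defs.coord (0 : label) s = 0.
Proof. by case: s => [i||||] //; rewrite /Defs.coord /= if_same. Qed.

Lemma coordN p s : Defs.coord (- p) s = - Defs.coord p s.
Proof. by apply/eqP; rewrite -addr_eq0 -coordD addNr coord0. Qed.

Lemma rep_opp fl f u : rep fl f u -> rep fl (eopp f) (sopp u).
Proof.
move=> [f1 f2 f3 f4 f5]; split=> [s l|s l|s|s|s] /=.
- by rewrite mulNr f1 /lev lsum_neg.
- by rewrite mulNr f2 /lev lsum_neg.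
- by rewrite coordN mulNr f3 rmorphN.
- by rewrite mulNr f4 exN mulrN.
- by rewrite mulNr f5 rmorphN.
Qed.

Lemma qsubst_pos l (m : nat) : qpow (- (ex l * (Posz m)%:~R)) = qex m%:R (qopp l).
Proof. by rewrite /qex exN mulNr. Qed.

Lemma qsubst_neg l (m : nat) : qpow (- (ex l * (Negz m)%:~R)) = qex m.+1%:R l.
Proof. by rewrite /qex NegzE rmorphN mulrN opprK. Qed.

Lemma rep_subst fl f u l : rep fl f u -> rep fl (qsubst lnq (ex l) f) (ssubst l u).
Proof.
move=> [f1 f2 f3 f4 f5]; split=> [s m|s m|s|s|s] //=.
- by rewrite mulrAC f1 qsubst_pos /lev lsum_shift //; exact: qexD.
- by rewrite mulrAC f2 qsubst_neg /lev lsum_shift //; exact: qexD.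
- by rewrite mulrDl f4 mulrAC f5 exD exZ; ring.
Qed.

Lemma lev1 a e m : lev [:: (a, e)] m = a%:~R * qex m e.
Proof. by rewrite /lev /lsum big_seq1. Qed.

Lemma lev2 a e b d m : lev [:: (a, e); (b, d)] m = a%:~R * qex m e + b%:~R * qex m d.
Proof. by rewrite /lev /lsum big_cons big_seq1. Qed.

Lemma lev0 m : lev [::] m = 0.
Proof. by rewrite /lev /lsum big_nil. Qed.

Lemma eq_osc_idx s t : (osc_idx s == osc_idx t) = (s == t).
Proof. exact: (inj_eq (can_inj osc_idxK)). Qed.

Definition is_bc (s : osc) := if s is Oa _ then false else true.

Lemma coord_Qlabel s t : is_bc s -> Defs.coord (Qlabel R s) t = (t == s)%:R.
Proof. by case: s => // _; case: t => [i||||]; rewrite /Defs.coord /= ?if_same. Qed.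

Lemma fld_pos kappa l (m : nat) :
  qpow (- (ex kappa * m%:R)) * qpow (- (ex l * m%:R)) = qex m%:R (qopp (qadd kappa l)).
Proof. by rewrite -qpowD /qex exN exD; congr Defs.qpow; ring. Qed.

Lemma fld_neg kappa l (m : nat) :
  qpow (- (ex kappa * m%:R)) * qex m%:R l = qex m%:R (qadd l (qopp kappa)).
Proof. by rewrite /qex -qpowD exD exN; congr Defs.qpow; ring. Qed.

Lemma divr_cancel_pos (F : fieldType) (d x y : F) : d != 0 ->
  - (1 / d * x) * y * d = (-1)%:~R * (x * y).
Proof. by move=> d0; rewrite rmorphN1; field. Qed.

Lemma divr_cancel_neg (F : fieldType) (d x y : F) : d != 0 ->
  - (1 / (- d) * x) * y * d = 1%:~R * (x * y).
Proof.
by move=> d0; rewrite rmorph1 invrN; field.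
Qed.

Lemma rep_fld fl s l kappa : is_bc s ->
  rep fl (fld lnq (pair_of R s) (ex l) (ex kappa)) (sfld (osc_idx s) l kappa).
Proof.
move=> bc_s.
have den0_s : den0 fl s = 1 by case: s bc_s.
have den_s m : den fl s m = qnum m by case: {den0_s} s bc_s.
split=> [t m|t m|t|t|t] /=; rewrite eq_osc_idx.
- case: (t =P s) => [ts|_]; last by rewrite !mul0r lev0.
  rewrite ts den_s lev1 -fld_pos; apply: divr_cancel_pos; exact: qnum_neq0.
- case: (t =P s) => [ts|_]; last by rewrite !mul0r lev0.
  rewrite ts den_s lev1 -fld_neg qsubst_neg NegzE rmorphN qnumN.
  by apply: divr_cancel_neg; exact: qnum_neq0.
- rewrite coord_Qlabel //; case: (t =P s) => [ts|_]; last by rewrite mul0r.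
  by rewrite ts den0_s mulr1.
- case: (t =P s) => [ts|_]; last by rewrite mul0r addr0 mul0r ex0 mulr0.
  by rewrite ts den0_s mulr1 add0r mul1r mulrC.
- case: (t =P s) => [ts|_]; last by rewrite mul0r.
  by rewrite ts den0_s mulr1.
Qed.

(** The denominator is [e m] for this exponent e, so its product with q - q^-1 has two monomials in
    either normalization; this gives a_+ and a_- both symbolic forms. *)
Definition sden (fl : bool) (s : osc) : qexponent :=
  if s is Oa _ then (if fl then (2, 2) else (2, 0)) else (2, 0).

Lemma ex20 : ex (2, 0) = 1.
Proof. by rewrite /ex /= mul0r addr0; field. Qed.

Lemma ex22 : ex (2, 2) = k + 1.
Proof. by rewrite /ex /=; field. Qed.

Lemma ex_sden fl s : ex (sden fl s) = den0 fl s.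
Proof. by case: s fl => [i||||] [] /=; rewrite ?ex20 ?ex22. Qed.

Lemma den_sden fl s m : den fl s m = qnum (ex (sden fl s) * m).
Proof. by case: s fl => [i||||] [] /=; rewrite ?ex20 ?ex22 ?mul1r. Qed.

Lemma den_qq fl s m :
  (q - q^-1) * den fl s m = qex m (sden fl s) - qex m (qopp (sden fl s)).
Proof.
rewrite den_sden /Defs.qnum mulrC divfK ?qq_neq0 // /qex exN mulNr //.
Qed.

Lemma rep_fldp fl s l :
  rep fl (fldp lnq (pair_of R s) (ex l)) (sfldp (osc_idx s) (sden fl s) l).
Proof.
split=> [t m|t m|t|t|t] /=; rewrite ?eq_osc_idx.
- case: (t =P s) => [ts|_]; last by rewrite !mul0r lev0.
  rewrite ts /= mulr1 qsubst_pos lev2 mulrAC den_qq 2!qexD rmorph1 rmorphN1; ring.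
- by rewrite andbF !mul0r lev0.
- by rewrite coord0 mul0r.
- case: (t =P s) => [ts|_]; last by rewrite mul0r addr0 mul0r ex0 mulr0.
  by rewrite ts mul0r addr0 mul1r ex_sden.
- by rewrite mul0r.
Qed.

Lemma rep_fldm fl s l :
  rep fl (fldm lnq (pair_of R s) (ex l)) (sfldm (osc_idx s) (sden fl s) l).
Proof.
split=> [t m|t m|t|t|t] /=; rewrite ?eq_osc_idx.
- by rewrite ltNge /= andbF !mul0r lev0.
- case: (t =P s) => [ts|_]; last by rewrite !mul0r lev0.
  rewrite ts /= mulr1 qsubst_neg lev2 mulrAC mulNr den_qq 2!qexD rmorph1 rmorphN1; ring.
- by rewrite coord0 mul0r.
- case: (t =P s) => [ts|_]; last by rewrite mul0r addr0 mul0r ex0 mulr0.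
  by rewrite ts mul0r addr0 mul1r exN ex_sden mulNr mulrN.
- by rewrite mul0r.
Qed.

Lemma star_cancel_pos (F : fieldType) (d e x y : F) : d != 0 -> e != 0 ->
  - (d / e / d * x) * y * e = (-1)%:~R * (x * y).
Proof. by move=> d0 e0; rewrite rmorphN1; field; rewrite d0 e0. Qed.

Lemma star_cancel_neg (F : fieldType) (d e x y : F) : d != 0 -> e != 0 ->
  - ((- d) / (- e) / (- d) * x) * y * e = 1%:~R * (x * y).
Proof.
by move=> d0 e0; rewrite rmorph1 !invrN; field; rewrite d0 e0.
Qed.

Lemma coord_Qa (c : C) (i : 'I_2) t : Defs.coord (Qa c i) t = if t == Oa i then c else 0.
Proof.
case: t => [j||||] //; rewrite /Defs.coord /Qa.
by case: i => -[|[|//]] ?; case: j => -[|[|//]] ?.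
Qed.

(** The coefficient ([m] / [(k+1) m]) / [m] is 1 / [(k+1) m] up to a power of q, which dictates the
    normalization [true] for S. *)
Lemma rep_astar (i : 'I_2) l kappa :
  rep true (fld lnq (astar lnq k i) (ex l) (ex kappa)) (sfld i l kappa).
Proof.
split=> [t m|t m|t|t|t] /=; rewrite -[i : nat]/(osc_idx (Oa i)) eq_osc_idx.
- case: (t =P Oa i) => [ts|_]; last by rewrite !mul0r lev0.
  rewrite ts lev1 -fld_pos; apply: star_cancel_pos; [exact: qnum_neq0 | exact: k_generic].
- case: (t =P Oa i) => [ts|_]; last by rewrite !mul0r lev0.
  rewrite ts lev1 -fld_neg qsubst_neg NegzE rmorphN mulrN !qnumN.
  by apply: star_cancel_neg; [exact: qnum_neq0 | exact: k_generic].
- rewrite coord_Qa; case: (t =P Oa i) => [ts|_]; last by rewrite mul0r.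
  by rewrite ts mulVf.
- case: (t =P Oa i) => [ts|_]; last by rewrite mul0r addr0 mul0r ex0 mulr0.
  by rewrite ts add0r mulrAC mulVf // mul1r mulrC.
- case: (t =P Oa i) => [ts|_]; last by rewrite mul0r.
  by rewrite ts mulVf.
Qed.

End Representation.


Lemma sum_idxs (V : nmodType) (G : nat -> V) :
  \sum_(i <- idxs) G i = \sum_(s : osc) G (osc_idx s).
Proof.
rewrite sum_osc big_seq [RHS]big_seq; apply: eq_bigr => i.
by rewrite mem_iota => /osc_ofK ->.
Qed.

Definition coordz (R : realType) (p : label R) (s : osc) : int :=
  let: (_, _, m12, m13, m23, n) := p in
  match s with Oa _ => 0 | Ob12 => m12 | Ob13 => m13 | Ob23 => m23 | Oc => n end.

(* the parity of the action of e^{sqrt(-1) pi (sum of the s_0, s in ss)} on e^Q *)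
Definition spar (ss : seq osc) (u : sexponent) : bool :=
  odd (foldr addn 0%N [seq `|sQ u (osc_idx s)|%N | s <- ss]).

Definition seq_equiv (u v : sexponent) : bool :=
  all (fun i => [&& leqL (spos u i) (spos v i), leqL (sneg u i) (sneg v i),
    sQ u i == sQ v i, scst u i == scst v i & slnz u i == slnz v i]) idxs.

(** * Contractions, zero modes and signs computed symbolically *)

Section Soundness.
Variable R : realType.
Local Notation C := R[i].
Local Notation label := (label R).
Local Notation fock := (fock R).
Variables lnq k : C.
Local Notation qpow := (qpow lnq).
Local Notation qnum := (qnum lnq).
Local Notation q := (qpow 1).
Local Notation contr := (contr lnq k).
Local Notation eigen := (eigen k).
Local Notation zpow := (zpow k).
Local Notation zscal := (zscal k).
Local Notation ex := (ex k).
Local Notation qex := (qex lnq k).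
Local Notation lev := (lev lnq k).
Local Notation rep := (rep lnq k).
Local Notation den := (den lnq k).
Local Notation den0 := (den0 k).
Hypothesis q_not_root : forall n : nat, (0 < n)%N -> q ^+ n != 1.
Hypothesis k_generic : forall m : nat, (0 < m)%N -> qnum ((k + 1) * m%:R) != 0.
Hypothesis k1_neq0 : k + 1 != 0.
Implicit Types (f g : exponent R) (p : label) (u v : sexponent) (e d : qexponent).

Lemma qex0 m : qex m (0, 0) = 1.
Proof. by rewrite /qex ex0 mul0r qpow0. Qed.

Lemma osc_ind2 (P : osc -> Prop) : P (Oa 0) -> P (Oa 1) ->
  P Ob12 -> P Ob13 -> P Ob23 -> P Oc -> forall s, P s.
Proof.
move=> P0 P1 ? ? ? ?; case=> // -[[|[|//]] lt2].
  by have -> : Ordinal lt2 = 0 by exact: val_inj.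
by have -> : Ordinal lt2 = 1 by exact: val_inj.
Qed.

Lemma qnum_double m : qnum (2 * m) = qnum m * lev [:: (1, (2, 0)); (1, (-2, 0))] m.
Proof.
rewrite lev2 !rmorph1 !mul1r /qex (exN k (2, 0)) ex20 mulN1r mul1r.
have -> : 2 * m = m + m by ring.
by rewrite /Defs.qnum opprD !qpowD; ring.
Qed.

Lemma den_prod (i j : 'I_2) fl m :
  den fl (Oa i) m * den (~~ fl) (Oa j) m = qnum m * qnum ((k + 1) * m).
Proof. by case: fl => //=; exact: mulrC. Qed.

(** Opposite normalizations supply the product [m] [(k+1) m]. It cancels the q-numbers in the
    commutator of the a's, because [a_ij m] / [m] is q^m + q^-m, -1 or 0. *)
Lemma contr_eta fl s t m : (0 < m)%N -> m%:R * contr s t m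
  = lev (eta (osc_idx s) (osc_idx t)) m%:R * (den fl s m%:R * den (~~ fl) t m%:R).
Proof.
move=> m_gt0; have m0 : m%:R != 0 :> C by rewrite pnatr_eq0 -lt0n.
have cancel (x : C) : m%:R * (x / m%:R) = x by rewrite mulrC divfK.
move: s t; do 2![apply: osc_ind2]; try by rewrite /= lev0 mul0r mulr0.
- rewrite den_prod /Defs.contr cancel /cartan /= [RHS]mulrA [lev _ _ * _]mulrC. by rewrite -qnum_double.
- rewrite den_prod /Defs.contr cancel /cartan /= rmorphN1 mulN1r qnumN lev1 qex0.
  by rewrite mulr1 rmorphN1 mulN1r mulNr.
- rewrite den_prod /Defs.contr cancel /cartan /= rmorphN1 mulN1r qnumN lev1 qex0.
  by rewrite mulr1 rmorphN1 mulN1r mulNr.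
- by rewrite den_prod /Defs.contr cancel /cartan /= mul0r lev0 mul0r /Defs.qnum oppr0 subrr !mul0r.
- by rewrite /Defs.contr mulrN cancel lev1 qex0 expr2 mulr1 rmorphN1 mulN1r.
- by rewrite cancel lev1 qex0 expr2 mulr1 mul1r.
- by rewrite cancel lev1 qex0 expr2 mulr1 mul1r.
- by rewrite cancel lev1 qex0 expr2 mulr1 mul1r.
Qed.

Lemma contraction_sound fl f g u v l : rep fl f u -> rep (~~ fl) g v ->
  l.+1%:R * contraction lnq k f g l = lev (scontr u v) l.+1%:R.
Proof.
move=> [fp _ _ _ _] [_ gn _ _ _].
have lM L M : lev (lmul L M) l.+1%:R = lev L l.+1%:R * lev M l.+1%:R.
  by apply: lsum_mul; exact: qexD.
rewrite /lev /scontr lsum_flatten sum_idxs mulr_sumr; apply: eq_bigr => s _.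
rewrite lsum_flatten sum_idxs mulr_sumr; apply: eq_bigr => t _.
rewrite -/(lev _ _) !lM -fp -gn mulrCA (contr_eta fl) //; ring.
Qed.

Lemma contr0_eta fl s t :
  contr0 k s t = (eta0 (osc_idx s) (osc_idx t))%:~R * (den0 fl s * den0 (~~ fl) t).
Proof.
have e1 : (k + 1) * 1 = 1 * (k + 1) by rewrite mulrC.
move: s t; do 2![apply: osc_ind2]; rewrite /= ?mul0r // /cartan /=;
by case: fl; rewrite /= ?mulr1 ?mul1r ?mulr0 ?mul0r // mulrC.
Qed.

Lemma ex_foldr (r : seq qexponent) : ex (foldr qadd (0, 0) r) = \sum_(e <- r) ex e.
Proof. by elim: r => [|e r IHr]; rewrite ?big_nil ?ex0 // big_cons /= exD IHr. Qed.

Lemma intr_foldr (r : seq int) : (foldr +%R 0 r)%:~R = \sum_(a <- r) a%:~R :> C.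
Proof. by elim: r => [|a r IHr]; rewrite ?big_nil // big_cons -IHr /= rmorphD. Qed.

Lemma zscal_sound fl f g u v : rep fl f u -> rep (~~ fl) g v ->
  zscal f (Qpart g) = qpow (ex (skap u v)).
Proof.
move=> [_ _ _ fc _] [_ _ gQ _ _]; rewrite /zscal /Defs.qpow; congr cexp.
rewrite /skap ex_foldr big_map sum_idxs mulr_suml; apply: eq_bigr => s _.
rewrite ex_foldr big_map sum_idxs /Defs.eigen mulr_sumr mulr_suml; apply: eq_bigr => t _.
rewrite (contr0_eta fl) exZ rmorphM /= -gQ.
transitivity ((eta0 (osc_idx s) (osc_idx t))%:~R * (const f s * den0 fl s)
  * (Defs.coord (Qpart g) t * den0 (~~ fl) t)); first by ring.
by rewrite fc; ring.
Qed.

Lemma zpow_sound fl f g u v : rep fl f u -> rep (~~ fl) g v ->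
  zpow f (Qpart g) = (szpow u v)%:~R.
Proof.
move=> [_ _ _ _ fl'] [_ _ gQ _ _]; rewrite /zpow.
rewrite /szpow intr_foldr big_map sum_idxs; apply: eq_bigr => s _.
rewrite intr_foldr big_map sum_idxs /Defs.eigen mulr_sumr; apply: eq_bigr => t _.
rewrite (contr0_eta fl) !rmorphM /= -gQ -fl'; ring.
Qed.

Definition sgnz (n : int) : C := (-1) ^+ `|n|%N.

Lemma sgnzD m n : sgnz (m + n) = sgnz m * sgnz n.
Proof.
rewrite /sgnz -exprD -signr_odd -[RHS]signr_odd; congr (_ ^+ nat_of_bool _); clear; lia.
Qed.

Definition schar (ss : seq osc) p : C := \prod_(s <- ss) sgnz (coordz p s).

Lemma coordzD p p' s : coordz (p + p') s = coordz p s + coordz p' s.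
Proof.
case: p p' => [[[[[p1 p2] p3] p4] p5] p6] [[[[[r1 r2] r3] r4] r5] r6].
by case: s.
Qed.

Lemma coord_coordz p s : is_bc s -> Defs.coord p s = (coordz p s)%:~R.
Proof. by case: p => [[[[[p1 p2] p3] p4] p5] p6]; case: s. Qed.

Lemma schar_character ss : character (schar ss).
Proof.
move=> p p'; rewrite /schar -big_split; apply: eq_bigr => s _.
by rewrite coordzD sgnzD.
Qed.

Lemma schar_sound fl ss g v : all is_bc ss -> rep fl g v ->
  schar ss (Qpart g) = (-1) ^+ spar ss v.
Proof.
move=> bc [_ _ gQ _ _]; rewrite /spar signr_odd /schar.
elim: ss bc => [_|s ss IHss /= /andP[bc_s /IHss {}IHss]]; first by rewrite big_nil expr0.
rewrite big_cons IHss exprD /sgnz; congr (_ ^+ `|_| * _).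
apply: (@intr_inj C); rewrite -gQ -coord_coordz //.
by case: s bc_s => //= _; rewrite mulr1.
Qed.

Lemma cexp_ipi (eps : C) : eps = 1 \/ eps = -1 -> cexp (eps * Complex 0 pi) = -1 :> C.
Proof.
case=> ->.
  by rewrite mul1r /cexp /= expR0 cospi sinpi mulr0 mul1r; apply/eqP; rewrite eq_complex /= oppr0 !eqxx.
by rewrite mulN1r /cexp /= oppr0 expR0 cosN sinN cospi sinpi oppr0 mulr0 mul1r; apply/eqP;
  rewrite eq_complex /= oppr0 !eqxx.
Qed.

Lemma cexpMn (x : C) n : cexp (x * n%:R) = cexp x ^+ n.
Proof.
elim: n => [|n IHn]; first by rewrite mulr0 cexp0.
by rewrite -addn1 natrD mulrDr mulr1 cexpD IHn exprD.
Qed.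

Lemma cexp_ipiz (eps : C) n : eps = 1 \/ eps = -1 ->
  cexp (eps * Complex 0 pi * n%:~R) = sgnz n :> C.
Proof.
move=> eps1; case: n => n; first by rewrite cexpMn cexp_ipi.
rewrite NegzE rmorphN mulrN -!mulNr cexpMn cexp_ipi //.
by case: eps1 => ->; [right | left; rewrite opprK].
Qed.

(** The zero modes of the b's and c have integral eigenvalues, so the phase is a sign; neither [eps]
    nor the negative norm of b^{12} affects it. *)
Lemma phase_schar (eps : C) (ss : seq osc) (w : fock) : eps = 1 \/ eps = -1 -> uniq ss -> all is_bc ss ->
  phase k eps ss w = diag (schar ss) w.
Proof.
move=> eps1 uniq_ss bc; rewrite /phase /expzero; congr (diag _ w); apply: funext => p.
rewrite /schar; transitivity (cexp (\sum_(s <- ss) eps * Complex 0 pi * eigen s p)).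
  congr cexp; rewrite (big_uniq _ uniq_ss) [RHS]big_mkcond /=; apply: eq_bigr => s _.
  by case: ifP; rewrite ?mul0r.
elim: ss uniq_ss bc => [_ _|s ss IHss /= /andP[_ /IHss IH] /andP[bc_s /IH {}IHss]].
  by rewrite !big_nil cexp0.
rewrite !big_cons cexpD IHss; congr (_ * _).
have -> : eigen s p = (eta0 (osc_idx s) (osc_idx s))%:~R * (coordz p s)%:~R.
  rewrite -coord_coordz // /Defs.eigen (bigD1 s) //= big1 ?addr0.
    by case: s bc_s => //= _; rewrite ?mul1r // rmorphN1.
  by move=> t; case: s t bc_s => [//||||] [?||||] //= _ _; rewrite mul0r.
have [->|->] : eta0 (osc_idx s) (osc_idx s) = 1 \/ eta0 (osc_idx s) (osc_idx s) = -1.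
- by case: s bc_s => // _; [right | left..].
- rewrite rmorph1 mul1r; exact: cexp_ipiz.
by rewrite rmorphN1 mulN1r -rmorphN cexp_ipiz // /sgnz abszN.
Qed.

End Soundness.

(* The term sign q^scoef ((q - q^-1) z)^(-sdivs) :e^sexpo: times the signs of the
   charges in sspecies. *)
Record sterm := STerm {
  ssign : int; scoef : qexponent; sdivs : nat; sexpo : sexponent; sspecies : seq osc }.

Lemma mul_expr1n (F : pzRingType) n (a : F) : a = 1 ^+ n * a.
Proof. by rewrite expr1n mul1r. Qed.

Lemma scale_expr1n (F : pzRingType) (V : lmodType F) n (v : V) : 1 ^+ n *: v = v.
Proof. by rewrite expr1n scale1r. Qed.

Lemma scale_expr1z (F : fieldType) (V : lmodType F) (n : int) (v : V) : 1 ^ n *: v = v.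
Proof. by rewrite exp1rz scale1r. Qed.

Lemma sum_pair (V : nmodType) (I : Type) (F : I -> V) i j :
  \sum_(r <- [:: i; j]) F r = F i + F j.
Proof. by rewrite big_cons big_seq1. Qed.

(** * Exchange of one term of X with one term of S *)

Section Pairs.
Variable R : realType.
Local Notation C := R[i].
Local Notation label := (label R).
Local Notation fock := (fock R).
Variables lnq k : C.
Local Notation qpow := (qpow lnq).
Local Notation qnum := (qnum lnq).
Local Notation qsubst := (qsubst lnq).
Local Notation q := (qpow 1).
Local Notation zpow := (zpow k).
Local Notation zscal := (zscal k).
Local Notation nexp := (nexp lnq k).
Local Notation ex := (ex k).
Local Notation lev := (lev lnq k).
Local Notation rep := (rep lnq k).
Local Notation den0 := (den0 k).
Local Notation tser := (tser lnq k).
Local Notation residue := (residue lnq k).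
Hypothesis q_not_root : forall n : nat, (0 < n)%N -> q ^+ n != 1.
Hypothesis k_generic : forall m : nat, (0 < m)%N -> qnum ((k + 1) * m%:R) != 0.
Hypothesis k1_neq0 : k + 1 != 0.
Implicit Types (f g : exponent R) (p : label) (u v : sexponent).

Lemma eann_scale f g (a : C) :
  (forall s l, osci g s (Posz l.+1) = a ^+ l.+1 * osci f s (Posz l.+1)) ->
  forall n (V : fock), eann lnq k g n V = a ^+ n *: eann lnq k f n V.
Proof.
move=> fp; apply: eexp_scale => l w.
by rewrite /ann scaler_sumr; apply: eq_bigr => s _; rewrite scalerA fp.
Qed.

Lemma ecrez_scale f g (a : C) : a != 0 ->
  (forall s l, osci g s (Negz l) = a ^+ l.+1 * osci f s (Negz l)) ->
  forall n (V : fock), ecrez lnq k g n V = a ^ n *: ecrez lnq k f n V.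
Proof.
move=> a0 fp [n|n] V; last exact: (esym (scaler0 _ _)).
apply: eexp_scale => l w.
by rewrite /cre scaler_sumr; apply: eq_bigr => s _; rewrite scalerA fp.
Qed.

(** The value of [osci] at 0 is arbitrary, so exponents with the same exponential need not be equal
    as records. *)
Lemma nexp_eq f g :
  (forall s l, osci f s (Posz l.+1) = osci g s (Posz l.+1)) ->
  (forall s l, osci f s (Negz l) = osci g s (Negz l)) ->
  Qpart f = Qpart g -> const f =1 const g -> lnz f =1 lnz g ->
  forall x (V : fock), nexp f x V = nexp g x V.
Proof.
move=> fp fn fQ fc fl x; apply: eq_on_kets; [exact: nexp_linear | exact: nexp_linear |].
move=> b; have hb := homogU b.
have zE : zpow f b.1 = zpow g b.1.
  by rewrite /zpow; apply: eq_bigr => s _; rewrite fl.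
have sE : zscal f b.1 = zscal g b.1.
  by rewrite /zscal; congr cexp; apply: eq_bigr => s _; rewrite fc.
have [[a xa]|x_out] := pselect (exists a : int, x = zpow f b.1 + a%:~R); last first.
  have xF (a : int) : x != zpow f b.1 + a%:~R.
    by apply/eqP => xa; apply: x_out; exists a.
  rewrite (nexp_out_homog lnq hb xF); apply: esym; apply: (nexp_out_homog lnq hb) => a.
  by rewrite -zE.
have hM : ((energy_of b.2)%:Z < (energy_of b.2).+1%:Z) by clear; lia.
rewrite xa; apply: (etrans (nexp_homog lnq k f a hb hM)).
rewrite zE; apply: esym; apply: (etrans (nexp_homog lnq k g a hb hM)).
rewrite sE fQ; apply: scale_congr; first by [].
apply: eq_bigr => n _.
have e1 := @eann_scale f g 1 (fun s l => etrans (esym (fp s l)) (mul_expr1n _ _)).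
have e2 := @ecrez_scale f g 1 (oner_neq0 _) (fun s l => etrans (esym (fn s l)) (mul_expr1n _ _)).
have e3 V : eann lnq k g n V = eann lnq k f n V.
  exact: (etrans (e1 n V) (scale_expr1n _ _)).
have e4 m V : ecrez lnq k g m V = ecrez lnq k f m V.
  exact: (etrans (e2 m V) (scale_expr1z _ _)).
exact: (etrans (e4 _ _) (congr1 (fun z => ecrez lnq k f _ (translate _ z)) (e3 _))).
Qed.

Lemma coord_inj p p' : (forall s, Defs.coord p s = Defs.coord p' s) -> p = p'.
Proof.
case: p p' => [[[[[p1 p2] p3] p4] p5] p6] [[[[[r1 r2] r3] r4] r5] r6] e.
have e1 : p1 = r1 := e (Oa 0); have e2 : p2 = r2 := e (Oa 1).
have e3 : p3 = r3 by apply: intr_inj (e Ob12).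
have e4 : p4 = r4 by apply: intr_inj (e Ob13).
have e5 : p5 = r5 by apply: intr_inj (e Ob23).
have e6 : p6 = r6 by apply: intr_inj (e Oc).
by rewrite e1 e2 e3 e4 e5 e6.
Qed.

Lemma nexp_rep_eq fl f g u v : rep fl f u -> rep fl g v -> seq_equiv u v ->
  forall x (V : fock), nexp f x V = nexp g x V.
Proof.
move=> [f1 f2 f3 f4 f5] [g1 g2 g3 g4 g5] /allP uv.
have equiv s : [/\ leqL (spos u (osc_idx s)) (spos v (osc_idx s)),
    leqL (sneg u (osc_idx s)) (sneg v (osc_idx s)), sQ u (osc_idx s) = sQ v (osc_idx s),
    scst u (osc_idx s) = scst v (osc_idx s) & slnz u (osc_idx s) = slnz v (osc_idx s)].
  have := uv (osc_idx s); rewrite mem_iota osc_idx_lt => /(_ isT).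
  by case/and5P => ? ? /eqP ? /eqP ? /eqP ?.
have d0 s := den0_neq0 k1_neq0 fl s.
apply: nexp_eq => [s l|s l||s|s].
- apply: (mulIf (den_neq0 q_not_root k_generic fl s (ltn0Sn l))); rewrite f1 g1.
  by apply: lev_eq; have [] := equiv s.
- apply: (mulIf (den_neq0 q_not_root k_generic fl s (ltn0Sn l))); rewrite f2 g2.
  by apply: lev_eq; have [] := equiv s.
- apply: coord_inj => s; apply: (mulIf (d0 s)); rewrite f3 g3.
  by have [_ _ ->] := equiv s.
- apply: (mulIf (d0 s)); rewrite f4 g4.
  by have [_ _ _ ->] := equiv s.
- apply: (mulIf (d0 s)); rewrite f5 g5.
  by have [_ _ _ _ ->] := equiv s.
Qed.

Lemma nexp_qsubst l f x (V : fock) :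
  nexp (qsubst l f) x V = qpow (l * x) *: nexp f x V.
Proof.
move: V; apply: eq_on_kets; first exact: nexp_linear.
  exact: (linearP (qpow (l * x) \*: nexp f x)).
move=> b; have hb := homogU b.
have zE : zpow (qsubst l f) b.1 = zpow f b.1 by [].
have sE : zscal (qsubst l f) b.1 = qpow (l * zpow f b.1) * zscal f b.1.
  rewrite /zscal /Defs.qpow -cexpD /zpow mulrAC mulr_sumr -big_split.
  by congr cexp; apply: eq_bigr => s _; rewrite /=; ring.
have [[a xa]|x_out] := pselect (exists a : int, x = zpow f b.1 + a%:~R); last first.
  have xF (a : int) : x != zpow f b.1 + a%:~R.
    by apply/eqP => xa; apply: x_out; exists a.
  have e1 : nexp (qsubst l f) x (ket b) = 0 :=
    nexp_out_homog lnq hb (xF : forall a, x != zpow (qsubst l f) _ + _).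
  have e2 : nexp f x (ket b) = 0 := nexp_out_homog lnq hb xF.
  exact: (etrans e1 (esym (etrans (congr1 (GRing.scale _) e2) (scaler0 _ _)))).
have hM : ((energy_of b.2)%:Z < (energy_of b.2).+1%:Z) by clear; lia.
rewrite xa.
apply: (etrans (nexp_homog lnq k (qsubst l f) a hb hM)).
apply: esym; apply: (etrans (congr1 (fun z => _ *: z) (nexp_homog lnq k f a hb hM))).
rewrite sE scalerA mulrDr qpowD -mulrA [qpow (l * a%:~R) * _]mulrC mulrA -scalerA.
apply: scale_congr; first by [].
rewrite scaler_sumr; apply: eq_bigr => n _.
have e1 : eann lnq k (qsubst l f) n (ket b) = (qpow l)^-1 ^+ n *: eann lnq k f n (ket b).
  by apply: eann_scale => s m /=; rewrite mulrC qpowN exprVn qpowMn.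
have e2 m (W : fock) : ecrez lnq k (qsubst l f) m W = qpow l ^ m *: ecrez lnq k f m W.
  apply: (ecrez_scale (qpow_neq0 _ _)) => s i /=.
  by rewrite mulrC NegzE rmorphN mulrN opprK qpowMn.
apply: esym; apply: (etrans (congr1 (fun z => ecrez _ _ _ _ (translate _ z)) e1)).
apply: (etrans (congr1 (ecrez _ _ _ _) (translateZ _ _ _))).
apply: (etrans (linearZZ (ecrez lnq k (qsubst l f) (a + n%:Z)) _ _)) => /=.
apply: (etrans (congr1 (GRing.scale _) (e2 _ _))).
rewrite scalerA; apply: scale_congr; last by [].
by rewrite qpowMz expfzDr ?qpow_neq0 // mulrCA exprVn mulVf ?mulr1 // expf_neq0 // qpow_neq0.
Qed.

(** The a's carry the only complex charges; without their zero modes in the ln z part, as in X, all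
    powers of z are integral. *)
Lemma zpow_int f u : rep false f u -> slnz u 0 = 0 -> slnz u 1 = 0 ->
  forall p, exists a : int, zpow f p = a%:~R.
Proof.
move=> [_ _ _ _ fl] u0 u1 p.
exists (\sum_(s : osc) slnz u (osc_idx s) * (eta0 (osc_idx s) (osc_idx s) * coordz p s)).
rewrite rmorph_sum; apply: eq_bigr => s _ /=.
apply: etrans (esym (intrM _ _ _)); rewrite -fl.
have [bc_s|] := boolP (is_bc s).
  rewrite (_ : den0 false s = 1) ?mulr1; last by case: s bc_s.
  congr (_ * _); rewrite intrM -coord_coordz // /Defs.eigen (bigD1 s) //= big1 ?addr0.
    by case: s bc_s => //= _; rewrite ?mul1r // rmorphN1.
  by move=> t; case: s t bc_s => [//||||] [?||||] //= _ _; rewrite mul0r.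
case: s => // i _; have := fl (Oa i); rewrite /= mulr1 => ->.
by move: i; case=> -[|[|//]] ? /=; rewrite ?u0 ?u1 !mul0r.
Qed.

Record term_rep fl (t : term R) (st : sterm) : Prop := TermRep {
  rep_expo : rep fl (expo t) (sexpo st);
  rep_char : char t = schar (sspecies st);
  rep_species : all is_bc (sspecies st);
  rep_coef : coef t = (ssign st)%:~R * qpow (ex (scoef st)) * (q - q^-1)^-1 ^+ sdivs st;
  rep_shift : shift t = (sdivs st)%:R }.

(** The zero modes give the same integral power w in both orders, and their scalars have the ratio
    (-1)^(opp + b) q^d. The last two conditions are those of [zpow_int]. *)
Definition base_check (b : bool) (w : int) (d : qexponent) (opp : bool) (t u : sterm) :=
  [&& szpow (sexpo t) (sexpo u) == w, szpow (sexpo u) (sexpo t) == w,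
    skap (sexpo t) (sexpo u) == qadd (skap (sexpo u) (sexpo t)) d,
    spar (sspecies t) (sexpo u) == opp (+) b (+) spar (sspecies u) (sexpo t),
    slnz (sexpo t) 0 == 0 & slnz (sexpo t) 1 == 0].

Definition contr_check (t u : sterm) (L M : laurent) :=
  leqL (scontr (sexpo t) (sexpo u)) L && leqL (scontr (sexpo u) (sexpo t)) M.

(** The sign and the power of q produced when the phase and the zero modes of t cross e^Q of u. *)
Definition pscal (t u : sterm) : C :=
  (-1) ^+ spar (sspecies t) (sexpo u) * qpow (ex (skap (sexpo t) (sexpo u))).

Section OnePair.
Variables (t u : term R) (st su : sterm).
Hypotheses (tP : term_rep false t st) (uP : term_rep true u su).

Lemma pscal_tu : char t (Qpart (expo u)) * zscal (expo t) (Qpart (expo u)) = pscal st su.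
Proof.
have [rt ct bt _ _] := tP; have [ru cu bu _ _] := uP.
by rewrite (zscal_sound rt ru) ct (schar_sound bt ru).
Qed.

Lemma pscal_ut : char u (Qpart (expo t)) * zscal (expo u) (Qpart (expo t)) = pscal su st.
Proof.
have [rt ct bt _ _] := tP; have [ru cu bu _ _] := uP.
by rewrite (zscal_sound ru rt) cu (schar_sound bu rt).
Qed.

Lemma pair_exchange b w d opp L M (c c' : nat -> C) P :
  base_check b w d opp st su -> contr_check st su L M ->
  exp_of (fun i => lev L i.+1%:R) c -> exp_of (fun i => lev M i.+1%:R) c' ->
  (pscal st su = (-1) ^+ opp * ((-1) ^+ b * pscal su st * qpow (ex d)) -> forall i : int,
    pscal st su * int_series c i - (-1) ^+ b * (pscal su st * int_series c' (w - i))
    = \sum_(rl <- P) rl.1 * qpow rl.2 ^ i) ->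
  forall x y (V : fock), tser t x (tser u y V) - (-1) ^+ b *: tser u y (tser t x V)
    = \sum_(rl <- P) (coef t * coef u) *: residue (expo t) (expo u) w
        (x + shift t) (y + shift u) rl (diag (fun p => char t p * char u p) V).
Proof.
case/and5P=> /eqP zw /eqP zw' /eqP kap /eqP par /andP[/eqP l0 /eqP l1].
case/andP=> cL cM ec ec' scalE.
have [rt ct bt _ _] := tP; have [ru cu bu _ _] := uP.
have kapE : pscal st su = (-1) ^+ opp * ((-1) ^+ b * pscal su st * qpow (ex d)).
  rewrite /pscal kap par exD qpowD !signr_addb; ring.
apply: (@term_exchange R lnq k t u c c').
- by rewrite ct; exact: schar_character.
- by rewrite cu; exact: schar_character.
- by rewrite ct (schar_sound bt ru) signr_eq0.
- case: ec => c0 recc; split=> // n; rewrite recc; apply: eq_bigr => i _.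
  by rewrite -(lev_eq _ _ _ cL) -(contraction_sound _ rt ru).
- case: ec' => c0 recc; split=> // n; rewrite recc; apply: eq_bigr => i _.
  by rewrite -(lev_eq _ _ _ cM) -(contraction_sound _ ru rt).
- by rewrite (zpow_sound rt ru) zw.
- by rewrite (zpow_sound ru rt) zw'.
- exact: (zpow_int rt l0 l1).
- by move=> i; rewrite pscal_tu pscal_ut; exact: scalE.
Qed.

Lemma lev_pole a (i : nat) : lev [:: (1, a)] i.+1%:R = qpow (ex a) ^+ i.+1.
Proof. by rewrite lev1 rmorph1 mul1r /qex qpowMn. Qed.

Lemma eq_exp_of (g h : nat -> C) c : g =1 h -> exp_of g c -> exp_of h c.
Proof.
move=> gh [c0 recc]; split=> // n; rewrite recc; apply: eq_bigr => i _.
by rewrite gh.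
Qed.

Lemma qpowNe a : qpow (ex (qopp a)) = (qpow (ex a))^-1.
Proof. by rewrite exN qpowN. Qed.

(** In this and the next four lemmas the arguments of [base_check] are forced by the contraction as
    a function of x: w is its degree at infinity, and (-1)^opp q^d is the inverse of its leading
    coefficient there. *)
Lemma pair_trivial b : base_check b 0 (0, 0) false st su && contr_check st su [::] [::] ->
  forall x y (V : fock), tser t x (tser u y V) - (-1) ^+ b *: tser u y (tser t x V) = 0.
Proof.
case/andP=> base con x y V.
have e0 : exp_of (fun i => lev [::] i.+1%:R) (fun n => (n == 0%N)%:R).
  split=> // -[|n]; first by rewrite big_ord0 mul0r.
  by rewrite mulr0 big1 // => i _; rewrite lev0 mul0r.
rewrite (pair_exchange (P := [::]) base con e0 e0) ?big_nil // => kapE i.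
by rewrite big_nil; apply: trivial_exchange; rewrite kapE ex0 qpow0 expr0 mul1r mulr1.
Qed.

Lemma pair_zero b a : base_check b 1 (qopp a) true st su &&
    contr_check st su [:: (-1, a)] [:: (-1, qopp a)] ->
  forall x y (V : fock), tser t x (tser u y V) - (-1) ^+ b *: tser u y (tser t x V) = 0.
Proof.
case/andP=> base con x y V.
have ez e : exp_of (fun i => lev [:: (-1, e)] i.+1%:R) (zero_series (qpow (ex e))).
  apply: eq_exp_of (exp_of_zero _) => i.
  by rewrite lev1 rmorphN1 mulN1r /qex qpowMn.
rewrite (pair_exchange (P := [::]) base con (ez _) (ez _)) ?big_nil // => kapE i.
rewrite big_nil qpowNe; apply: zero_exchange; first exact: qpow_neq0.
by rewrite kapE expr1 mulN1r qpowNe.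
Qed.

Lemma pair_pole b a : base_check b (-1) a true st su &&
    contr_check st su [:: (1, a)] [:: (1, qopp a)] ->
  forall x y (V : fock), tser t x (tser u y V) - (-1) ^+ b *: tser u y (tser t x V)
  = (coef t * coef u) *: residue (expo t) (expo u) (-1) (x + shift t) (y + shift u)
      (pscal st su, ex a) (diag (fun p => char t p * char u p) V).
Proof.
case/andP=> base con x y V.
have ep e : exp_of (fun i => lev [:: (1, e)] i.+1%:R) (pole_series (qpow (ex e))).
  apply: eq_exp_of (exp_of_pole _) => i; by rewrite lev_pole.
rewrite (pair_exchange (P := [:: (pscal st su, ex a)]) base con (ep _) (ep _)) ?big_seq1 //.
move=> kapE i; rewrite big_seq1 qpowNe; apply: pole_exchange; first exact: qpow_neq0.
by rewrite kapE expr1 mulN1r.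
Qed.

Lemma pair_moebius b a d : base_check b 0 (qadd a (qopp d)) false st su &&
    contr_check st su [:: (1, a); (-1, d)] [:: (1, qopp a); (-1, qopp d)] ->
  forall x y (V : fock), tser t x (tser u y V) - (-1) ^+ b *: tser u y (tser t x V)
  = (coef t * coef u) *: residue (expo t) (expo u) 0 (x + shift t) (y + shift u)
      (pscal st su * (1 - qpow (ex d) / qpow (ex a)), ex a)
      (diag (fun p => char t p * char u p) V).
Proof.
case/andP=> base con x y V.
have em e e' : exp_of (fun i => lev [:: (1, e); (-1, e')] i.+1%:R)
    (moebius_series (qpow (ex e)) (qpow (ex e'))).
  apply: eq_exp_of (exp_of_moebius _ _) => i.
  by rewrite lev2 rmorph1 rmorphN1 mul1r mulN1r /qex !qpowMn.
set P := (_, ex a).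
rewrite (pair_exchange (P := [:: P]) base con (em _ _) (em _ _)) ?big_seq1 //.
move=> kapE i; rewrite big_seq1 !qpowNe /P /=; apply: moebius_exchange.
- exact: qpow_neq0.
- exact: qpow_neq0.
- by rewrite kapE expr0 mul1r exD qpowD qpowNe mulrA.
Qed.

Lemma pair_poles b a d : qpow (ex a) != qpow (ex d) ->
  base_check b (-2) (qadd a d) false st su &&
    contr_check st su [:: (1, a); (1, d)] [:: (1, qopp a); (1, qopp d)] ->
  forall x y (V : fock), tser t x (tser u y V) - (-1) ^+ b *: tser u y (tser t x V)
  = (coef t * coef u) *: residue (expo t) (expo u) (-2) (x + shift t) (y + shift u)
      (pscal st su * (qpow (ex a) / (qpow (ex a) - qpow (ex d))), ex a)
      (diag (fun p => char t p * char u p) V)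
  + (coef t * coef u) *: residue (expo t) (expo u) (-2) (x + shift t) (y + shift u)
      (pscal st su * - (qpow (ex d) / (qpow (ex a) - qpow (ex d))), ex d)
      (diag (fun p => char t p * char u p) V).
Proof.
move=> ad /andP[base con] x y V.
have em e e' : qpow (ex e) != qpow (ex e') -> exp_of (fun i => lev [:: (1, e); (1, e')] i.+1%:R)
    (poles_series (qpow (ex e)) (qpow (ex e'))).
  move=> ee'; apply: eq_exp_of (exp_of_poles ee') => i.
  by rewrite lev2 rmorph1 !mul1r /qex !qpowMn.
have ad' : qpow (ex (qopp a)) != qpow (ex (qopp d)) by rewrite !qpowNe (inj_eq invr_inj).
set P := (_, ex a); set Q := (_, ex d).
refine (etrans (pair_exchange (P := [:: P; Q]) base con (em _ _ ad) (em _ _ ad') _ x y V)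
  (sum_pair _ P Q)).
move=> kapE i; rewrite big_cons big_seq1 !qpowNe /P /Q /= mulrN.
rewrite !(mulrA (pscal st su) (qpow _) (_ ^-1)) mulNr; apply: poles_exchange.
- exact: qpow_neq0.
- exact: qpow_neq0.
- exact: ad.
- by rewrite kapE expr0 mul1r exD qpowD mulrA.
Qed.

End OnePair.
End Pairs.

(** * Residues *)

(* The coefficient of z^x w^y in (q - q^-1)^(-rdiv) times the sum over the integers n
   of c (q^rpole w / z)^n, times w^(-rshift) :e^rexpo(w):, times the signs of the
   charges in rspecies; c = rcoef. *)
Record sresidue := SResidue {
  rcoef : laurent; rdiv : nat; rpole : qexponent; rshift : int;
  rexpo : sexponent; rspecies : seq osc }.

(* The contraction of two terms, as a function of x = w/z: a constant, 1 - q^a x,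
   1 / (1 - q^a x), (1 - q^d x) / (1 - q^a x) or 1 / ((1 - q^(d-2) x) (1 - q^d x)). *)
Inductive kind := Trivial | Zero of qexponent | Pole of qexponent
  | Moebius of qexponent & qexponent | Poles of qexponent.

Definition one_laurent : laurent := [:: (1, (0, 0))].
Definition qq_laurent : laurent := [:: (1, (2, 0)); (-1, (-2, 0))].

Definition kcheck (b : bool) (K : kind) (t u : sterm) : bool :=
  match K with
  | Trivial => base_check b 0 (0, 0) false t u && contr_check t u [::] [::]
  | Zero a => base_check b 1 (qopp a) true t u
      && contr_check t u [:: (-1, a)] [:: (-1, qopp a)]
  | Pole a => base_check b (-1) a true t u && contr_check t u [:: (1, a)] [:: (1, qopp a)]
  | Moebius a d => base_check b 0 (qadd a (qopp d)) false t u
      && contr_check t u [:: (1, a); (-1, d)] [:: (1, qopp a); (-1, qopp d)]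
  | Poles d => let a := qadd d (-4, 0) in base_check b (-2) (qadd a d) false t u
      && contr_check t u [:: (1, a); (1, d)] [:: (1, qopp a); (1, qopp d)]
  end.

(* t and t' are the forms of the same term in the two normalizations of a *)
Definition sresidue_of (t t' u : sterm) (w : int) (r : laurent) (l : qexponent) (d : nat) :=
  SResidue
    (lmul [:: (ssign t * ssign u * (-1) ^+ spar (sspecies t) (sexpo u),
       qadd (qadd (scoef t) (scoef u)) (qadd (skap (sexpo t) (sexpo u))
         (qscale (w - (sdivs t)%:Z) l)))] r)
    (sdivs t + sdivs u + d) l ((sdivs t)%:Z + (sdivs u)%:Z - w)
    (sadd (ssubst l (sexpo t')) (sexpo u)) (sspecies t ++ sspecies u).

(** For [Poles], where the poles are q^a and q^d with q^a = q^(d-2), the partial fractions have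
    coefficients q^a / (q^a - q^d) = - q^-1 / (q - q^-1) and - q^d / (q^a - q^d) = q / (q - q^-1):
    hence the additional division by q - q^-1. *)
Definition kres (K : kind) (t t' u : sterm) : seq sresidue :=
  match K with
  | Trivial | Zero _ => [::]
  | Pole a => [:: sresidue_of t t' u (-1) one_laurent a 0]
  | Moebius a d => [:: sresidue_of t t' u 0 [:: (1, (0, 0)); (-1, qadd d (qopp a))] a 0]
  | Poles d => [:: sresidue_of t t' u (-2) [:: (-1, (-2, 0))] (qadd d (-4, 0)) 1;
                   sresidue_of t t' u (-2) [:: (1, (2, 0))] d 1]
  end.

(** Signs square to 1, so only the parities of the multiplicities matter. *)
Definition same_species (ss ss' : seq osc) : bool :=
  all (fun i => odd (count_mem (osc_of i) ss) == odd (count_mem (osc_of i) ss')) idxs.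

Definition same_residue (r r' : sresidue) : bool :=
  [&& rpole r == rpole r', rshift r == rshift r', seq_equiv (rexpo r) (rexpo r')
    & same_species (rspecies r) (rspecies r')].

(* the sum of the coefficients, multiplied by (q - q^-1)^D *)
Definition total_coef (D : nat) (rs : seq sresidue) : laurent :=
  flatten [seq lmul (rcoef r) (iter (D - rdiv r) (lmul qq_laurent) one_laurent) | r <- rs].

(** Residues are grouped by pole, power of w, exponential and signs, and the coefficients of each
    group must sum to 0. The fuel n bounds the number of groups; the test fails if it runs out. *)
Fixpoint vanish (n D : nat) (rs : seq sresidue) : bool :=
  match n, rs with
  | _, [::] => true
  | n'.+1, r :: rs' =>
      [&& all (fun r' => rdiv r' <= D)%N rs,
        leqL (total_coef D [seq r' <- rs | same_residue r r']) [::]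
        & vanish n' D [seq r' <- rs | ~~ same_residue r r']]
  | _, _ => false
  end.

Lemma leqL_refl L : leqL L L.
Proof. by apply/allP => e _. Qed.

Lemma seq_equiv_refl u : seq_equiv u u.
Proof. by apply/allP => i _; rewrite !leqL_refl !eqxx. Qed.

Lemma eq_big_all (V : nmodType) (I : Type) (rs : seq I) (p : pred I) (F G : I -> V) :
  all p rs -> (forall i, p i -> F i = G i) -> \sum_(i <- rs) F i = \sum_(i <- rs) G i.
Proof.
move=> prs FG; elim: rs prs => [_|i rs IHrs /= /andP[/FG pi /IHrs {}IHrs]].
  by rewrite !big_nil.
by rewrite !big_cons pi IHrs.
Qed.

Lemma sum_scale_all (F : pzRingType) (V : lmodType F) (I : Type) (rs : seq I) (p : pred I)
    (G : I -> V) (a : I -> F) (w : V) : all p rs -> (forall i, p i -> G i = a i *: w) ->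
  \sum_(i <- rs) G i = (\sum_(i <- rs) a i) *: w.
Proof. by move=> prs GE; rewrite scaler_suml; exact: (eq_big_all prs GE). Qed.

Lemma vanishS n D r rs : vanish n.+1 D (r :: rs) =
  [&& all (fun r' => rdiv r' <= D)%N (r :: rs),
    leqL (total_coef D [seq r' <- r :: rs | same_residue r r']) [::]
    & vanish n D [seq r' <- r :: rs | ~~ same_residue r r']].
Proof. by []. Qed.

Section Residues.
Variable R : realType.
Local Notation C := R[i].
Local Notation label := (label R).
Local Notation fock := (fock R).
Variables lnq k : C.
Local Notation qpow := (qpow lnq).
Local Notation qnum := (qnum lnq).
Local Notation q := (qpow 1).
Local Notation nexp := (nexp lnq k).
Local Notation ex := (ex k).
Local Notation lev := (lev lnq k).
Local Notation rep := (rep lnq k).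
Local Notation den := (den lnq k).
Local Notation den0 := (den0 k).
Local Notation tser := (tser lnq k).
Local Notation residue := (residue lnq k).
Local Notation pscal := (pscal lnq k).
Local Notation term_rep := (term_rep lnq k).
Hypothesis q_not_root : forall n : nat, (0 < n)%N -> q ^+ n != 1.
Hypothesis k_generic : forall m : nat, (0 < m)%N -> qnum ((k + 1) * m%:R) != 0.
Hypothesis k1_neq0 : k + 1 != 0.

(** A canonical exponent with symbolic form u, which stands for all those produced by different
    pairs of terms. *)
Definition realize (u : sexponent) : exponent R := Exponent
  (fun s n => match n with
    | Posz m => lev (spos u (osc_idx s)) m%:R / den true s m%:R
    | Negz m => lev (sneg u (osc_idx s)) m.+1%:R / den true s m.+1%:R
    end)
  ((sQ u 0)%:~R / (k + 1), (sQ u 1)%:~R / (k + 1), sQ u 2, sQ u 3, sQ u 4, sQ u 5)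
  (fun s => lnq * ex (scst u (osc_idx s)) / den0 true s)
  (fun s => (slnz u (osc_idx s))%:~R / den0 true s).

Lemma rep_realize u : rep true (realize u) u.
Proof.
split=> [s l|s l|||]; first by rewrite divfK // den_neq0.
- by rewrite divfK // den_neq0.
- by apply: osc_ind2; rewrite /Defs.coord /= ?mulr1 ?divfK.
- by move=> s; rewrite divfK // den0_neq0.
- by move=> s; rewrite divfK // den0_neq0.
Qed.

Definition rscal (r : sresidue) (x : C) : C :=
  if is_int x then lev (rcoef r) 1 * (q - q^-1)^-1 ^+ rdiv r * qpow (- (ex (rpole r) * x))
  else 0.

Definition rser (r : sresidue) (x y : C) (v : fock) : fock :=
  rscal r x *: nexp (realize (rexpo r)) (x + y + (rshift r)%:~R) (diag (schar (rspecies r)) v).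

Lemma levM L M m : lev (lmul L M) m = lev L m * lev M m.
Proof. by rewrite /lev lsum_mul //; exact: qexD. Qed.

Lemma lev_one m : lev one_laurent m = 1.
Proof. by rewrite lev1 qex0 mulr1 rmorph1. Qed.

Lemma lev_qq : lev qq_laurent 1 = q - q^-1.
Proof. by rewrite lev2 rmorph1 rmorphN1 mul1r mulN1r /qex !mulr1 (exN k (2, 0)) ex20 qpowN. Qed.

Lemma is_int_addn (x : C) (n : nat) : is_int (x + n%:R) = is_int x.
Proof.
apply/asboolP/asboolP => -[a xa].
  by exists (a - n%:Z); rewrite rmorphB /= -xa addrK.
by exists (a + n%:Z); rewrite rmorphD /= -xa.
Qed.

Lemma schar_cat ss ss' p : @schar R (ss ++ ss') p = @schar R ss p * @schar R ss' p.
Proof. exact: big_cat. Qed.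

(** The scalars are read off [st], but the exponent at the pole is a sum with that of u, which
    requires t in the normalization of u, given by [st']. *)
Lemma residue_sound t u st st' su (w : int) r L l d x y (V : fock) :
  term_rep false t st -> rep true (expo t) (sexpo st') -> term_rep true u su ->
  r = lev L 1 * (q - q^-1)^-1 ^+ d ->
  (coef t * coef u) *: residue (expo t) (expo u) w (x + shift t) (y + shift u)
      (pscal st su * r, ex l) (diag (fun p => char t p * char u p) V)
  = rser (sresidue_of st st' su w L l d) x y V.
Proof.
move=> [rt ct bt kt ht] rt' [ru cu bu ku hu] rE.
rewrite /residue scalerA /rser; apply: (congr2 (fun a z => a *: z)).
  rewrite ht is_int_addn /rscal /=; case: ifP => _; last by rewrite mulr0.
  rewrite rE kt ku levM lev1 /pscal /qex mulr1 !exprD.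
  move: (skap _ _) => K; rewrite 3!exD exZ 2!intrM intrB.
  have -> : (((-1) ^+ spar (sspecies st) (sexpo su) : int)%:~R : C)
      = (-1) ^+ spar (sspecies st) (sexpo su) by rewrite rmorphXn rmorphN1.
  rewrite (_ : ex l * (w%:~R - (x + (sdivs st)%:R))
    = (w%:~R - (sdivs st)%:Z%:~R) * ex l + - (ex l * x)); last by ring.
  rewrite !qpowD; ring.
have -> : (fun p => char t p * char u p) = @schar R (sspecies st ++ sspecies su).
  by apply: funext => p; rewrite schar_cat ct cu.
have -> : x + shift t + (y + shift u) - w%:~R
    = x + y + ((sdivs st)%:Z + (sdivs su)%:Z - w)%:~R.
  by rewrite ht hu rmorphB rmorphD /=; ring.
exact: (nexp_rep_eq q_not_root k_generic k1_neq0 (rep_add (rep_subst l rt') ru)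
  (rep_realize _) (seq_equiv_refl _)).
Qed.

Lemma bracket_sound b K t u st st' su x y (V : fock) :
  term_rep false t st -> rep true (expo t) (sexpo st') -> term_rep true u su ->
  kcheck b K st su ->
  tser t x (tser u y V) - (-1) ^+ b *: tser u y (tser t x V)
  = \sum_(r <- kres K st st' su) rser r x y V.
Proof.
move=> tP tP' uP; have q0 := qq_neq0 q_not_root.
case: K => [|a|a|a d|d] /= chk.
- by rewrite big_nil; exact: (pair_trivial tP uP chk).
- by rewrite big_nil; exact: (pair_zero tP uP chk).
- rewrite big_seq1; apply: (etrans (pair_pole tP uP chk x y V)).
  rewrite -[pscal st su]mulr1; refine (residue_sound _ _ _ _ _ tP tP' uP _).
  by rewrite lev_one mulr1.
- rewrite big_seq1; apply: (etrans (pair_moebius tP uP chk x y V)).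
  refine (residue_sound _ _ _ _ _ tP tP' uP _).
  by rewrite mulr1 lev2 qex0 qexD /qex !mulr1 rmorph1 rmorphN1 mulN1r exN qpowN.
- have e4 : ex (qadd d (-4, 0)) = ex d - 2 by rewrite exD /ex /=; field.
  have qq2 : qpow 2 = q * q by rewrite -qpowD.
  have ad : qpow (ex (qadd d (-4, 0))) != qpow (ex d).
    rewrite e4 qpowD qpowN qq2; apply/eqP => e; have qd := qpow_neq0 lnq (ex d).
    have := q_not_root (n := 2) isT; rewrite expr2 -(inj_eq invr_inj) invr1 => /eqP; apply.
    by apply: (mulfI qd); rewrite e mulr1.
  apply: (etrans (pair_poles tP uP ad chk x y V)).
  rewrite (sum_pair (fun r => rser r x y V)).
  have q1 := qpow_neq0 lnq 1; have qd := qpow_neq0 lnq (ex d).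
  have qq1 : q * q - 1 != 0 by rewrite subr_eq0; exact: (q_not_root (n := 2) isT).
  have qdq : qpow (ex d) + - qpow (ex d) * (q * q) != 0.
    have -> : qpow (ex d) + - qpow (ex d) * (q * q) = - qpow (ex d) * (q * q - 1) by ring.
    by rewrite mulf_neq0 ?oppr_eq0.
  have l1 : lev [:: (-1, (-2, 0))] 1 = - q^-1.
    by rewrite lev1 rmorphN1 mulN1r /qex mulr1 (exN k (2, 0)) ex20 qpowN.
  have l2 : lev [:: (1, (2, 0))] 1 = q.
    by rewrite lev1 rmorph1 mul1r /qex mulr1 ex20.
  apply: (congr2 +%R); refine (residue_sound _ _ _ _ _ tP tP' uP _).
    by rewrite l1 expr1 e4 qpowD qpowN qq2; field; rewrite q1 qq1 qdq.
  by rewrite l2 expr1 e4 qpowD qpowN qq2; field; rewrite q1 qq1 qdq.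
Qed.

(** With the common denominator (q - q^-1)^D, coefficients of residues with different [rdiv] can be
    added as Laurent polynomials. *)
Lemma rcoef_sound r D x : (rdiv r <= D)%N -> rscal r x = (if is_int x then
    lev (lmul (rcoef r) (iter (D - rdiv r) (lmul qq_laurent) one_laurent)) 1
      * (q - q^-1)^-1 ^+ D * qpow (- (ex (rpole r) * x)) else 0).
Proof.
move=> rD; rewrite /rscal; case: ifP => // _; rewrite levM.
have -> n : lev (iter n (lmul qq_laurent) one_laurent) 1 = (q - q^-1) ^+ n.
  by elim: n => [|n IHn]; rewrite ?lev_one // iterS levM lev_qq IHn exprS.
have -> : (q - q^-1)^-1 ^+ rdiv r = (q - q^-1) ^+ (D - rdiv r) * (q - q^-1)^-1 ^+ D.
  rewrite -{2}(subnK rD) exprD mulrA -exprMn divff ?expr1n ?mul1r //.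
  exact: (qq_neq0 q_not_root).
by rewrite mulrA.
Qed.

Lemma schar_count ss p :
  schar ss p = \prod_(i <- idxs) sgnz R (coordz p (osc_of i)) ^+ count_mem (osc_of i) ss.
Proof.
elim: ss => [|s ss IHss]; first by rewrite /schar big_nil big1.
rewrite /schar big_cons -/(schar ss p) IHss.
have -> : sgnz R (coordz p s) = \prod_(i <- idxs) sgnz R (coordz p (osc_of i)) ^+ (osc_of i == s).
  rewrite (bigD1_seq (osc_idx s)) ?iota_uniq ?mem_iota ?osc_idx_lt //= osc_idxK eqxx expr1.
  rewrite big_seq_cond big1 ?mulr1 // => i /andP[i_in i_ne]; case: eqP => // is_; case/eqP: i_ne.
  by rewrite -is_ osc_ofK //; move: i_in; rewrite mem_iota.
rewrite -big_split; apply: eq_bigr => i _ /=; by rewrite exprD eq_sym.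
Qed.

Lemma same_species_sound ss ss' p : same_species ss ss' -> schar ss p = schar ss' p :> C.
Proof.
move=> /allP same; rewrite !schar_count big_seq [RHS]big_seq; apply: eq_bigr => i i_in.
have odd_sgnz (m : int) n : sgnz R m ^+ n = sgnz R m ^+ odd n.
  by rewrite /sgnz -!exprM -signr_odd -[RHS]signr_odd !oddM oddb.
by rewrite odd_sgnz (eqP (same i i_in)) -odd_sgnz.
Qed.

Lemma same_residue_sound r r' x y (v : fock) : same_residue r r' ->
  nexp (realize (rexpo r')) (x + y + (rshift r')%:~R) (diag (schar (rspecies r')) v)
  = nexp (realize (rexpo r)) (x + y + (rshift r)%:~R) (diag (schar (rspecies r)) v).
Proof.
case/and4P=> _ /eqP -> equ same.
have -> : schar (rspecies r') = schar (rspecies r) :> (label -> C).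
  by apply: funext => p; rewrite (same_species_sound _ same).
apply: esym.
exact: (nexp_rep_eq q_not_root k_generic k1_neq0 (rep_realize _) (rep_realize _) equ).
Qed.

Lemma sum_filter_split (V : nmodType) (I : Type) (p : pred I) (rs : seq I) (F : I -> V) :
  \sum_(r <- rs) F r = \sum_(r <- rs | p r) F r + \sum_(r <- rs | ~~ p r) F r.
Proof. by rewrite (bigID p). Qed.

Lemma vanish_sound n D rs x y (v : fock) : vanish n D rs ->
  \sum_(r <- rs) rser r x y v = 0.
Proof.
elim: n rs => [[_|//]|n IHn [_|r rs]]; first exact: big_nil.
  exact: big_nil.
rewrite vanishS; set rs0 := r :: rs; case/and3P=> small zero rest.
refine (etrans (sum_filter_split (same_residue r) rs0 (fun r' => rser r' x y v)) _).
rewrite -[X in _ + X]big_filter (IHn _ rest) addr0 -big_filter.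
set W := nexp (realize (rexpo r)) (x + y + (rshift r)%:~R) (diag (schar (rspecies r)) v).
set ws := [seq r' <- rs0 | same_residue r r'].
have wsP : all (fun r' => same_residue r r' && (rdiv r' <= D)%N) ws.
  by rewrite all_filter; apply: sub_all small => r' /= ->; rewrite andbT implybb.
have E r' : same_residue r r' && (rdiv r' <= D)%N -> rser r' x y v = rscal r' x *: W.
  by case/andP=> same _; rewrite /rser (same_residue_sound _ _ _ same).
refine (etrans (sum_scale_all wsP E) (etrans (congr1 (fun a => a *: W) _) (scale0r W))).
pose a := (q - q^-1)^-1 ^+ D * qpow (- (ex (rpole r) * x)).
have tot0 : \sum_(r' <- ws) lev (lmul (rcoef r') (iter (D - rdiv r') (lmul qq_laurent)
    one_laurent)) 1 = 0.
  exact: (etrans (esym (lsum_flatten (qex lnq k 1) _ _)) (etrans (lev_eq lnq k 1 zero) (lev0 _ _ _))).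
have F r' : same_residue r r' && (rdiv r' <= D)%N -> rscal r' x = (if is_int x then
    lev (lmul (rcoef r') (iter (D - rdiv r') (lmul qq_laurent) one_laurent)) 1 else 0) * a.
  case/andP=> same small'; rewrite (rcoef_sound x small') /a; case/and4P: same => /eqP -> _ _ _.
  by case: ifP => _; rewrite ?mul0r ?mulrA.
rewrite (eq_big_all wsP F) -mulr_suml; case: (is_int x); last by rewrite big1 ?mul0r.
by rewrite tot0 mul0r.
Qed.

End Residues.

(** * The currents *)

Section Data.
Variable fl : bool.
Local Notation "u [+] v" := (sadd u v) (at level 50, left associativity).
Local Notation "u [-] v" := (sadd u (sopp v)) (at level 50, left associativity).
Local Notation "[-] u" := (sopp u) (at level 35, right associativity).
Let z : qexponent := (0, 0).
Let one : qexponent := (2, 0).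
Let mone : qexponent := (-2, 0).
Let a1 := sden fl (Oa 0).
Let bc : qexponent := (2, 0).

Definition sXp1 := [::
  STerm (-1) z 1 ([-] sfld 2 z mone [-] sfld 5 one z) [:: Oc; Ob12];
  STerm 1 z 1 ([-] sfld 2 z mone [-] sfld 5 mone z) [:: Oc; Ob12]].

Definition sXp2 := [::
  STerm (-1) z 0 ([-] sfldp 2 bc one [-] sfldp 3 bc one [+] sfld 4 one z)
    [:: Oc; Ob12; Ob13; Ob23];
  STerm 1 z 0 (sfld 2 z z [+] sfld 3 z z [+] sfld 5 z z) [::]].

Definition sXm1 := [::
  STerm 1 z 1 (sfldp 0 a1 (1, 1) [+] sfld 2 (4, 2) one [+] sfldp 3 bc (4, 2)
    [-] sfldp 4 bc (2, 2) [+] sfld 5 (2, 2) z) [:: Oc; Ob12];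
  STerm (-1) z 1 (sfldm 0 a1 (-1, -1) [+] sfld 2 (-4, -2) one [+] sfldm 3 bc (-4, -2)
    [-] sfldm 4 bc (-2, -2) [+] sfld 5 (-2, -2) z) [:: Oc; Ob12];
  STerm 1 (2, 2) 0 (sfldp 0 a1 (1, 1) [-] sfld 3 (2, 2) z [+] sfld 4 (2, 2) mone)
    [:: Ob13; Ob23]].

Definition sXm2 := [::
  STerm 1 one 1 (sfldp 1 a1 (1, 1) [-] sfld 4 (2, 2) z) [:: Oc; Ob12; Ob13; Ob23];
  STerm (-1) one 1 (sfldm 1 a1 (-1, -1) [-] sfld 4 (-2, -2) z) [:: Oc; Ob12; Ob13; Ob23];
  STerm (-1) z 1 (sfldm 1 a1 (-1, -1) [-] sfld 2 (-2, -2) one [-] sfld 3 (-2, -2) one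
    [-] sfld 5 (0, -2) z) [::];
  STerm 1 z 1 (sfldm 1 a1 (-1, -1) [-] sfld 2 (-2, -2) one [-] sfld 3 (-2, -2) one
    [-] sfld 5 (-4, -2) z) [::]].

Definition stS1 :=
  let f := [-] sfld 2 z z [-] sfldm 2 bc mone [-] sfldm 3 bc mone [+] sfldm 4 bc z in
  [:: STerm 1 z 1 (f [-] sfld 5 z z) [:: Oc; Ob12];
    STerm (-1) z 1 (f [-] sfld 5 (-4, 0) z) [:: Oc; Ob12];
    STerm 1 one 0 (sfld 3 z z [-] sfld 4 one z [+] sfldp 4 bc z) [:: Ob13; Ob23]].

Definition stS2 := [:: STerm (-1) mone 0 (sfld 4 z z) [:: Oc; Ob12; Ob13; Ob23]].

Definition sA i := [-] sfld i z (1, 1).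
Definition smerge i (u : sterm) :=
  STerm (ssign u) (scoef u) (sdivs u) (sadd (sA i) (sexpo u)) (sspecies u).

Definition sA' i := [-] sfld i z (-1, -1).
(** On the support of delta(q^(k+1) w/z), the factor z^-1 is q^(-k-1) w^-1, and similarly for the
    other sign. This gives the coefficients, and one of the two units of [rshift]; the other comes
    from the difference operator. *)
Definition stotal i := [::
  SResidue [:: (-1, (-2, -2))] 1 (2, 2) 2 (ssubst (2, 2) (sA' i)) [::];
  SResidue [:: (1, (2, 2))] 1 (-2, -2) 2 (ssubst (-2, -2) (sA' i)) [::]].

End Data.

Definition rneg (r : sresidue) :=
  SResidue (lneg (rcoef r)) (rdiv r) (rpole r) (rshift r) (rexpo r) (rspecies r).

Definition kres_row (Ks : seq kind) (t t' : sterm) (us : seq sterm) :=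
  flatten [seq kres Ku.1 t t' Ku.2 | Ku <- zip Ks us].
Definition kcheck_row b (Ks : seq kind) (t : sterm) (us : seq sterm) :=
  (size Ks == size us) && all (fun Ku => kcheck b Ku.1 t Ku.2) (zip Ks us).
Fixpoint ktable (Kss : seq (seq kind)) (ts ts' us : seq sterm) : seq sresidue :=
  match Kss, ts, ts' with
  | Ks :: Kss', t :: ts1, t' :: ts1' => kres_row Ks t t' us ++ ktable Kss' ts1 ts1' us
  | _, _, _ => [::]
  end.
Fixpoint ktable_check b (Kss : seq (seq kind)) (ts us : seq sterm) : bool :=
  match Kss, ts with
  | Ks :: Kss', t :: ts1 => kcheck_row b Ks t us && ktable_check b Kss' ts1 us
  | [::], [::] => true
  | _, _ => false
  end.

(** Rows of these tables are the terms of X, columns those of S. The two residues at q^-1 in [Kp11]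
    cancel, as do the two at q^-2 in [Kp21] and the six at q^k in [Km21]. *)
Definition Kp11 := [:: [:: Trivial; Moebius (-2, 0) (-6, 0); Trivial];
                       [:: Moebius (-2, 0) (2, 0); Trivial; Trivial]].
Definition Kp21 := [:: [:: Trivial; Trivial; Pole (-4, 0)];
                       [:: Trivial; Moebius (-4, 0) (0, 0); Zero (0, 0)]].
Definition Kp12 := [:: [:: Trivial]; [:: Trivial]].
Definition Kp22 := [:: [:: Zero (-2, 0)]; [:: Trivial]].
(** The kind [Poles] has the poles q^(-k-3) and q^(-k-1). The former cancels against the first row;
    the latter and q^(k+1) from the second row are the two terms of the total difference. *)
Definition Km11 := [:: [:: Trivial; Moebius (-6, -2) (-2, -2); Trivial];
  [:: Moebius (2, 2) (-2, 2); Trivial; Trivial]; [:: Trivial; Trivial; Poles (-2, -2)]].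
Definition Km12 := [:: [:: Trivial]; [:: Trivial]; [:: Zero (-4, -2)]].
Definition Km21 := [:: [:: Trivial; Trivial; Zero (-4, -2)];
  [:: Moebius (0, 2) (4, 2); Moebius (0, 2) (4, 2); Zero (4, 2)];
  [:: Trivial; Moebius (0, 2) (-4, 2); Pole (0, 2)];
  [:: Moebius (0, 2) (4, 2); Trivial; Pole (0, 2)]].
Definition Km22 := [:: [:: Pole (-2, -2)]; [:: Pole (2, 2)]; [:: Trivial]; [:: Trivial]].

Lemma sum_triple (V : nmodType) (I : Type) (F : I -> V) i j l :
  \sum_(r <- [:: i; j; l]) F r = F i + (F j + F l).
Proof. by rewrite 2!big_cons big_seq1. Qed.

Lemma sum_quadruple (V : nmodType) (I : Type) (F : I -> V) i j l m :
  \sum_(r <- [:: i; j; l; m]) F r = F i + (F j + (F l + F m)).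
Proof. by rewrite 3!big_cons big_seq1. Qed.

Lemma sum_cons (V : nmodType) (I : Type) (F : I -> V) i rs :
  \sum_(r <- i :: rs) F r = F i + \sum_(r <- rs) F r.
Proof. exact: big_cons. Qed.

Lemma sum_cat (V : nmodType) (I : Type) (F : I -> V) rs rs' :
  \sum_(r <- rs ++ rs') F r = \sum_(r <- rs) F r + \sum_(r <- rs') F r.
Proof. exact: big_cat. Qed.

Section Shapes.
Variables (F : comPzRingType) (V : lmodType F).
Implicit Types (a b c : F) (u v : V).

Lemma opp_scaleB a c c' u v : c = - a -> c' = a -> - (a *: (u - v)) = c *: u + c' *: v.
Proof. by move=> -> ->; rewrite scalerBr opprB scaleNr addrC. Qed.

Lemma oppD_scale c c' u v : c = -1 -> c' = 1 -> - u + v = c *: u + c' *: v.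
Proof. by move=> -> ->; rewrite scaleN1r scale1r. Qed.

Lemma scaleBD a b c c' c'' u v w : c = a -> c' = - a -> c'' = b ->
  a *: (u - v) + b *: w = c *: u + (c' *: v + c'' *: w).
Proof. by move=> -> -> ->; rewrite scalerBr scaleNr addrA. Qed.

Lemma scaleBB a b c c' c'' c3 u v w w' : c = a * b -> c' = - (a * b) -> c'' = - a -> c3 = a ->
  a *: (b *: (u - v) - (w - w')) = c *: u + (c' *: v + (c'' *: w + c3 *: w')).
Proof.
by move=> -> -> -> ->; rewrite !scalerBr !scalerA opprB !scaleNr -!addrA [- (a *: w) + _]addrC.
Qed.

Lemma opp_scale b c u : c = - b -> - (b *: u) = c *: u.
Proof. by move=> ->; rewrite scaleNr. Qed.

Lemma sum_commutator (I J : Type) (ts : seq I) (us : seq J) (f : I -> {linear V -> V})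
    (g : J -> {linear V -> V}) (s : F) v :
  \sum_(t <- ts) f t (\sum_(u <- us) g u v) - s *: (\sum_(u <- us) g u (\sum_(t <- ts) f t v))
  = \sum_(t <- ts) \sum_(u <- us) (f t (g u v) - s *: g u (f t v)).
Proof.
under eq_bigr => t _ do rewrite linear_sum.
under [X in _ - s *: X]eq_bigr => u _ do rewrite linear_sum.
rewrite scaler_sumr; under [X in _ - X]eq_bigr => u _ do rewrite scaler_sumr.
rewrite [X in _ - X]exchange_big -sumrB; apply: eq_bigr => t _.
by rewrite -sumrB.
Qed.

Lemma total_shape a b c d p p' s s' u : a * (c * d) - a * (b * d) = p * p' + s * s' ->
  a *: (b *: - (d *: u) - c *: - (d *: u)) = p *: (p' *: u) + s *: (s' *: u).
Proof.
move=> E; rewrite !scalerN opprK scalerDr scalerN !scalerA -scalerDl -E scalerBl !mulrA.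
by rewrite addrC.
Qed.

End Shapes.

Section Currents.
Variable R : realType.
Local Notation C := R[i].
Local Notation label := (label R).
Local Notation fock := (fock R).
Variables lnq k : C.
Local Notation qpow := (qpow lnq).
Local Notation qnum := (qnum lnq).
Local Notation q := (qpow 1).
Local Notation nexp := (nexp lnq k).
Local Notation ex := (ex k).
Local Notation rep := (rep lnq k).
Local Notation tser := (tser lnq k).
Local Notation term_rep := (term_rep lnq k).
Local Notation rser := (rser lnq k).
Hypothesis q_not_root : forall n : nat, (0 < n)%N -> q ^+ n != 1.
Hypothesis k_generic : forall m : nat, (0 < m)%N -> qnum ((k + 1) * m%:R) != 0.
Hypothesis k1_neq0 : k + 1 != 0.
Local Notation a1 := (pair_of R (Oa 0)).
Local Notation a2 := (pair_of R (Oa 1)).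
Local Notation b12 := (pair_of R Ob12).
Local Notation b13 := (pair_of R Ob13).
Local Notation b23 := (pair_of R Ob23).
Local Notation c := (pair_of R Oc).
Local Notation fld := (fld lnq).
Local Notation fldp := (fldp lnq).
Local Notation fldm := (fldm lnq).
Local Notation "f [+] g" := (eadd f g) (at level 50, left associativity).
Local Notation "f [-] g" := (eadd f (eopp g)) (at level 50, left associativity).
Local Notation "[-] f" := (eopp f) (at level 35, right associativity).

Definition realized (fs : exponent R * sterm) : term R :=
  Term ((ssign fs.2)%:~R * qpow (ex (scoef fs.2)) * (q - q^-1)^-1 ^+ sdivs fs.2)
    (sdivs fs.2)%:R fs.1 (@schar R (sspecies fs.2)).

Fixpoint all_rep fl (fs : seq (exponent R)) (ss : seq sterm) : Prop :=
  match fs, ss with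
  | f :: fs', s :: ss' => [/\ rep fl f (sexpo s), all is_bc (sspecies s) & all_rep fl fs' ss']
  | [::], [::] => True
  | _, _ => False
  end.

Lemma realized_rep fl f s : rep fl f (sexpo s) -> all is_bc (sspecies s) ->
  term_rep fl (realized (f, s)) s.
Proof. by []. Qed.

Lemma rep_fldE fl s x y l m : is_bc s -> x = ex l -> y = ex m ->
  rep fl (fld (pair_of R s) x y) (sfld (osc_idx s) l m).
Proof. by move=> bc_s -> ->; exact: rep_fld. Qed.

Lemma rep_fldpE fl s x l : x = ex l ->
  rep fl (fldp (pair_of R s) x) (sfldp (osc_idx s) (sden fl s) l).
Proof. by move=> ->; exact: rep_fldp. Qed.

Lemma rep_fldmE fl s x l : x = ex l ->
  rep fl (fldm (pair_of R s) x) (sfldm (osc_idx s) (sden fl s) l).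
Proof. by move=> ->; exact: rep_fldm. Qed.

Lemma rep_astarE (i : 'I_2) x y l m : x = ex l -> y = ex m ->
  rep true (fld (astar lnq k i) x y) (sfld i l m).
Proof. by move=> -> ->; exact: rep_astar. Qed.

Ltac solve_ex := by rewrite /ex /=; field.
Ltac solve_rep := repeat first
  [ refine (rep_add _ _) | refine (rep_opp _)
  | refine (rep_fldE _ (isT : is_bc Ob12) _ _); solve_ex
  | refine (rep_fldE _ (isT : is_bc Ob13) _ _); solve_ex
  | refine (rep_fldE _ (isT : is_bc Ob23) _ _); solve_ex
  | refine (rep_fldE _ (isT : is_bc Oc) _ _); solve_ex
  | refine (rep_fldpE _ _ _); solve_ex
  | refine (rep_fldmE _ _ _); solve_ex
  | refine (rep_astarE _ _ _); solve_ex ].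

Ltac solve_all_rep := first
  [ exact I | refine (And3 _ _ _); [solve_rep | reflexivity | solve_all_rep] ].

Definition fXp1 := [:: [-] fld b12 0 (-1) [-] fld c 1 0; [-] fld b12 0 (-1) [-] fld c (-1) 0].

Definition fXp2 := [:: [-] fldp b12 1 [-] fldp b13 1 [+] fld b23 1 0;
  fld b12 0 0 [+] fld b13 0 0 [+] fld c 0 0].
Definition fXm1 := [::
  fldp a1 ((k + 1) / 2) [+] fld b12 (k + 2) 1 [+] fldp b13 (k + 2)
    [-] fldp b23 (k + 1) [+] fld c (k + 1) 0;
  fldm a1 (- ((k + 1) / 2)) [+] fld b12 (- k - 2) 1
    [+] fldm b13 (- k - 2) [-] fldm b23 (- k - 1) [+] fld c (- k - 1) 0;
  fldp a1 ((k + 1) / 2) [-] fld b13 (k + 1) 0 [+] fld b23 (k + 1) (-1)].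
Definition fXm2 := [::
  fldp a2 ((k + 1) / 2) [-] fld b23 (k + 1) 0;
  fldm a2 (- ((k + 1) / 2)) [-] fld b23 (- k - 1) 0;
  fldm a2 (- ((k + 1) / 2)) [-] fld b12 (- k - 1) 1 [-] fld b13 (- k - 1) 1 [-] fld c (- k) 0;
  fldm a2 (- ((k + 1) / 2)) [-] fld b12 (- k - 1) 1 [-] fld b13 (- k - 1) 1
    [-] fld c (- k - 2) 0].
Definition ftS1 :=
  let f := [-] fld b12 0 0 [-] fldm b12 (-1) [-] fldm b13 (-1) [+] fldm b23 0 in
  [:: f [-] fld c 0 0; f [-] fld c (-2) 0; fld b13 0 0 [-] fld b23 1 0 [+] fldp b23 0].
Definition ftS2 := [:: fld b23 0 0].

Lemma all_rep_Xp1 fl : all_rep fl fXp1 sXp1.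
Proof. solve_all_rep. Qed.
Lemma all_rep_Xp2 fl : all_rep fl fXp2 sXp2.
Proof. solve_all_rep. Qed.
Lemma all_rep_Xm1 fl : all_rep fl fXm1 (sXm1 fl).
Proof. solve_all_rep. Qed.
Lemma all_rep_Xm2 fl : all_rep fl fXm2 (sXm2 fl).
Proof. solve_all_rep. Qed.
Lemma all_rep_tS1 fl : all_rep fl ftS1 stS1.
Proof. solve_all_rep. Qed.
Lemma all_rep_tS2 fl : all_rep fl ftS2 stS2.
Proof. solve_all_rep. Qed.

Definition series fs ss : fseries R := fun x v =>
  \sum_(t <- [seq realized fs' | fs' <- zip fs ss]) tser t x v.

Lemma diag_schar0 (v : fock) : diag (schar [::]) v = v.
Proof.
have -> : schar [::] = (fun=> 1) :> (label -> C).
  by apply: funext => p; rewrite /schar big_nil.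
apply: (eq_linear (S := diag (fun=> 1)) (T := idfun)) => b.
exact: (etrans (diagU _ b) (scale1r _)).
Qed.

Lemma tser_shift0 f sg e E ss x (v : fock) :
  tser (realized (f, STerm sg e 0 E ss)) x v
  = coef (realized (f, STerm sg e 0 E ss)) *: nexp f x (diag (schar ss) v).
Proof.
exact: (congr1 (fun z => coef (realized (f, STerm sg e 0 E ss)) *: nexp f z (diag (schar ss) v))
  (addr0 x)).
Qed.

Lemma tser_unphased0 f sg e E x (v : fock) :
  tser (realized (f, STerm sg e 0 E [::])) x v
  = coef (realized (f, STerm sg e 0 E [::])) *: nexp f x v.
Proof.
refine (etrans (tser_shift0 _ _ _ _ _ _ _) _).
exact: (congr1 (fun w => coef (realized (f, STerm sg e 0 E [::])) *: nexp f x w) (diag_schar0 v)).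
Qed.

Lemma tser_unphased1 f sg e E x (v : fock) :
  tser (realized (f, STerm sg e 1 E [::])) x v
  = coef (realized (f, STerm sg e 1 E [::])) *: nexp f (x + 1) v.
Proof.
exact: (congr1 (fun w => coef (realized (f, STerm sg e 1 E [::])) *: nexp f (x + 1) w) (diag_schar0 v)).
Qed.

Definition phase_schar1 ss (v : fock) := @phase_schar R k 1 ss v (or_introl erefl).
Definition phase_scharN1 ss (v : fock) := @phase_schar R k (-1) ss v (or_intror erefl).
Notation qq := ((q - q^-1)^-1).

Lemma exN20 : ex (-2, 0) = -1.
Proof. by rewrite (exN k (2, 0)) ex20. Qed.

Ltac solve_coef := by rewrite /= ?ex0 ?ex20 ?exN20 ?ex22 ?qpowN ?qpow0 ?expr0 ?expr1 ?mulr1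
  ?rmorph1 ?rmorphN1 ?mulN1r ?mul1r ?mulNr ?mul1r.

Lemma Xp1E x v : Xp1 lnq k x v = series fXp1 sXp1 x v.
Proof.
refine (etrans _ (esym (sum_pair (fun t => tser t x v) _ _))).
set u := nexp ([-] fld b12 0 (-1) [-] fld c 1 0) (x + 1) (diag (schar [:: Oc; Ob12]) v).
set w := nexp ([-] fld b12 0 (-1) [-] fld c (-1) 0) (x + 1) (diag (schar [:: Oc; Ob12]) v).
refine (etrans (_ : _ = - (qq *: (u - w))) _).
  rewrite /u /w -(phase_schar1 (ss := [:: Oc; Ob12]) v isT isT); reflexivity.
apply: opp_scaleB; solve_coef.
Qed.

Lemma Xp2E x v : Xp2 lnq k x v = series fXp2 sXp2 x v.
Proof.
refine (etrans _ (esym (sum_pair (fun t => tser t x v) _ _))).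
set u := nexp ([-] fldp b12 1 [-] fldp b13 1 [+] fld b23 1 0) x
  (diag (schar [:: Oc; Ob12; Ob13; Ob23]) v).
set w := nexp (fld b12 0 0 [+] fld b13 0 0 [+] fld c 0 0) x v.
refine (etrans (_ : _ = - u + w) _).
  rewrite /u /w -(phase_schar1 (ss := [:: Oc; Ob12; Ob13; Ob23]) v isT isT); reflexivity.
refine (etrans (oppD_scale u w _ _) (congr2 +%R (esym (tser_shift0 _ _ _ _ _ _ _))
  (esym (tser_unphased0 _ _ _ _ _ _)))); solve_coef.
Qed.

Lemma Xm1E x v : Xm1 lnq k x v = series fXm1 (sXm1 false) x v.
Proof.
refine (etrans _ (esym (sum_triple (fun t => tser t x v) _ _ _))).
set u := nexp (nth ([-] fld c 0 0) fXm1 0) (x + 1) (diag (schar [:: Oc; Ob12]) v).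
set u' := nexp (nth ([-] fld c 0 0) fXm1 1) (x + 1) (diag (schar [:: Oc; Ob12]) v).
set w := nexp (nth ([-] fld c 0 0) fXm1 2) x (diag (schar [:: Ob13; Ob23]) v).
refine (etrans (_ : _ = qq *: (u - u') + qpow (k + 1) *: w) _).
  rewrite /u /u' /w -(phase_scharN1 (ss := [:: Oc; Ob12]) v isT isT).
  rewrite -(phase_schar1 (ss := [:: Ob13; Ob23]) v isT isT); reflexivity.
refine (etrans (scaleBD u u' w _ _ _) (congr1 (fun z => _ + (_ + z))
  (esym (tser_shift0 _ _ _ _ _ _ _)))); solve_coef.
Qed.

Lemma Xm2E x v : Xm2 lnq k x v = series fXm2 (sXm2 false) x v.
Proof.
refine (etrans _ (esym (sum_quadruple (fun t => tser t x v) _ _ _ _))).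
set ss := [:: Oc; Ob12; Ob13; Ob23].
set u := nexp (nth ([-] fld c 0 0) fXm2 0) (x + 1) (diag (schar ss) v).
set u' := nexp (nth ([-] fld c 0 0) fXm2 1) (x + 1) (diag (schar ss) v).
set w := nexp (nth ([-] fld c 0 0) fXm2 2) (x + 1) v.
set w' := nexp (nth ([-] fld c 0 0) fXm2 3) (x + 1) v.
refine (etrans (_ : _ = qq *: (q *: (u - u') - (w - w'))) _).
  rewrite /u /u' -(phase_scharN1 (ss := ss) v isT isT); reflexivity.
refine (etrans (scaleBB u u' w w' _ _ _ _) (congr1 (fun z => _ + (_ + z)) (congr2 +%R
  (esym (tser_unphased1 _ _ _ _ _ _)) (esym (tser_unphased1 _ _ _ _ _ _)))));
  first [solve_coef | rewrite [in RHS]mulrC; solve_coef].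
Qed.

Lemma tS1E x v : tS1 lnq k x v = series ftS1 stS1 x v.
Proof.
refine (etrans _ (esym (sum_triple (fun t => tser t x v) _ _ _))).
set u := nexp (nth ([-] fld c 0 0) ftS1 0) (x + 1) (diag (schar [:: Oc; Ob12]) v).
set u' := nexp (nth ([-] fld c 0 0) ftS1 1) (x + 1) (diag (schar [:: Oc; Ob12]) v).
set w := nexp (nth ([-] fld c 0 0) ftS1 2) x (diag (schar [:: Ob13; Ob23]) v).
refine (etrans (_ : _ = qq *: (u - u') + q *: w) _).
  rewrite /u /u' /w -(phase_schar1 (ss := [:: Oc; Ob12]) v isT isT).
  rewrite -(phase_scharN1 (ss := [:: Ob13; Ob23]) v isT isT); reflexivity.
refine (etrans (scaleBD u u' w _ _ _) (congr1 (fun z => _ + (_ + z))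
  (esym (tser_shift0 _ _ _ _ _ _ _)))); solve_coef.
Qed.

Lemma tS2E x v : tS2 lnq k x v = series ftS2 stS2 x v.
Proof.
refine (etrans _ (esym (big_seq1 _ _ (fun t => tser t x v)))).
set ss := [:: Oc; Ob12; Ob13; Ob23].
set u := nexp (fld b23 0 0) x (diag (schar ss) v).
refine (etrans (_ : _ = - (q^-1 *: u)) _).
  rewrite /u -(phase_scharN1 (ss := ss) v isT isT); reflexivity.
refine (etrans (opp_scale u _) (esym (tser_shift0 _ _ _ _ _ _ _))); solve_coef.
Qed.

Definition fA (i : 'I_2) := [-] fld (astar lnq k i) 0 ((k + 1) / 2).
Definition fA' (i : 'I_2) := [-] fld (astar lnq k i) 0 (- ((k + 1) / 2)).

Lemma rep_fA i : rep true (fA i) (sA i).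
Proof. solve_rep. Qed.

Lemma rep_fA' i : rep true (fA' i) (sA' i).
Proof. solve_rep. Qed.

(** Satisfied by the terms of tilde S^i: they involve only b's and c, which commute with the a's.
    For the same reason their symbolic forms are the same in both normalizations. *)
Definition merge_check i (u : sterm) := [&& leqL (scontr (sA i) (sexpo u)) [::],
  szpow (sA i) (sexpo u) == 0 & skap (sA i) (sexpo u) == (0, 0)].

Lemma mergeable_sound (i : 'I_2) f s : rep false f (sexpo s) -> merge_check i s ->
  mergeable lnq k (fA i) (realized (f, s)).
Proof.
move=> rf /and3P[c0 /eqP z0 /eqP k0]; have rA := rep_fA i; split=> [l||] /=.
- have := contraction_sound l rA rf; rewrite (lev_eq _ _ _ c0) lev0 => /eqP.
  by rewrite mulf_eq0 pnatr_eq0 => /eqP.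
- by rewrite (zpow_sound rA rf) z0.
- by rewrite (zscal_sound rA rf) k0 ex0 qpow0.
Qed.

Lemma merge_series (i : 'I_2) fs ss x v : all_rep false fs ss -> all (merge_check i) ss ->
  smul (nexp (fA i)) (series fs ss) x v
  = series [seq fA i [+] f | f <- fs] [seq smerge i s | s <- ss] x v.
Proof.
move=> rfs mss; refine (etrans (smul_terms _ x v) _).
  elim: fs ss rfs mss => [|f fs IHfs] [|s ss] //= [rf bc rfs] /andP[ms mss].
  by split; [exact: mergeable_sound | exact: IHfs].
have E : [seq realized p | p <- zip [seq fA i [+] f | f <- fs] [seq smerge i s | s <- ss]]
    = [seq merge_term (fA i) t | t <- [seq realized p | p <- zip fs ss]].
  by elim: fs ss {rfs mss} => [|f fs IHfs] [|s ss] //=; rewrite IHfs.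
refine (etrans _ (congr1 (fun r => \sum_(t <- r) tser t x v) (esym E))).
exact: (esym (big_map (merge_term (fA i)) xpredT (fun t => tser t x v))).
Qed.

Definition fS (j : 'I_2) := [seq fA j [+] f | f <- if j == 0 then ftS1 else ftS2].
Definition sS (j : 'I_2) := [seq smerge j s | s <- if j == 0 then stS1 else stS2].

Lemma screenE j x v : screen lnq k j x v = series (fS j) (sS j) x v.
Proof.
rewrite /fS /sS; case: j => -[|[|//]] lt2.
- have E : tS1 lnq k = series ftS1 stS1.
    by apply: funext => y; apply: funext => w; exact: tS1E.
  refine (etrans (_ : _ = smul (nexp (fA _)) (series ftS1 stS1) x v)
    (merge_series _ _ (all_rep_tS1 _) _)).
    by rewrite -E.
  by vm_compute.
have E : tS2 lnq k = series ftS2 stS2.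
  by apply: funext => y; apply: funext => w; exact: tS2E.
refine (etrans (_ : _ = smul (nexp (fA _)) (series ftS2 stS2) x v)
  (merge_series _ _ (all_rep_tS2 _) _)).
  by rewrite -E.
by vm_compute.
Qed.

Lemma all_rep_merge (i : 'I_2) fs ss : all_rep true fs ss ->
  all_rep true [seq fA i [+] f | f <- fs] [seq smerge i s | s <- ss].
Proof.
elim: fs ss => [|f fs IHfs] [|s ss] //= [rf bc rfs]; split=> //; last exact: IHfs.
exact: rep_add (rep_fA i) rf.
Qed.

Lemma all_rep_S j : all_rep true (fS j) (sS j).
Proof.
apply: all_rep_merge; case: ifP => _; [exact: all_rep_tS1 | exact: all_rep_tS2].
Qed.

Lemma tser_linear t x : linear (tser t x).
Proof.
move=> a u v; rewrite /tser (linearP (diag (char t))) (linearP (nexp _ _)) /=.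
by rewrite scalerDr !scalerA mulrC.
Qed.
HB.instance Definition _ t x := GRing.isLinear.Build C fock fock _ (tser t x) (tser_linear t x).

Lemma scomm_series (s t b : bool) X Y fX sX fY sY x y (v : fock) : s && t = b ->
  (forall z w, X z w = series fX sX z w) -> (forall z w, Y z w = series fY sY z w) ->
  scomm s t (X x) (Y y) v
  = \sum_(f <- zip fX sX) \sum_(g <- zip fY sY)
      (tser (realized f) x (tser (realized g) y v)
       - (-1) ^+ b *: tser (realized g) y (tser (realized f) x v)).
Proof.
move=> st XE YE; rewrite /scomm (_ : (-1) ^+ (s * t) = (-1) ^+ b :> C); last by rewrite -st -mulnb.
rewrite !XE !YE.
pose F p : {linear fock -> fock} := tser (realized p) x.
pose G p : {linear fock -> fock} := tser (realized p) y.
have XF w : series fX sX x w = \sum_(p <- zip fX sX) F p w.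
  exact: (big_map realized xpredT (fun t => tser t x w)).
have YG w : series fY sY y w = \sum_(p <- zip fY sY) G p w.
  exact: (big_map realized xpredT (fun t => tser t y w)).
refine (etrans _ (sum_commutator (zip fX sX) (zip fY sY) F G ((-1) ^+ b) v)).
apply: (congr2 (fun z z' => z - _ *: z')).
  by refine (etrans (XF _) _); rewrite YG.
by refine (etrans (YG _) _); rewrite XF.
Qed.

Lemma kres_row_sound b Ks t st st' fs ss x y (v : fock) :
  term_rep false t st -> rep true (expo t) (sexpo st') -> all_rep true fs ss ->
  kcheck_row b Ks st ss ->
  \sum_(g <- zip fs ss) (tser t x (tser (realized g) y v)
       - (-1) ^+ b *: tser (realized g) y (tser t x v))
  = \sum_(r <- kres_row Ks st st' ss) rser r x y v.
Proof.
move=> tP tP'; elim: fs ss Ks => [|g fs IHfs] [|s ss] [|K Ks] //=.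
  by rewrite [RHS]big_nil [LHS]big_nil.
case=> rg bc rfs /andP[/eqP[sz] /= /andP[chk chks]].
refine (etrans (sum_cons _ _ _) (etrans _ (esym (sum_cat _ _ _)))).
apply: (congr2 +%R).
  exact: (bracket_sound q_not_root k_generic k1_neq0 x y v tP tP' (realized_rep rg bc) chk).
by apply: IHfs; rewrite // /kcheck_row sz eqxx.
Qed.

Lemma ktable_sound b Kss fs ts ts' us ss x y (v : fock) :
  all_rep false fs ts -> all_rep true fs ts' -> all_rep true us ss ->
  ktable_check b Kss ts ss ->
  \sum_(f <- zip fs ts) \sum_(g <- zip us ss)
      (tser (realized f) x (tser (realized g) y v)
       - (-1) ^+ b *: tser (realized g) y (tser (realized f) x v))
  = \sum_(r <- ktable Kss ts ts' ss) rser r x y v.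
Proof.
move=> + + uss; elim: fs ts ts' Kss => [|f fs IHfs] [|t ts] [|t' ts'] [|Ks Kss] //=.
  by rewrite [RHS]big_nil [LHS]big_nil.
case=> rf bc rfs [rf' _ rfs'] /andP[chk chks].
refine (etrans (sum_cons _ _ _) (etrans _ (esym (sum_cat _ _ _)))).
apply: (congr2 +%R); last exact: IHfs.
exact: (kres_row_sound x y v (realized_rep rf bc) rf' uss chk).
Qed.

Lemma rser_neg r x y (v : fock) : rser (rneg r) x y v = - rser r x y v.
Proof.
have E : rscal lnq k (rneg r) x = - rscal lnq k r x.
  rewrite /rscal /=; case: ifP => _; last by rewrite oppr0.
  by rewrite /lev lsum_neg !mulNr.
exact: (etrans (congr1 (fun a => a *: _) E) (scaleNr _ _)).
Qed.

Lemma vanish_eq n D rs rs' x y (v : fock) : vanish n D (rs ++ map rneg rs') ->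
  \sum_(r <- rs) rser r x y v = \sum_(r <- rs') rser r x y v.
Proof.
move=> /(vanish_sound q_not_root k_generic k1_neq0 x y v) E.
apply/eqP; rewrite -subr_eq0; apply/eqP; refine (etrans _ E).
refine (etrans _ (esym (sum_cat _ _ _))); apply: (congr1 (GRing.add _)).
refine (etrans _ (esym (big_map _ _ _))); rewrite -sumrN.
by apply: eq_bigr => r _; rewrite rser_neg.
Qed.

Lemma delta_mulE (A : fseries R) x y (v : fock) :
  delta_mul A x y v = if is_int x then A (y + x) v else 0.
Proof.
rewrite /delta_mul; case: ifP => [/asboolP[a xa]|/asboolPn x_out].
  rewrite (_ : [set n : int | x = - n%:~R]%classic = [set (- a)%R]%classic); last first.
    apply/seteqP; split=> [n /= xn|n /= ->]; last by rewrite xa mulrNz opprK.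
  by apply: (@intr_inj C); rewrite mulrNz -xa xn opprK.
  by rewrite fsbig_set1 mulrNz opprK xa.
rewrite (_ : [set n : int | x = - n%:~R]%classic = set0) ?fsbig_set0 //.
by apply/seteqP; split=> n //= xn; case: x_out; exists (- n); rewrite rmorphN.
Qed.

Lemma total_diffE i x y (v : fock) :
  total_diff lnq k i x y v = \sum_(r <- stotal i) rser r x y v.
Proof.
refine (etrans _ (esym (sum_pair (fun r => rser r x y v) _ _))).
pose W := nexp (fA' i) (x + y + 2%:~R) v.
have qW l : nexp (realize lnq k (ssubst l (sA' i))) (x + y + 2%:~R) (diag (schar [::]) v)
    = qpow (ex l * (x + y + 2%:~R)) *: W.
  refine (etrans (etrans (congr1 (nexp _ _) (diag_schar0 v)) _) (nexp_qsubst lnq k (ex l) (fA' i) _ v)).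
  refine (nexp_rep_eq q_not_root k_generic k1_neq0
    (rep_realize q_not_root k_generic k1_neq0 _) _ (seq_equiv_refl _) _ _).
  exact: rep_subst (rep_fA' i).
pose B := delta_mul (nexp (fA' i)) (x + 1) (y + 1) v.
have E : total_diff lnq k i x y v
    = qq *: (qpow ((k + 1) * (y + 1)) *: - B - qpow (- (k + 1) * (y + 1)) *: - B) by [].
refine (etrans E (etrans _ (congr2 (fun z z' => rscal lnq k _ x *: z + rscal lnq k _ x *: z')
  (esym (qW (2, 2))) (esym (qW (-2, -2)))))).
have BE : B = (if is_int x then 1 else 0) *: W.
  refine (etrans (delta_mulE _ _ _ _) _); rewrite (is_int_addn x 1); case: ifP => _.
    by rewrite scale1r /W; congr (nexp _ _ v); ring.
  by rewrite scale0r.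
refine (etrans (congr1 (fun w => qq *: (_ *: - w - _ *: - w)) BE) _).
apply: total_shape; rewrite /rscal /=; case: ifP => _; last by rewrite !mulr0 !mul0r subr0 addr0.
have e1 : ex (2, 2) = k + 1 by exact: ex22.
have e2 : ex (-2, -2) = - (k + 1) by rewrite (exN k (2, 2)) ex22.
rewrite !lev1 !expr1 /qex !mulr1 e1 e2 rmorph1 rmorphN1 mulN1r mul1r.
(* The exponent is redistributed into the prefactor q^(-k-1), the power of the pole and the dilation
   of [W], whose argument is x + y + 2. *)
have -> : qpow ((k + 1) * (y + 1))
    = qpow (- (k + 1)) * qpow (- ((k + 1) * x)) * qpow ((k + 1) * (x + y + 2%:~R)).
  by rewrite -!qpowD; congr Defs.qpow; ring.
have -> : qpow (- (k + 1) * (y + 1))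
    = qpow (k + 1) * qpow (- (- (k + 1) * x)) * qpow (- (k + 1) * (x + y + 2%:~R)).
  by rewrite -!qpowD; congr Defs.qpow; ring.
ring.
Qed.

Lemma scomm_check b Kss n D X fX sX j rs x y (s t : bool) (v : fock) : s && t = b ->
  (forall z w, X z w = series fX (sX false) z w) -> (forall fl, all_rep fl fX (sX fl)) ->
  ktable_check b Kss (sX false) (sS j) ->
  vanish n D (ktable Kss (sX false) (sX true) (sS j) ++ map rneg rs) ->
  scomm s t (X x) (screen lnq k j y) v = \sum_(r <- rs) rser r x y v.
Proof.
move=> st XE rX chk van.
refine (etrans (scomm_series x y v st XE (screenE j)) _).
refine (etrans (ktable_sound x y v (rX false) (rX true) (all_rep_S j) chk) _).
exact: vanish_eq van.
Qed.

Lemma Xp_relation i j x y (v : fock) :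
  scomm (parity i) (parity j) (Xp lnq k i x) (screen lnq k j y) v = 0.
Proof.
(* The goals left to computation concern closed symbolic data only. The values 20 and 4 are ample
   bounds for the number of groups of residues and for the powers of 1 / (q - q^-1). *)
rewrite /Xp; case: i j => -[|[|//]] lti [] [|[|//]] ltj.
- refine (etrans (scomm_check (b := false) (Kss := Kp11) (n := 20) (D := 4) (rs := [::]) x y v
    _ Xp1E all_rep_Xp1 _ _) _); [by [] | by vm_compute | by vm_compute | exact: big_nil].
- refine (etrans (scomm_check (b := false) (Kss := Kp12) (n := 20) (D := 4) (rs := [::]) x y v
    _ Xp1E all_rep_Xp1 _ _) _); [by [] | by vm_compute | by vm_compute | exact: big_nil].
- refine (etrans (scomm_check (b := false) (Kss := Kp21) (n := 20) (D := 4) (rs := [::]) x y v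
    _ Xp2E all_rep_Xp2 _ _) _); [by [] | by vm_compute | by vm_compute | exact: big_nil].
- refine (etrans (scomm_check (b := true) (Kss := Kp22) (n := 20) (D := 4) (rs := [::]) x y v
    _ Xp2E all_rep_Xp2 _ _) _); [by [] | by vm_compute | by vm_compute | exact: big_nil].
Qed.

Lemma Xm_relation i j x y (v : fock) :
  scomm (parity i) (parity j) (Xm lnq k i x) (screen lnq k j y) v
  = (i == j)%:R *: total_diff lnq k j x y v.
Proof.
rewrite /Xm; case: i j => -[|[|//]] lti [] [|[|//]] ltj.
- refine (etrans (scomm_check (b := false) (Kss := Km11) (n := 20) (D := 4) (rs := stotal 0) x y v
    _ Xm1E all_rep_Xm1 _ _) (etrans _ (esym (scale1r _))));
    [by [] | by vm_compute | by vm_compute | refine (esym (total_diffE (Ordinal ltj) x y v))].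
- refine (etrans (scomm_check (b := false) (Kss := Km12) (n := 20) (D := 4) (rs := [::]) x y v
    _ Xm1E all_rep_Xm1 _ _) (etrans _ (esym (scale0r _))));
    [by [] | by vm_compute | by vm_compute | exact: big_nil].
- refine (etrans (scomm_check (b := false) (Kss := Km21) (n := 20) (D := 4) (rs := [::]) x y v
    _ Xm2E all_rep_Xm2 _ _) (etrans _ (esym (scale0r _))));
    [by [] | by vm_compute | by vm_compute | exact: big_nil].
- refine (etrans (scomm_check (b := true) (Kss := Km22) (n := 20) (D := 4) (rs := stotal 1) x y v
    _ Xm2E all_rep_Xm2 _ _) (etrans _ (esym (scale1r _))));
    [by [] | by vm_compute | by vm_compute | refine (esym (total_diffE (Ordinal ltj) x y v))].
Qed.

End Currents.

(** * The Cartan generators *)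

Definition schi (i : nat) (s : nat) : laurent :=
  match i, s with
  | 0, 0 | _.+1, 1 => [:: (1, (-1, 0))]
  | 0, 2 => [:: (1, (0, -1)); (1, (-4, -1))]
  | 0, 3 => [:: (1, (-4, -1))]
  | 0, 4 | _.+1, 2 | _.+1, 3 => [:: (-1, (-2, -1))]
  | _, _ => [::]
  end.

Definition schi0 (i : nat) (s : nat) : int :=
  match i, s with
  | 0, 0 | 0, 3 | _.+1, 1 => 1
  | 0, 2 => 2
  | 0, 4 | _.+1, 2 | _.+1, 3 => -1
  | _, _ => 0
  end.

(** h^i is written in the form of an exponent, though it is not exponentiated, to reuse the symbolic
    contractions; (q - q^-1) [m] = q^m - q^-m makes its coefficients polynomial. The [slnz] part
    holds h^i_0, so that [szpow] computes the charge of a term. *)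
Definition sH (i : nat) := SExponent (fun s => lmul (schi i s) qq_laurent)
  (fun s => lmul (schi i s) qq_laurent) (fun=> 0) (fun=> (0, 0)) (schi0 i).

Definition h_check (i : nat) (u : sterm) : bool :=
  [&& leqL (scontr (sH i) (sexpo u)) [::], leqL (scontr (sexpo u) (sH i)) [::]
    & szpow (sH i) (sexpo u) == 0].

Section Shapes.
Variables (F : comPzRingType) (V : lmodType F).
Implicit Types (a b c d : F) (u v w x y z : V).

Lemma add_scale0 u v : u + (0 : F) *: v = u.
Proof. by rewrite scale0r addr0. Qed.

Lemma sum_osc6 (G : osc -> V) : \sum_(s : osc) G s =
  G (Oa 0) + (G (Oa 1) + (G Ob12 + (G Ob13 + (G Ob23 + G Oc)))).
Proof. by rewrite sum_osc /idxs /= !big_cons big_nil addr0. Qed.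

Lemma hgen0_shape a b c d u v w x y z : a *: u + b *: v + c *: w - d *: x
  = a *: u + (0 *: y + (b *: v + (c *: w + (- d *: x + 0 *: z)))).
Proof. by rewrite !scale0r add0r addr0 scaleNr !addrA. Qed.

Lemma hgen1_shape a b c u v w x y z : a *: u - b *: v - c *: w
  = 0 *: y + (a *: u + (- b *: v + (- c *: w + (0 *: x + 0 *: z)))).
Proof. by rewrite !scale0r add0r !addr0 !scaleNr !addrA. Qed.

Lemma commute_shape (T N D : {linear V -> V}) a b v :
  (forall w, T (N w) = N (T w)) -> (forall w, D (T w) = T (D w)) ->
  a *: T (b *: N (D v)) = b *: N (D (a *: T v)).
Proof. by move=> TN DT; rewrite (linearZZ T) (linearZZ D) (linearZZ N) /= DT TN !scalerA mulrC. Qed.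

End Shapes.

Section Cartan.
Variable R : realType.
Local Notation C := R[i].
Local Notation label := (label R).
Local Notation fock := (fock R).
Variables lnq k : C.
Local Notation qpow := (qpow lnq).
Local Notation qnum := (qnum lnq).
Local Notation q := (qpow 1).
Local Notation mode := (mode lnq k).
Local Notation nexp := (nexp lnq k).
Local Notation ann := (ann lnq k).
Local Notation cre := (cre lnq k).
Local Notation ex := (ex k).
Local Notation rep := (rep lnq k).
Local Notation lev := (lev lnq k).
Local Notation tser := (tser lnq k).
Local Notation zpow := (zpow k).

(** T preserves labels, hence the scalars of the zero modes, and commutes with every other
    factor. *)
Lemma nexp_commute (T : {linear fock -> fock}) (d : int) g :
  (forall l v, T (cre g l v) = cre g l (T v)) -> (forall l v, T (ann g l v) = ann g l (T v)) ->
  (forall v, T (translate (Qpart g) v) = translate (Qpart g) (T v)) ->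
  (forall p D v, homog p D v -> homog p (D + d) (T v)) ->
  forall y v, T (nexp g y v) = nexp g y (T v).
Proof.
move=> Tc Ta Tt Th y; apply: (eq_linear (S := T \o nexp g y) (T := nexp g y \o T)) => b.
have hb := homogU b; have hTb := Th _ _ _ hb.
have [[a ya]|y_out] := pselect (exists a : int, y = zpow g b.1 + a%:~R); last first.
  have yF (a : int) : y != zpow g b.1 + a%:~R by apply/eqP => ya; apply: y_out; exists a.
  refine (etrans (etrans (congr1 T (nexp_out_homog lnq hb yF)) (linear0 T)) _).
  exact: (esym (nexp_out_homog lnq hTb yF)).
(* T changes the energy by d, so the two expansions need a bound above both energies. *)
pose B := (energy_of b.2 + `|d|).+1%N.
have lt1 : ((energy_of b.2)%:Z < B%:Z) by rewrite /B; lia.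
have lt2 : ((energy_of b.2)%:Z + d < B%:Z) by rewrite /B; lia.
rewrite ya; refine (etrans (congr1 T (nexp_homog lnq k g a hb lt1)) _).
refine (etrans _ (esym (nexp_homog lnq k g a hTb lt2))).
refine (etrans (linearZZ T _ _) _) => /=; apply: scale_congr; first by [].
refine (etrans (linear_sum T _ _ _) _); apply: eq_bigr => n _.
refine (etrans (ezexp_commute Tc _ _) _); apply: (congr1 (ecrez lnq k g _)).
refine (etrans (Tt _) _); apply: (congr1 (translate _)).
exact: (eexp_commute Ta).
Qed.

Lemma diag_commute (h : label -> C) (T : {linear fock -> fock}) :
  (forall b, exists D, homog b.1 D (T (ket b))) -> forall v, diag h (T v) = T (diag h v).
Proof.
move=> Th; apply: (eq_linear (S := diag h \o T) (T := T \o diag h)) => b.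
have [D hT] := Th b.
refine (etrans (homog_diag h hT) _); apply: esym.
exact: (etrans (congr1 T (diagU h b)) (linearZZ T _ _)).
Qed.

Lemma ann_nexp H g l y v : (forall l, contraction lnq k H g l = 0) ->
  ann H l (nexp g y v) = nexp g y (ann H l v).
Proof.
move=> c0; apply: (@nexp_commute (ann H l) (- l.+1%:Z)) => [m w|m w|w|p D w hw].
- refine (etrans (ann_cre lnq k H g l m w) _); rewrite c0 if_same; exact: add_scale0.
- exact: ann_commuting.
- exact: (esym (translate_ann lnq k _ H l w)).
- exact: homog_ann.
Qed.

Lemma cre_nexp H g l y v : (forall l, contraction lnq k g H l = 0) ->
  cre H l (nexp g y v) = nexp g y (cre H l v).
Proof.
move=> c0; apply: (@nexp_commute (cre H l) l.+1%:Z) => [m w|m w|w|p D w hw].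
- exact: cre_commuting.
- apply: esym; refine (etrans (ann_cre lnq k g H m l w) _); case: eqP => _; rewrite ?c0;
    exact: add_scale0.
- exact: (esym (translate_cre lnq k _ H l w)).
- exact: homog_cre.
Qed.

Lemma zero_nexp H g y v : zpow H (Qpart g) = 0 ->
  diag (zpow H) (nexp g y v) = nexp g y (diag (zpow H) v).
Proof.
move=> z0; apply: (@nexp_commute (diag (zpow H)) 0) => [m w|m w|w|p D w hw].
- apply: diag_commute => b; eexists; exact: (homog_cre lnq k g m (homogU b)).
- apply: diag_commute => b; eexists; exact: (homog_ann lnq k g m (homogU b)).
- refine (etrans (diag_translate _ _ _) _); apply: (congr1 (fun h => translate _ (diag h w))).
  by apply: funext => p; rewrite zpowD z0 addr0.
- by rewrite addr0; exact: (eq_ind _ (homog p D) (homogZ _ hw) _ (esym (homog_diag (zpow H) hw))).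
Qed.

Definition chi (i : 'I_2) (s : osc) (M : C) : C :=
  if i == 0 then
    match s with
    | Oa j => if j == 0 then qpow (- (M / 2)) else 0
    | Ob12 => qpow (- ((k / 2 + 1) * M)) * (qpow M + qpow (- M))
    | Ob13 => qpow (- ((k / 2 + 2) * M))
    | Ob23 => - qpow (- ((k / 2 + 1) * M))
    | Oc => 0
    end
  else
    match s with
    | Oa j => if j == 0 then 0 else qpow (- (M / 2))
    | Ob12 | Ob13 => - qpow (- ((k / 2 + 1) * M))
    | Ob23 | Oc => 0
    end.

Lemma hgen_chi i m v : hgen lnq k i m v = \sum_(s : osc) chi i s `|m|%N%:R *: mode s m v.
Proof.
refine (etrans _ (esym (sum_osc6 _))); rewrite /hgen /chi; case: (i == 0).
  exact: hgen0_shape.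
exact: hgen1_shape.
Qed.

(* (q - q^-1) h^i as an exponent *)
Definition fH (i : 'I_2) : exponent R := Exponent
  (fun s n => (q - q^-1) * chi i s `|n|%N%:R) 0 (fun=> 0) (fun s => chi i s 0).

Hypothesis q_not_root : forall n : nat, (0 < n)%N -> q ^+ n != 1.

Lemma lev_schi (i : 'I_2) s m : chi i s m = lev (schi i (osc_idx s)) m.
Proof.
have ex1 : ex (-1, 0) = - (1 / 2) by rewrite /ex /=; field.
have ex2 : ex (0, -1) = - (k / 2 + 1) + 1 by rewrite /ex /=; field.
have ex4 : ex (-4, -1) = - (k / 2 + 1) - 1 by rewrite /ex /=; field.
have ex3 : ex (-2, -1) = - (k / 2 + 1) by rewrite /ex /=; field.
move: s; case: i => -[|[|//]] lti; apply: osc_ind2;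
  rewrite /chi /schi /= ?lev0 ?lev1 ?lev2 ?rmorph1 ?rmorphN1 ?mul1r ?mulN1r /qex ?ex1 ?ex2 ?ex3 ?ex4 //.
- by congr Defs.qpow; ring.
- by rewrite mulrDr -!qpowD; congr (Defs.qpow _ _ + Defs.qpow _ _); ring.
- by congr Defs.qpow; ring.
- by congr (- Defs.qpow _ _); ring.
- by congr Defs.qpow; ring.
- by congr (- Defs.qpow _ _); ring.
- by congr (- Defs.qpow _ _); ring.
Qed.

Lemma chi0 (i : 'I_2) s : chi i s 0 = (schi0 i (osc_idx s))%:~R.
Proof.
move: s; case: i => -[|[|//]] lti; apply: osc_ind2;
  by rewrite /chi /= ?mul0r ?mulr0 ?oppr0 ?qpow0 ?mul1r ?rmorphN1.
Qed.

Lemma rep_fH i : rep false (fH i) (sH i).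
Proof.
have scaled s l : (q - q^-1) * chi i s l.+1%:R * den lnq k false s l.+1%:R
    = lev (lmul (schi i (osc_idx s)) qq_laurent) l.+1%:R.
  rewrite mulrAC (den_qq k q_not_root) mulrC levM lev_schi lev2 rmorph1 rmorphN1 mul1r mulN1r.
  by rewrite (_ : sden false s = (2, 0)) //; case: s.
split=> [s l|s l|s|s|s]; [exact: scaled | exact: scaled |..].
- by rewrite coord0 mul0r.
- by rewrite mul0r ex0 mulr0.
- by rewrite (_ : den0 k false s = 1) ?mulr1; [exact: chi0 | case: s].
Qed.

Lemma contraction_eq0 fl f g u w : rep fl f u -> rep (~~ fl) g w ->
  leqL (scontr u w) [::] -> forall l, contraction lnq k f g l = 0.
Proof.
move=> rf rg c0 l; have := contraction_sound l rf rg; rewrite (lev_eq _ _ _ c0) lev0 => /eqP.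
by rewrite mulf_eq0 pnatr_eq0 => /eqP.
Qed.

(** A common interface for n = 0, n > 0 and n < 0, where [T] is respectively diagonal, an
    annihilator or a creator. *)
Definition hgen_like i n (a : C) (T : {linear fock -> fock}) :=
  [/\ forall v, hgen lnq k i n v = a *: T v,
    forall h v, diag h (T v) = T (diag h v)
    & forall f s, rep true f (sexpo s) -> h_check i s ->
        forall z v, T (nexp f z v) = nexp f z (T v)].

Lemma hgen_linear i n : linear (hgen lnq k i n).
Proof.
move=> a u v; rewrite !hgen_chi scaler_sumr -big_split; apply: eq_bigr => s _ /=.
by rewrite linearP scalerDr !scalerA mulrC.
Qed.
HB.instance Definition _ i n := GRing.isLinear.Build C fock fock _ (hgen lnq k i n) (hgen_linear i n).

Lemma hgen_opP i n : exists a T, hgen_like i n a T.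
Proof.
have q0 := qq_neq0 q_not_root; have rH := rep_fH i.
have scaled m v : hgen lnq k i m v = (q - q^-1)^-1 *: \sum_(s : osc)
    ((q - q^-1) * chi i s `|m|%N%:R) *: mode s m v.
  refine (etrans (hgen_chi _ _ _) _); rewrite scaler_sumr; apply: eq_bigr => s _.
  by rewrite scalerA mulKf.
case: n => [[|l]|l].
- exists 1, (diag (zpow (fH i))); split=> [|h v|f s rf /and3P[_ _ /eqP z0] z v].
  + apply: eq_on_kets; [exact: hgen_linear | exact: (linearP (1 \*: diag (zpow (fH i)))) |].
    move=> b; refine (etrans (hgen_chi _ _ _) _); rewrite scale1r.
    refine (etrans _ (esym (diagU (zpow (fH i)) b))).
    rewrite /zpow scaler_suml; apply: eq_bigr => s _ /=.
    exact: (etrans (congr1 (GRing.scale _) (diagU _ b)) (scalerA _ _ _)).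
  + apply: diag_commute => b; exists (energy_of b.2).
    exact: (eq_ind _ (homog _ _) (homogZ _ (homogU b)) _ (esym (diagU _ b))).
  + by apply: zero_nexp; rewrite (zpow_sound rH rf) z0.
- exists (q - q^-1)^-1, (ann (fH i) l); split=> [v|h v|f s rf /and3P[c0 _ _] z v].
  + exact: scaled.
  + apply: diag_commute => b; eexists; exact: (homog_ann lnq k _ l (homogU b)).
  + apply: ann_nexp; exact: (contraction_eq0 rH rf c0).
- exists (q - q^-1)^-1, (cre (fH i) l); split=> [v|h v|f s rf /and3P[_ c0 _] z v].
  + exact: scaled.
  + apply: diag_commute => b; eexists; exact: (homog_cre lnq k _ l (homogU b)).
  + apply: cre_nexp; exact: (contraction_eq0 rf rH c0).
Qed.

Hypothesis k_generic : forall m : nat, (0 < m)%N -> qnum ((k + 1) * m%:R) != 0.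
Hypothesis k1_neq0 : k + 1 != 0.

Lemma hgen_tser (i : 'I_2) n f s y v : rep true f (sexpo s) -> h_check i s ->
  hgen lnq k i n (tser (realized lnq k (f, s)) y v) = tser (realized lnq k (f, s)) y (hgen lnq k i n v).
Proof.
move=> rf chk; have [a [T [TE Td Tn]]] := hgen_opP i n.
refine (etrans (TE _) (etrans _ (esym (congr1 (tser _ y) (TE v))))).
apply: (commute_shape (T := T) (N := nexp f _) (D := diag _)); first exact: (Tn _ _ rf chk).
exact: Td.
Qed.

Lemma hgen_series (i : 'I_2) n fs ss y v : all_rep lnq k true fs ss -> all (h_check i) ss ->
  hgen lnq k i n (series lnq k fs ss y v) = series lnq k fs ss y (hgen lnq k i n v).
Proof.
move=> rfs chk; rewrite /series; refine (etrans (linear_sum (hgen lnq k i n) _ _ _) _) => /=.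
elim: fs ss rfs chk => [|f fs IHfs] [|s ss] //=.
  by move=> _ _; rewrite [LHS]big_nil [RHS]big_nil.
case=> rf bc rfs /andP[chk chks].
refine (etrans (sum_cons _ _ _) (etrans _ (esym (sum_cons _ _ _)))).
by apply: (congr2 +%R); [exact: hgen_tser | exact: IHfs].
Qed.

Lemma h_relation i j n y v :
  scomm false (parity j) (hgen lnq k i n) (screen lnq k j y) v = 0.
Proof.
rewrite /scomm mul0n expr0; refine (etrans (congr1 (fun w => _ - w) (scale1r _)) _).
apply/eqP; rewrite subr_eq0; apply/eqP.
refine (etrans (congr1 _ (screenE q_not_root k_generic k1_neq0 j y v)) _).
refine (etrans (hgen_series _ _ _ _ _) (esym (screenE q_not_root k_generic k1_neq0 j y _))).
  exact: all_rep_S.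
by case: i j => -[|[|//]] lti [] [|[|//]] ltj; vm_compute.
Qed.

End Cartan.

Theorem theorem3 (R : realType) (lnq k : R[i])
    (q_not_root_of_unity : forall n : nat, (0 < n)%N -> qpow lnq 1 ^+ n != 1)
    (k_generic : forall m : nat, (0 < m)%N -> qnum lnq ((k + 1) * m%:R) != 0)
    (k_neq0 : k != 0) (k_neqN1 : k != -1) (i j : 'I_2) :
  [/\ (forall (n : int) (y : R[i]) (v : fock R),
         scomm false (parity j) (hgen lnq k i n) (screen lnq k j y) v = 0),
      (forall (x y : R[i]) (v : fock R),
         scomm (parity i) (parity j) (Xp lnq k i x) (screen lnq k j y) v = 0)
    & (forall (x y : R[i]) (v : fock R),
         scomm (parity i) (parity j) (Xm lnq k i x) (screen lnq k j y) v
         = (i == j)%:R *: total_diff lnq k j x y v)].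
Proof.
have k1_neq0 : k + 1 != 0 by rewrite addr_eq0.
split=> [n y v|x y v|x y v]; [exact: h_relation | exact: Xp_relation | exact: Xm_relation].
Qed.
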